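(* For every $\boldsymbol{F}\in L^2(\mathbb{R}^2_+)^{2\times 2}$ there exists a weak solution $\boldsymbol{u}=(u_1,u_2)\in \dot H^1_{0,\sigma}(\mathbb{R}^2_+)$ to the stationary Navier-Stokes equations with forcing $\boldsymbol{F}$ satisfying $$\|\nabla \boldsymbol{u}\|_{L^2(\mathbb{R}^2_+)}^2\le \langle \nabla\boldsymbol{u},\boldsymbol{F}\rangle_{L^2(\mathbb{R}^2_+)}$$ and $$\|\nabla\boldsymbol{u}\|_{L^2(\mathbb{R}^2_+)}\le \|\boldsymbol{F}\|_{L^2(\mathbb{R}^2_+)},\qquad \|\boldsymbol{u}\|_{L^2(\mathbb{R}^2_+,\omega^{-1})}\le 4\|\boldsymbol{F}\|_{L^2(\mathbb{R}^2_+)}$$ for any $\omega\in\{\omega_0,\omega_1,\omega_2\}$.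
   Context: Let $\mathbb{R}^2_+=\{\boldsymbol{x}=(x_1,x_2)\in\mathbb{R}^2: x_2>0\}$. Let $C^\infty_{c,\sigma}(\mathbb{R}^2_+)$ be the set of compactly supported smooth vector fields $\boldsymbol{\varphi}:\mathbb{R}^2_+\to\mathbb{R}^2$ with $\nabla\cdot\boldsymbol{\varphi}=0$. The homogeneous Sobolev space is $\dot H^1(\mathbb{R}^2_+)=\{u\in L^1_{\mathrm{loc}}(\mathbb{R}^2_+):\nabla u\in L^2(\mathbb{R}^2_+)\}$ with semi-norm $\|\nabla u\|_{L^2(\mathbb{R}^2_+)}$. $\dot H^1_{0,\sigma}(\mathbb{R}^2_+)$ denotes the completion of $C^\infty_{c,\sigma}(\mathbb{R}^2_+)$ in $\dot H^1(\mathbb{R}^2_+)\times\dot H^1(\mathbb{R}^2_+)$; by Hardy's inequality the semi-norm is a norm on it, and its elements are identified with functions (limits $\boldsymbol v$ of sequences $\boldsymbol\varphi_k\in C^\infty_{c,\sigma}(\mathbb{R}^2_+)$ with $\nabla\boldsymbol\varphi_k\to\nabla\boldsymbol v$ in $L^2$ and $\boldsymbol\varphi_k\to\boldsymbol v$ in $L^2_{\mathrm{loc}}$). The equations are $-\Delta\boldsymbol{u}+(\boldsymbol{u}\cdot\nabla)\boldsymbol{u}+\nabla P+\operatorname{div}(\boldsymbol{F})=0$, $\nabla\cdot\boldsymbol{u}=0$ in $\mathbb{R}^2_+$, $\boldsymbol{u}=0$ on $\partial\mathbb{R}^2_+$. For $\boldsymbol{F}=(\boldsymbol{F}_1,\boldsymbol{F}_2)\in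 L^2(\mathbb{R}^2_+)^{2\times2}$ with $\boldsymbol{F}_i=(F_{i1},F_{i2})$, a vector field $\boldsymbol{u}=(u_1,u_2)\in\dot H^1_{0,\sigma}(\mathbb{R}^2_+)$ is a weak solution if $$\sum_{i=1}^2\int_{\mathbb{R}^2_+}\big(\nabla u_i\cdot\nabla\varphi_i+(\boldsymbol{u}\cdot\nabla)u_i\,\varphi_i\big)\,d\boldsymbol{x}=\sum_{i=1}^2\int_{\mathbb{R}^2_+}\boldsymbol{F}_i\cdot\nabla\varphi_i\,d\boldsymbol{x}$$ for all $\boldsymbol{\varphi}=(\varphi_1,\varphi_2)\in C^\infty_{c,\sigma}(\mathbb{R}^2_+)$. Here $\langle\nabla\boldsymbol{u},\boldsymbol{F}\rangle_{L^2(\mathbb{R}^2_+)}=\sum_{i=1}^2\int_{\mathbb{R}^2_+}\nabla u_i\cdot\boldsymbol{F}_i\,d\boldsymbol{x}$. Weights: $\omega_0(\boldsymbol{x})=\frac{|x_2|^2|\boldsymbol{x}|}{|x_2|+4|\boldsymbol{x}|}$, $\omega_1(\boldsymbol{x})=|x_2||\boldsymbol{x}|$, $\omega_2(\boldsymbol{x})=|x_2|^2/4$. For a weight $\mu$, $\|f\|_{L^2(\mathbb{R}^2_+,\mu)}=\big(\int_{\mathbb{R}^2_+}|f(\boldsymbol{x})|^2\mu(\boldsymbol{x})\,d\boldsymbol{x}\big)^{1/2}$. *)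

(* Defs.v *)
From mathcomp Require Import all_boot all_order all_algebra.
From mathcomp Require Import all_classical all_reals all_analysis.

Set Implicit Arguments.
Unset Strict Implicit.
Unset Printing Implicit Defensive.

Import Order.TTheory GRing.Theory Num.Theory.
Import numFieldNormedType.Exports.

Local Open Scope classical_set_scope.
Local Open Scope ring_scope.

(* Indices 0 and 1 of ['I_2] stand for the coordinates x_1 and x_2.
   A vector field is a family ['I_2 -> R * R -> R]; a tensor field is a family
   indexed by pairs, [F (i, j)] being F_ij and [Du (i, j)] being d_j u_i. *)
Definition std_vec (R : realType) (j : 'I_2) : R * R :=
  ((j == 0)%:R, (j == 1)%:R).

Definition halfplane (R : realType) : set (R * R) := [set x | 0 < x.2].
Arguments halfplane : clear implicits.

(* [plane R] is [R * R] with the measurable structure that carries the product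
   Lebesgue measure; it is convertible to [R * R]. *)
Notation plane R := (measurableTypeR R * measurableTypeR R)%type.

Definition lebesgue2 (R : realType) : {measure set (plane R) -> \bar R} :=
  (@lebesgue_measure R \x @lebesgue_measure R)%E.

(* The library's norm on [R * R] is the sup norm. *)
Definition eucl (R : realType) (x : R * R) : R :=
  Num.sqrt (x.1 ^+ 2 + x.2 ^+ 2).

Definition partial (R : realType) (j : 'I_2) (f : R * R -> R) : R * R -> R :=
  'D_(std_vec R j) f.

Definition iter_partial (R : realType) (s : seq 'I_2) (f : R * R -> R) :
    R * R -> R :=
  foldr (@partial R) f s.

Definition smooth (R : realType) (f : R * R -> R) : Prop :=
  forall s : seq 'I_2, continuous (iter_partial s f) /\
    forall (j : 'I_2) (x : R * R), derivable (iter_partial s f) x (std_vec R j).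

(* A smooth function with compact support in the open half-plane is represented
   by its (smooth) extension by zero to the whole plane. *)
Definition test_function (R : realType) (f : R * R -> R) : Prop :=
  [/\ smooth f, compact (closure [set x | f x != 0])
    & closure [set x | f x != 0] `<=` halfplane R].

Definition solenoidal_test (R : realType) (phi : 'I_2 -> R * R -> R) : Prop :=
  (forall i, test_function (phi i)) /\
  (forall x, \sum_(i < 2) partial i (phi i) x = 0).

Definition grad (R : realType) (phi : 'I_2 -> R * R -> R) :
    'I_2 * 'I_2 -> R * R -> R :=
  fun ij => partial ij.2 (phi ij.1).

Definition L2norm (R : realType) (I : finType) (A : set (R * R))
    (f : I -> R * R -> R) : \bar R :=
  sqrte (\int[lebesgue2 R]_(x in A) (\sum_i `|f i x| ^+ 2)%:E)%E.

Definition weighted_L2norm (R : realType) (I : finType) (w : R * R -> R)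
    (f : I -> R * R -> R) : \bar R :=
  sqrte (\int[lebesgue2 R]_(x in halfplane R)
           ((\sum_i `|f i x| ^+ 2) * w x)%:E)%E.

Definition L2 (R : realType) (I : finType) (f : I -> R * R -> R) : Prop :=
  (forall i, measurable_fun (halfplane R : set (plane R)) (f i)) /\
  (L2norm (halfplane R) f < +oo)%E.

Definition L1loc (R : realType) (f : R * R -> R) : Prop :=
  measurable_fun (halfplane R : set (plane R)) f /\
  forall K : set (R * R), compact K -> K `<=` halfplane R ->
    (lebesgue2 R).-integrable K (EFin \o f).

Definition inner_L2 (R : realType) (f g : 'I_2 * 'I_2 -> R * R -> R) : R :=
  \sum_(i < 2) \int[lebesgue2 R]_(x in halfplane R)
    (\sum_(j < 2) f (i, j) x * g (i, j) x).

Definition weak_gradient (R : realType) (u : 'I_2 -> R * R -> R)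
    (Du : 'I_2 * 'I_2 -> R * R -> R) : Prop :=
  forall (i j : 'I_2) (psi : R * R -> R), test_function psi ->
    \int[lebesgue2 R]_(x in halfplane R) (u i x * partial j psi x) =
    - \int[lebesgue2 R]_(x in halfplane R) (Du (i, j) x * psi x).

(* [u] lies in dotH^1 x dotH^1 and [Du] is (a representative of) its
   distributional gradient, which is unique up to a null set. *)
Definition dotH1 (R : realType) (u : 'I_2 -> R * R -> R)
    (Du : 'I_2 * 'I_2 -> R * R -> R) : Prop :=
  [/\ forall i, L1loc (u i), weak_gradient u Du & L2 Du].

(* The completion of the solenoidal test fields in dotH^1 x dotH^1, realized as
   a space of functions: limits for the gradients in L^2 and for the fields in
   L^2_loc. *)
Definition dotH1_0sigma (R : realType) (u : 'I_2 -> R * R -> R)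
    (Du : 'I_2 * 'I_2 -> R * R -> R) : Prop :=
  dotH1 u Du /\
  exists phi : nat -> 'I_2 -> R * R -> R,
    [/\ forall k, solenoidal_test (phi k),
        (fun k => L2norm (halfplane R)
           (fun ij x => grad (phi k) ij x - Du ij x)) @ \oo --> 0%E
      & forall K : set (R * R), compact K -> K `<=` halfplane R ->
          (fun k => L2norm K (fun i x => phi k i x - u i x)) @ \oo --> 0%E].

Definition weak_solution (R : realType) (F : 'I_2 * 'I_2 -> R * R -> R)
    (u : 'I_2 -> R * R -> R) (Du : 'I_2 * 'I_2 -> R * R -> R) : Prop :=
  dotH1_0sigma u Du /\
  forall phi : 'I_2 -> R * R -> R, solenoidal_test phi ->
    \sum_(i < 2) \int[lebesgue2 R]_(x in halfplane R)
      (\sum_(j < 2) Du (i, j) x * partial j (phi i) x +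
       (\sum_(j < 2) u j x * Du (i, j) x) * phi i x) =
    \sum_(i < 2) \int[lebesgue2 R]_(x in halfplane R)
      (\sum_(j < 2) F (i, j) x * partial j (phi i) x).

Definition omega0 (R : realType) (x : R * R) : R :=
  `|x.2| ^+ 2 * eucl x / (`|x.2| + 4 * eucl x).
Arguments omega0 : clear implicits.

Definition omega1 (R : realType) (x : R * R) : R := `|x.2| * eucl x.
Arguments omega1 : clear implicits.

Definition omega2 (R : realType) (x : R * R) : R := `|x.2| ^+ 2 / 4.
Arguments omega2 : clear implicits.

(* Main.v *)
(* Galerkin method. The convection form b is skew, so on the span of finitely many solenoidal
   test fields the equation with a small multiple of the identity added is coercive and has a
   solution (Poincare-Miranda, by Kuhn's combinatorial lemma over F_2), bounded by |F|. An
   ultrafilter on the directed set of finite families of test fields provides a weak limit as a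
   bounded form, which almost-minimisers of a quadratic functional turn into a fast Cauchy
   sequence of test fields. Since b is antisymmetric in its last two arguments,
   b(u,u,phi) - b(v,v,phi) = b(u-v,u,phi) - b(v,phi,u-v) only involves u - v on a bounded set,
   where a Poincare inequality on the cells of a fine grid makes it small up to finitely many
   bounded functionals; hence the limit solves the equation.
   The weights satisfy 1/omega_0 = 1/omega_1 + 1/omega_2, so only omega_0 matters. For it
   int |u|^2/omega_0 <= 16 int |grad u|^2 follows by expanding |grad u + u A|^2 >= 0 for a field A
   with div A - |A|^2 >= 1/(16 omega_0), and the limit field is the L^2 limit of the approximations
   divided by sqrt omega_0, multiplied back by sqrt omega_0. *)
From HB Require Import structures.
Require Import Defs.
From mathcomp Require Import all_boot all_order all_algebra all_fingroup.
From mathcomp Require Import zify ring lra.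
From mathcomp Require Import all_classical all_reals all_analysis measurable_realfun.

Set Implicit Arguments.
Unset Strict Implicit.
Unset Printing Implicit Defensive.

Import Order.TTheory GRing.Theory Num.Theory.
Import numFieldNormedType.Exports.

Local Open Scope classical_set_scope.
Local Open Scope ring_scope.

(** * Poincare-Miranda theorem *)

(** The analysis stays on test fields, and limits are taken only at the end. With the Dirichlet
    product these fields form an incomplete space, so the abstract existence result assumes a
    semidefinite product only and returns approximate solutions. Test fields being continuous with
    compact support, integration by parts reduces to Fubini and the fundamental theorem of calculus
    on lines. The Galerkin fields converge only weakly, but the fast Cauchy sequence that represents
    their limit converges strongly, so every term of the final equation is a product of two L^2
    limits. Compactness serves only to pass from the Galerkin fields to that sequence. The
    half-plane has no Poincare inequality, so a bound on the gradient does not place a field in L^2;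
    the field times the square root of the Hardy weight does lie there, which makes completeness of
    L^2 available. The energy relation survives as an inequality, by weak lower semicontinuity; the
    bound of the gradient by F follows from it by Young's inequality, and the constant 4 is the
    square root of the Hardy constant 16. *)

Lemma F2_addrr (x : 'F_2) : x + x = 0.
Proof. by case: x => -[|[|//]] ?; apply/eqP. Qed.

(* Leibniz rule for the coboundary: the facets of a simplex sum to the cup product of the coboundaries. *)
Lemma cup_coboundary (n : nat) (a : nat -> nat -> 'F_2) :
  \prod_(i < n.+1) (a i i.+1 + a i i) =
  \sum_(k < n.+2) (\prod_(i < n) (a i (bump k i.+1) + a i (bump k i))) * a n (bump k n).
Proof.
elim: n a => [|n IH] a.
  by rewrite big_ord1 !big_ord_recl !big_ord0 /= !mul1r /bump /= addr0.
rewrite big_ord_recl (IH (fun i m => a i.+1 m.+1)).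
rewrite [X in _ * X]big_ord_recl [RHS]big_ord_recl [X in _ = _ + X]big_ord_recl.
rewrite mulrDr addrA; congr (_ + _); last first.
  have E (k m : nat) : bump k.+2 m.+1 = (bump k.+1 m).+1 by rewrite /bump; lia.
  rewrite mulr_sumr; apply: eq_bigr => k _; rewrite big_ord_recl mulrA.
  congr (_ * _ * _); last by rewrite E.
  by apply: eq_bigr => i _; rewrite !E.
rewrite !big_ord_recl /= -!mulrA -mulrDl; congr (_ * _).
rewrite /bump /= !add1n !add0n.
have := F2_addrr (a 0%N 2%N) => e.
transitivity (a 0%N 1%N + a 0%N 0%N + (a 0%N 2%N + a 0%N 2%N)); last by ring.
by rewrite e addr0.
Qed.

(** Right multiplication by [s] exchanges the even and the odd permutations without changing [f], so
    the two halves of the sum are equal and cancel in F_2. *)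
Lemma sum_odd_invariant (n : nat) (s : 'S_n) (f : 'S_n -> 'F_2) :
  odd_perm s -> (forall t, f (t * s)%g = f t) -> \sum_t f t = 0.
Proof.
move=> os fs; rewrite (bigID (fun t : 'S_n => odd_perm t)) /=.
rewrite (reindex_inj (mulIg s)) /=.
under eq_bigl => t do rewrite odd_permM os addbT.
by under eq_bigr => t _ do rewrite fs; rewrite F2_addrr.
Qed.

(** Lets the permutations that fix [ord_max], which index the facets lying in the face
    [x ord_max = p], be summed over as ['S_n]. *)
Lemma lift_perm_max_bij (n : nat) :
  {on [pred t : 'S_n.+1 | t ord_max == ord_max], bijective (lift_perm ord_max ord_max)}.
Proof.
pose low (t : 'S_n.+1) (k : 'I_n) := odflt k (unlift ord_max (t (lift ord_max k))).
have lowK (t : 'S_n.+1) k : t ord_max = ord_max -> lift ord_max (low t k) = t (lift ord_max k).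
  move=> tm; have : ord_max != t (lift ord_max k).
    by rewrite -[X in X != _]tm (inj_eq perm_inj) neq_lift.
  by rewrite /low => /unlift_some[] j -> ->.
exists (fun t => odflt 1%g [pick s | lift_perm ord_max ord_max s == t]) => [s _|t].
  case: pickP => [s' /eqP e|/(_ s)]; last by rewrite eqxx.
  apply/permP => k; apply: (@lift_inj _ ord_max).
  by rewrite -!(lift_perm_lift ord_max ord_max) e.
rewrite inE => /eqP tm; case: pickP => [s /eqP //|].
have low_inj : injective (low t).
  by move=> j k /(congr1 (lift ord_max)); rewrite !lowK // => /perm_inj/lift_inj.
move=> /(_ (perm low_inj)) /eqP[]; apply/permP => k.
case: (unliftP ord_max k) => [k'|] ->; last by rewrite lift_perm_id tm.
by rewrite lift_perm_lift permE lowK.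
Qed.

(** Vertex [k] on the lattice path from [q] to [q + (1, ..., 1)] that raises coordinate [j] at step
    [t j], counted from 0: [t] gives the rank of each coordinate. *)
Definition kuhn_vertex (n : nat) (q : 'I_n -> nat) (t : 'S_n) (k : nat) :
  'I_n -> nat := fun j => (q j + (t j < k))%N.

(* The permutation [t] runs through the simplices of Kuhn's triangulation of the cube at [q]. *)
Definition kuhn_sum (n p : nat) (l : 'I_n -> ('I_n -> nat) -> 'F_2) : 'F_2 :=
  \sum_(t : 'S_n) \sum_(q : {ffun 'I_n -> 'I_p.+1} | [forall j, q j < p]%N)
    \prod_(i < n) (l i (kuhn_vertex (fun j => q j) t i.+1) +
                   l i (kuhn_vertex (fun j => q j) t i)).

Section KuhnStep.
Variables (n p : nat) (l : 'I_n.+1 -> ('I_n.+1 -> nat) -> 'F_2).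
Hypothesis p0 : (0 < p)%N.
Hypothesis l0 : forall i x, x i = 0%N -> l i x = 0.
Hypothesis l1 : forall i x, x i = p -> l i x = 1.

Let Q := {ffun 'I_n.+1 -> 'I_p.+1}.
Let G (q : 'I_n.+1 -> nat) (t : 'S_n.+1) : 'F_2 :=
  (\prod_(i < n) (l (widen_ord (leqnSn n) i) (kuhn_vertex q t i.+1) +
                  l (widen_ord (leqnSn n) i) (kuhn_vertex q t i)))
   * l ord_max (kuhn_vertex q t n).

(** The term of the facet opposite vertex [k]: [bump k] skips the index [k]. Dropping the last
    vertex gives [G]. *)
Let facet (k : nat) (q : 'I_n.+1 -> nat) (t : 'S_n.+1) : 'F_2 :=
  (\prod_(i < n) (l (widen_ord (leqnSn n) i) (kuhn_vertex q t (bump k i.+1)) +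
                  l (widen_ord (leqnSn n) i) (kuhn_vertex q t (bump k i))))
   * l ord_max (kuhn_vertex q t (bump k n)).

Let kuhn_leibniz (q : 'I_n.+1 -> nat) t :
  \prod_(i < n.+1) (l i (kuhn_vertex q t i.+1) + l i (kuhn_vertex q t i)) =
  \sum_(k < n.+2) facet k q t.
Proof.
have := @cup_coboundary n (fun i m => l (inord i) (kuhn_vertex q t m)).
under eq_bigr => i _ do rewrite inord_val.
move=> ->; apply: eq_bigr => k _; rewrite /facet; congr (_ * _).
  apply: eq_bigr => i _.
  have -> // : inord i = widen_ord (leqnSn n) i.
  by apply: val_inj => /=; rewrite inordK // ltnS ltnW.
by congr (l _ _); apply: val_inj => /=; rewrite inordK.
Qed.

(** Exchanging the ranks [k.-1] and [k] moves only vertex [k], the one that the facet omits, so this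
    transposition pairs off the simplices on the two sides of each such facet. *)
Let inner_facet (k : nat) (q : 'I_n.+1 -> nat) :
  (0 < k < n.+1)%N -> \sum_t facet k q t = 0.
Proof.
move=> /andP[k0 kn].
have kn1 : (k.-1 < n.+1)%N by lia.
pose s : 'S_n.+1 := tperm (Ordinal kn1) (Ordinal kn).
have os : odd_perm s by rewrite odd_tperm -val_eqE /=; lia.
apply: (sum_odd_invariant os) => t.
have E m : m <> k -> kuhn_vertex q (t * s)%g m = kuhn_vertex q t m.
  move=> mk; apply/boolp.funext => j; rewrite /kuhn_vertex permM; congr (_ + _)%N.
  rewrite /s; case: tpermP => [->|->|//] /=; lia.
rewrite /facet; congr (_ * _); last by rewrite E //; rewrite /bump; lia.
by apply: eq_bigr => i _; rewrite !E // /bump; lia.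
Qed.

Let shift (q : Q) (d : 'I_n.+1) : Q := [ffun j => inord (q j + (j == d))].
Let unshift (q : Q) (d : 'I_n.+1) : Q := [ffun j => inord (q j - (j == d))].
Let rot : 'S_n.+1 := perm (can_inj (@ord_predK n.+1)).

Let rotE (j : 'I_n.+1) : (rot j : nat) = (if j == ord0 then n else j.-1).
Proof.
rewrite permE /=; case: ifP => [/eqP -> //=|]; first by rewrite modn_small.
move/eqP/eqP; rewrite -val_eqE /= => j0.
have := ltn_ord j; move: (j : nat) j0 => m m0 mn.
rewrite (_ : (m + n.+1).-1 = m.-1 + n.+1)%N; last by lia.
by rewrite modnDr modn_small //; lia.
Qed.

(** The facet opposite vertex 0 also belongs to the path that starts at vertex 1, one step further
    in direction [d], and raises [d] last; there it is opposite the last vertex. [rot] lowers every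
    rank by one and sends rank 0 to [n]. *)
Let facet0 (q : Q) (t : 'S_n.+1) (d : 'I_n.+1) : t d = ord0 -> (forall j, q j < p)%N ->
  facet 0 (fun j => q j) t = G (fun j => shift q d j) (t * rot)%g.
Proof.
move=> td qp.
have E m : (m <= n)%N -> kuhn_vertex (fun j => q j) t m.+1 =
    kuhn_vertex (fun j => shift q d j) (t * rot)%g m.
  move=> mn; apply/boolp.funext => j; rewrite /kuhn_vertex ffunE permM rotE.
  rewrite inordK; last by have := qp j; case: (j == d) => /=; lia.
  rewrite -td (inj_eq perm_inj); case: eqVneq => [->|jd] /=.
    by rewrite td /=; lia.
  have : t j != 0 :> nat by rewrite -[X in _ != X]/(val (@ord0 n)) val_eqE -td (inj_eq perm_inj).
  by lia.
rewrite /facet /G /bump /= !add1n E //; congr (_ * _).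
by apply: eq_bigr => i _; rewrite !E // ltnW.
Qed.

Let facetn (q : 'I_n.+1 -> nat) (t : 'S_n.+1) : facet n.+1 q t = G q t.
Proof.
have E m : (m <= n)%N -> bump n.+1 m = m by rewrite /bump; lia.
rewrite /facet /G E //; congr (_ * _).
by apply: eq_bigr => i _; rewrite !E // ltnW.
Qed.

(** The coordinate raised last; it keeps the value [q (top t)] on the whole facet of [G q t]. *)
Let top (t : 'S_n.+1) : 'I_n.+1 := (t^-1)%g ord_max.
Let inbox (q : Q) := [forall j, q j < p]%N.
Let inboxS (q : Q) (d : 'I_n.+1) :=
  (0 < q d)%N && [forall j, (j != d) ==> (q j < p)%N].

Let sum_facet0 :
  \sum_(t : 'S_n.+1) \sum_(q : Q | inbox q) facet 0 (fun j => q j) t =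
  \sum_(t : 'S_n.+1) \sum_(q : Q | inboxS q (top t)) G (fun j => q j) t.
Proof.
rewrite [RHS](reindex_inj (mulIg rot)) /=; apply: eq_bigr => t _.
set d := top _.
have td : t d = ord0.
  rewrite /d /top invMg permM; have -> : (rot^-1)%g ord_max = ord0.
    by apply: (@perm_inj _ rot); rewrite permKV; apply: ord_inj; rewrite rotE eqxx.
  by rewrite permKV.
rewrite [RHS](reindex_onto (fun q => shift q d) (fun q => unshift q d)) /=; last first.
  move=> q /andP[q0 _]; apply/ffunP => j; rewrite !ffunE; apply: ord_inj.
  rewrite inordK; last by rewrite inordK; have := ltn_ord (q j); case: eqVneq => [->|_] /=; lia.
  by rewrite inordK; have := ltn_ord (q j); case: eqVneq => [->|_] /=; lia.
apply: eq_big => [q|q /forallP qp]; last exact: facet0.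
apply/idP/idP => [/forallP qp|/andP[/andP[_ /forallP h] /eqP e]].
  have E j : (shift q d j : nat) = (q j + (j == d))%N.
    by rewrite ffunE inordK //; have := qp j; case: eqP => _ /=; lia.
  apply/andP; split; [apply/andP; split|].
  - by rewrite E eqxx; lia.
  - by apply/forallP => j; apply/implyP => /negbTE jd; rewrite E jd addn0.
  - by apply/eqP/ffunP => j; rewrite ffunE E addnK inord_val.
apply/forallP => j; case: (eqVneq j d) => [->|jd].
  rewrite ltn_neqAle -ltnS ltn_ord andbT; apply/eqP => qd.
  (* If [q d = p], the shift overflows: [inord] falls back to 0, and unshifting gives 0 instead of
     [p], which is positive. *)
  move/ffunP: e => /(_ d) /(congr1 val) /=; rewrite !ffunE eqxx addn1 qd.
  have -> : inord p.+1 = ord0 :> 'I_p.+1 by rewrite /inord /insubd insubF // ltnn.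
  by rewrite sub0n inordK // => p_0; move: p0; rewrite -p_0.
have := h j; rewrite jd /= ffunE (negbTE jd) addn0 inordK //.
Qed.

Let coord_top (q : 'I_n.+1 -> nat) (t : 'S_n.+1) k :
  (k <= n)%N -> kuhn_vertex q t k (top t) = q (top t).
Proof. by move=> kn; rewrite /kuhn_vertex /top permKV /= ltnNge kn addn0. Qed.

Let G_top0 (q : 'I_n.+1 -> nat) (t : 'S_n.+1) : q (top t) = 0%N -> G q t = 0.
Proof.
move=> q0; case: (unliftP ord_max (top t)) => [i|] ti.
  rewrite /G (bigD1 i) //=.
  have <- : top t = widen_ord (leqnSn n) i.
    by rewrite ti; apply: ord_inj; rewrite /= /bump leqNgt ltn_ord add0n.
  by rewrite !(@l0 (top t)) ?addr0 ?mul0r // coord_top // ltnW.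
by rewrite /G l0 ?mulr0 // -ti coord_top.
Qed.

(** On such a facet the label of the coordinate [top t] is constantly 1, so its factor [1 + 1]
    vanishes. The last coordinate escapes because [G] contains the last label itself and not its
    coboundary. *)
Let G_topp (q : 'I_n.+1 -> nat) (t : 'S_n.+1) :
  q (top t) = p -> top t != ord_max -> G q t = 0.
Proof.
move=> q0; case: (unliftP ord_max (top t)) => [i|->]; last by rewrite eqxx.
move=> ti _; rewrite /G (bigD1 i) //=.
have <- : top t = widen_ord (leqnSn n) i.
  by rewrite ti; apply: ord_inj; rewrite /= /bump leqNgt ltn_ord add0n.
by rewrite !(@l1 (top t)) ?F2_addrr ?mul0r // coord_top // ltnW.
Qed.

Definition kuhn_face_ext (x : 'I_n -> nat) : 'I_n.+1 -> nat :=
  fun j => if unlift ord_max j is Some i then x i else p.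

(* Discrete Stokes: interior facets cancel in pairs, and of the boundary only the facets in the
   face [x ord_max = p] contribute. *)
Lemma kuhn_sum_step :
  kuhn_sum p l = kuhn_sum p (fun i x => l (widen_ord (leqnSn n) i) (kuhn_face_ext x)).
Proof.
have -> : kuhn_sum p l =
    \sum_(t : 'S_n.+1) \sum_(q : Q | inboxS q (top t) && (q (top t) == p :> nat))
      G (fun j => q j) t.
  rewrite /kuhn_sum.
  under eq_bigr => t _ do under eq_bigr => q _ do rewrite kuhn_leibniz.
  under eq_bigr => t _ do rewrite exchange_big.
  rewrite exchange_big big_ord_recl big_ord_recr /= [X in _ + (X + _)]big1 ?add0r; last first.
    move=> k _; rewrite exchange_big big1 //= => q _; apply: inner_facet.
    by rewrite /= /bump; have := ltn_ord k; lia.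
  have -> : bump 0 n = n.+1 by rewrite /bump.
  under [X in _ + X]eq_bigr => t _ do under eq_bigr => q _ do rewrite facetn.
  rewrite sum_facet0 -big_split; apply: eq_bigr => t _ /=.
  (* Facets on which the constant coordinate lies strictly between 0 and [p] occur in both sums and
     cancel. Those with value 0 vanish by [G_top0], and those with value [p] come only from the
     facets opposite vertex 0. *)
  rewrite (bigID (fun q : Q => q (top t) == p :> nat)) /= -addrA.
  rewrite [X in _ + (_ + X)](bigID (fun q : Q => (0 < q (top t))%N)) /=.
  rewrite [X in _ + (_ + (_ + X))]big1 ?addr0; last first.
    by move=> q /andP[_]; rewrite -leqNgt leqn0 => /eqP q0; exact: G_top0.
  rewrite [X in _ + (X + _)](eq_bigl (fun q : Q => inbox q && (0 < q (top t))%N)) ?F2_addrr ?addr0 //.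
  move=> q; rewrite /inboxS andbC andbA andbAC; case: (0 < _)%N; rewrite ?andbF // !andbT.
  apply/andP/forallP => [[qp /forallP h] j|h].
    case: (eqVneq j (top t)) => [->|jd]; last by have := h j; rewrite jd.
    by have := ltn_ord (q (top t)); lia.
  by split; [have := h (top t); lia | apply/forallP => j; rewrite h implybT].
rewrite (bigID (fun t => top t == ord_max)) /= [X in _ + X]big1 ?addr0; last first.
  by move=> t tm; rewrite big1 // => q /andP[_ /eqP] qp; exact: G_topp.
rewrite (eq_bigl (fun t : 'S_n.+1 => t ord_max == ord_max)); last first.
  by move=> t; rewrite /top; apply/eqP/eqP => e; rewrite -{1}e ?permKV ?permK.
rewrite (reindex _ (lift_perm_max_bij n)) /=.
apply: eq_big => [s|s _]; first by rewrite lift_perm_id eqxx.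
have -> : top (lift_perm ord_max ord_max s) = ord_max.
  by rewrite /top lift_permV lift_perm_id.
pose ext (q : {ffun 'I_n -> 'I_p.+1}) : Q :=
  [ffun j => if unlift ord_max j is Some i then q i else ord_max].
pose res (q : Q) : {ffun 'I_n -> 'I_p.+1} := [ffun i => q (lift ord_max i)].
rewrite (reindex_onto ext res) /=; last first.
  move=> q /andP[_ /eqP qp]; apply/ffunP => j; rewrite !ffunE.
  by case: unliftP => [i|] -> ; rewrite ?ffunE //; apply: ord_inj.
have extE q k : (k <= n)%N ->
    kuhn_vertex (fun j => ext q j) (lift_perm ord_max ord_max s) k =
    kuhn_face_ext (kuhn_vertex (fun j => q j) s k).
  move=> kn; apply/boolp.funext => j; rewrite /kuhn_vertex /kuhn_face_ext ffunE.
  case: unliftP => [i|] ->; last by rewrite lift_perm_id /= ltnNge kn addn0.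
  have B m : (m < n)%N -> bump n m = m by rewrite /bump; lia.
  by rewrite lift_perm_lift /= B.
apply: eq_big => [q|q _].
  have -> : res (ext q) = q by apply/ffunP => i; rewrite !ffunE liftK.
  rewrite eqxx andbT ffunE unlift_none /= eqxx andbT /inboxS ffunE unlift_none /= p0 /=.
  apply/forallP/forallP => h j.
    by have := h (lift ord_max j); rewrite eq_sym neq_lift ffunE liftK.
  by apply/implyP; rewrite ffunE; case: unliftP => [i|] ->; rewrite ?eqxx.
rewrite /G !extE // l1 ?mulr1; last by rewrite /kuhn_face_ext unlift_none.
by apply: eq_bigr => i _; rewrite !extE // ltnW.
Qed.
End KuhnStep.

(** The sum counts modulo 2 the simplices on which, for every [i], label [i] changes along edge [i].
    [kuhn_sum_step] lowers the dimension until a single simplex with an empty product remains. *)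
Lemma kuhn_sum_eq1 (n p : nat) (l : 'I_n -> ('I_n -> nat) -> 'F_2) :
  (0 < p)%N -> (forall i x, x i = 0%N -> l i x = 0) ->
  (forall i x, x i = p -> l i x = 1) -> kuhn_sum p l = 1.
Proof.
move=> p0; elim: n l => [|n IH] l l0 l1; last first.
  have W (i : 'I_n) : widen_ord (leqnSn n) i = lift ord_max i.
    by apply: ord_inj; rewrite /= /bump leqNgt ltn_ord.
  rewrite kuhn_sum_step // IH // => i x xi.
    by apply: l0; rewrite /kuhn_face_ext W liftK.
  by apply: l1; rewrite /kuhn_face_ext W liftK.
rewrite /kuhn_sum (big_pred1 (1%g : 'S_0)); last by move=> t; apply/esym/eqP/permP => -[].
rewrite (big_pred1 [ffun i => ord0]) ?big_ord0 // => q.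
rewrite pred1E; apply/forallP/eqP => [_|_ [] //]; by apply/ffunP => -[].
Qed.

Lemma kuhn_lemma (n p : nat) (l : 'I_n -> ('I_n -> nat) -> bool) :
  (0 < p)%N -> (forall i x, x i = 0%N -> l i x = false) ->
  (forall i x, x i = p -> l i x = true) ->
  exists q : 'I_n -> nat, (forall j, q j < p)%N /\
    forall i, exists x y : 'I_n -> nat,
      [/\ forall j, (q j <= x j <= (q j).+1)%N,
          forall j, (q j <= y j <= (q j).+1)%N, l i x = false & l i y = true].
Proof.
move=> p0 l0 l1.
have : kuhn_sum p (fun i x => (l i x)%:R) != 0.
  rewrite kuhn_sum_eq1 ?oner_eq0 // => i x xi; [by rewrite (l0 i)|by rewrite (l1 i)].
move/eqP; apply: boolp.contra_notP => noq; rewrite /kuhn_sum big1 // => t _; rewrite big1 // => q /forallP qp.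
apply/eqP/negPn/negP => /prodf_neq0 nz; apply: noq.
exists (fun j => q j : nat); split => // i.
have vb (k : nat) j : (q j <= kuhn_vertex (fun j => q j) t k j <= (q j).+1)%N.
  by rewrite /kuhn_vertex leq_addr /=; case: (_ < _)%N; lia.
have := nz i isT.
set x := kuhn_vertex _ _ i.+1; set y := kuhn_vertex _ _ i.
case ex : (l i x); case ey : (l i y).
- by rewrite F2_addrr eqxx.
- by exists y, x; split=> //; apply: vb.
- by exists x, y; split=> //; apply: vb.
- by rewrite addr0 eqxx.
Qed.

Definition box_lipschitz (R : realType) (n : nat) (h : 'I_n -> ('I_n -> R) -> R)
    (r L : R) :=
  forall i c c' (d : R), (forall j, `|c j| <= r) -> (forall j, `|c' j| <= r) ->
    (forall j, `|c j - c' j| <= d) -> `|h i c - h i c'| <= L * d.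

(** A Lipschitz bound in place of continuity fixes the mesh beforehand: both signs of [h i] occur in
    one cube of side [2 * r / p], over which [h i] varies by at most [eta]. *)
Lemma poincare_miranda (R : realType) (n : nat) (h : 'I_n -> ('I_n -> R) -> R)
    (r L eta : R) :
  0 < r -> 0 <= L -> 0 < eta -> box_lipschitz h r L ->
  (forall i c, (forall j, `|c j| <= r) -> c i = - r -> h i c <= 0) ->
  (forall i c, (forall j, `|c j| <= r) -> c i = r -> 0 <= h i c) ->
  exists c, (forall j, `|c j| <= r) /\ forall i, `|h i c| <= eta.
Proof.
move=> r0 L0 eta0 hL hlo hhi.
have [p p0 pL] : exists2 p : nat, (0 < p)%N & L * (2 * r / p%:R) <= eta.
  exists (Num.truncn (L * (2 * r) / eta)).+1 => //.
  have := truncnS_gt (L * (2 * r) / eta); set N := _.+1 => hN.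
  by rewrite mulrA ler_pdivrMr ?ltr0n // -ler_pdivrMl // mulrC ltW.
have pR : 0 < p%:R :> R by rewrite ltr0n.
pose pt (x : 'I_n -> nat) : 'I_n -> R := fun j => - r + 2 * r * ((x j)%:R / p%:R).
have pt_box x : (forall j, x j <= p)%N -> forall j, `|pt x j| <= r.
  move=> xp j; rewrite /pt; set t := _ / p%:R.
  have t0 : 0 <= t by rewrite divr_ge0.
  have t1 : t <= 1 by rewrite ler_pdivrMr // mul1r ler_nat.
  by rewrite ler_norml; apply/andP; split; nra.
(* The labels are prescribed on the two faces: on the upper one [h i] may vanish, and [kuhn_lemma]
   asks for their values at lattice points outside the box as well. *)
pose l i (x : 'I_n -> nat) :=
  if x i == 0%N then false else if x i == p then true else 0 < h i (pt x).
have l0 i x : x i = 0%N -> l i x = false by rewrite /l => ->.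
have l1 i x : x i = p -> l i x = true.
  by rewrite /l => ->; rewrite eqxx; case: eqP p0 => // ->.
have [q [qp hq]] := kuhn_lemma p0 l0 l1.
have qb : forall j, `|pt q j| <= r by apply: pt_box => j; rewrite ltnW.
exists (pt q); split => // i.
have near x : (forall j, q j <= x j <= (q j).+1)%N ->
    (forall j, `|pt x j| <= r) /\ `|h i (pt q) - h i (pt x)| <= eta.
  move=> qx; have xb : forall j, `|pt x j| <= r.
    by apply: pt_box => j; have := qx j; have := qp j; lia.
  split => //; apply: le_trans pL; apply: hL => // j.
  rewrite /pt opprD addrACA subrr add0r -mulrBr -mulrBl.
  rewrite normrM (ger0_norm (_ : 0 <= 2 * r)); last by lra.
  rewrite ler_wpM2l //; [lra|rewrite normrM].
  have pi0 : 0 <= (p%:R : R)^-1 by rewrite invr_ge0 ltW.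
  rewrite (ger0_norm pi0) ler_piMl //.
  have /andP[h1 h2] := qx j; rewrite distrC -natrB // ger0_norm //.
  by rewrite -[leRHS](mulr1n) ler_nat; lia.
have [x [y [qx qy lx ly]]] := hq i.
have [xb xq] := near _ qx; have [yb yq] := near _ qy.
have hx : h i (pt x) <= 0.
  move: lx; rewrite /l; case: eqP => [x0 _|_].
    by apply: hlo => //; rewrite /pt x0 mul0r mulr0 addr0.
  by case: eqP => // _ /negbT; rewrite -leNgt.
have hy : 0 <= h i (pt y).
  move: ly; rewrite /l; case: eqP => // _; case: eqP => [y0 _|_ /ltW //].
  by apply: hhi => //; rewrite /pt y0 divff ?gt_eqF //; lra.
move: xq yq; rewrite !ler_norml => /andP[? ?] /andP[? ?].
by apply/andP; split; lra.
Qed.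

(* A zero of [c |-> c - clamp (c - P c)] solves the variational inequality of [P] on the box;
   coercivity keeps it away from the boundary, where it is a zero of [P]. *)
Lemma coercive_approx_zero (R : realType) (n : nat) (P : 'I_n -> ('I_n -> R) -> R)
    (e K : R) :
  0 < e -> 0 <= K ->
  (forall r : R, 0 < r -> exists2 L : R, 0 <= L & box_lipschitz P r L) ->
  (forall c, e * (\sum_i c i ^+ 2) - K <= \sum_i P i c * c i) ->
  exists2 r : R, 0 < r & forall eta : R, 0 < eta ->
    exists c, (forall j, `|c j| <= r) /\ forall i, `|P i c| <= eta.
Proof.
move=> e0 K0 PL Pc.
(* Chosen so that [K + 1 < e * (r / 2) ^+ 2]: a coordinate of size at least [r / 2] then forces the
   sum of the [P i c * c i] above 1, while [eta'] is small enough to keep that sum below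
   [n%:R * r * eta' <= 1]. *)
pose r := 2 * ((K + 2) / e + 1).
have Ke : 0 < (K + 2) / e by rewrite divr_gt0 //; lra.
have r0 : 0 < r by rewrite /r; lra.
have er : K + 1 < e * (r / 2) ^+ 2.
  have -> : r / 2 = (K + 2) / e + 1 by rewrite /r; lra.
  have : e * ((K + 2) / e) = K + 2 by rewrite mulrC divfK // gt_eqF.
  move: ((K + 2) / e) Ke => t t0 et.
  rewrite sqrrD expr1n mulr1 expr2; nra.
exists r => // eta eta0; have [L L0 hL] := PL _ r0.
pose eta' := Num.min eta (Num.min (r / 2) (1 / (n%:R * r + 1))).
have nr : 0 <= n%:R * r by rewrite mulr_ge0 // ltW.
have eta'0 : 0 < eta'.
  by rewrite /eta' !lt_min eta0 /= !divr_gt0 //; lra.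
have e1 : eta' <= eta by rewrite /eta' ge_min lexx.
have e2 : eta' <= r / 2 by rewrite /eta' !ge_min lexx orbT.
have e3 : n%:R * r * eta' <= 1.
  have : eta' <= 1 / (n%:R * r + 1) by rewrite /eta' !ge_min lexx !orbT.
  rewrite ler_pdivlMr; last lra.
  by move=> h; nra.
pose clamp (t : R) := Num.max (- r) (Num.min r t).
have clampP t : [\/ t < - r /\ clamp t = - r, [/\ - r <= t, t <= r & clamp t = t] |
    r < t /\ clamp t = r].
  rewrite /clamp; case: (ltP t (- r)) => h1; last case: (ltP r t) => h2.
  - apply: Or31; split=> //; have /min_idPr -> : t <= r by lra.
    by apply/max_idPl; lra.
  - apply: Or33; split=> //.
    by apply/max_idPr; lra.
  - by apply: Or32; split=> //; exact/max_idPr.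
have clampL s t : `|clamp s - clamp t| <= `|s - t|.
  have := ler_norm (s - t); have := ler_norm (t - s); rewrite (distrC t) ler_norml => n1 n2.
  case: (clampP s) => [[hs ->]|[hs1 hs2 ->]|[hs ->]];
  case: (clampP t) => [[ht ->]|[ht1 ht2 ->]|[ht ->]]; apply/andP; split; lra.
have tri (x y z w : R) : `|x - y - (z - w)| <= `|x - z| + `|y - w|.
  by rewrite (_ : x - y - (z - w) = (x - z) - (y - w)); [exact: ler_normB|ring].
pose h i c := c i - clamp (c i - P i c).
have hL' : box_lipschitz h r (2 + L).
  move=> i c c' d cb cb' cd; rewrite /h.
  have := hL i c c' d cb cb' cd; have := cd i.
  have := clampL (c i - P i c) (c' i - P i c').
  have : `|c i - P i c - (c' i - P i c')| <= `|c i - c' i| + `|P i c - P i c'|.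
    exact: tri.
  have : `|c i - clamp (c i - P i c) - (c' i - clamp (c' i - P i c'))|
     <= `|c i - c' i| + `|clamp (c i - P i c) - clamp (c' i - P i c')|.
    exact: tri.
  lra.
have [c [cb hc]] : exists c, (forall j, `|c j| <= r) /\ forall i, `|h i c| <= eta'.
  apply: (poincare_miranda r0 _ eta'0 hL'); first lra.
    by move=> i c cb ci; rewrite /h; case: (clampP (c i - P i c)) => [[? ->]|[? ? ->]|[? ->]]; lra.
  by move=> i c cb ci; rewrite /h; case: (clampP (c i - P i c)) => [[? ->]|[? ? ->]|[? ->]]; lra.
exists c; split => // i.
(* Where the clamp is inactive, [h j c] equals [P j c]. Where it is active, [c j] lies within [eta']
   of [- r] or [r], and [P j c] has the opposite sign, so the product is not positive. *)
have Pcase j : P j c * c j <= r * eta' /\ (`|P j c| <= eta' \/ r / 2 <= `|c j|).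
  have := hc j; have := cb j; rewrite /h !ler_norml.
  case: (clampP (c j - P j c)) => [[h1 ->]|[h0 h1 ->]|[h1 ->]] /andP[h2 h3] /andP[h4 h5].
  - split; first by apply: (@le_trans _ _ 0); [nra|exact: mulr_ge0 (ltW r0) (ltW eta'0)].
    by right; rewrite ler_normr; apply/orP; right; lra.
  - split; last by left; apply/andP; split; lra.
    have -> : P j c = c j - (c j - P j c) by lra.
    set t := c j - (c j - P j c) in h4 h5 *; nra.
  - split; first by apply: (@le_trans _ _ 0); [nra|exact: mulr_ge0 (ltW r0) (ltW eta'0)].
    by right; rewrite ler_normr; apply/orP; left; lra.
have [_ []] := Pcase i; first by move=> /le_trans; apply.
move=> ci; exfalso.
have up : \sum_j P j c * c j <= 1.
  apply: le_trans (e3); rewrite -mulrA mulr_natl -[X in _ *+ X](card_ord n) -sumr_const.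
  by apply: ler_sum => j _; have [] := Pcase j.
have := Pc c; have : e * (r / 2) ^+ 2 <= e * \sum_i c i ^+ 2.
  rewrite ler_wpM2l ?(ltW e0) // (bigD1 i) //= -[X in X <= _]addr0 lerD //.
    rewrite -[leRHS]real_normK ?num_real // lerXn2r ?nnegrE //; lra.
  by apply: sumr_ge0 => j _; rewrite sqr_ge0.
lra.
Qed.

(** * Stationary points in a pre-Hilbert space *)

(** The values stay in a segment and hence cluster; along an ultrafilter a cluster point is a
    limit. *)
Lemma ultra_bounded_limit (R : realType) (T : Type) (U : set_system T)
    (g : T -> R) (C : R) : UltraFilter U -> (\forall s \near U, `|g s| <= C) ->
  exists l : R, forall e : R, 0 < e -> \forall s \near U, `|g s - l| <= e.
Proof.
move=> UU gC; have [l [_ cl]] : (`[- C, C] `&` cluster (g @ U) !=set0)%classic.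
  by apply: segment_compact; apply: filterS gC => s; rewrite /= in_itv /= ler_norml.
exists l => e e0.
have [//|N] := @in_ultra_setVsetC _ U [set s | `|g s - l| <= e] UU.
have [t [/= h1 h2]] := cl (~` [set t | `|t - l| <= e]) (ball l e) N (nbhsx_ballx l e e0).
by move: h2; rewrite /ball /= distrC => /ltW/h1.
Qed.

Definition linear_form (R : realType) (E : lmodType R) (g : E -> R) :=
  forall c u v, g (c *: u + v) = c * g u + g v.

Section LinearForm.
Variables (R : realType) (E : lmodType R) (g : E -> R).
Hypothesis gL : linear_form g.

Lemma linear_form0 : g 0 = 0.
Proof. by have := gL 1 0 0; rewrite scaler0 addr0 mul1r => h; lra. Qed.

Lemma linear_formD u v : g (u + v) = g u + g v.
Proof. by have := gL 1 u v; rewrite scale1r mul1r. Qed.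

Lemma linear_formZ c u : g (c *: u) = c * g u.
Proof. by have := gL c u 0; rewrite !addr0 linear_form0 addr0. Qed.

Lemma linear_formN u : g (- u) = - g u.
Proof. by rewrite -scaleN1r linear_formZ mulN1r. Qed.

Lemma linear_formB u v : g (u - v) = g u - g v.
Proof. by rewrite linear_formD linear_formN. Qed.

Lemma linear_form_sum n (c : 'I_n -> R) (s : 'I_n -> E) :
  g (\sum_i c i *: s i) = \sum_i c i * g (s i).
Proof.
rewrite (big_morph g linear_formD linear_form0).
by apply: eq_bigr => i _; rewrite linear_formZ.
Qed.
End LinearForm.

Section PreHilbert.
Variables (R : realType) (E : lmodType R) (ip : E -> E -> R).
Hypothesis ipL : forall w, linear_form (ip ^~ w).
Hypothesis ipC : forall u v, ip u v = ip v u.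
Hypothesis ip_ge0 : forall u, 0 <= ip u u.

Definition ip_norm u := Num.sqrt (ip u u).
Local Notation nrm := ip_norm.

Lemma ipLr w : linear_form (ip w).
Proof. by move=> c u v; rewrite ipC ipL ![ip _ w]ipC. Qed.

Lemma ip_norm_ge0 u : 0 <= nrm u. Proof. exact: sqrtr_ge0. Qed.

Lemma ip_norm_sqr u : nrm u ^+ 2 = ip u u. Proof. by rewrite sqr_sqrtr. Qed.

Lemma ip_expand a u v :
  ip (a *: u + v) (a *: u + v) = a ^+ 2 * ip u u + 2 * a * ip u v + ip v v.
Proof. by rewrite ipL !ipLr (ipC v u); ring. Qed.

(** [ip] is only semidefinite: if [ip u u = 0], the nonnegative quadratic in [a] degenerates to an
    affine function, which forces [ip u v = 0]. *)
Lemma ip_cauchy_schwarz u v : `|ip u v| <= nrm u * nrm v.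
Proof.
rewrite -ler_sqr ?nnegrE ?mulr_ge0 ?ip_norm_ge0 // exprMn !ip_norm_sqr real_normK ?num_real //.
have [u0|u0] := eqVneq (ip u u) 0.
  have h a : 0 <= 2 * a * ip u v + ip v v.
    by have := ip_ge0 (a *: u + v); rewrite ip_expand u0 mulr0 add0r.
  suff -> : ip u v = 0 by rewrite expr0n mulr_ge0.
  apply/eqP/negPn/negP => uv0; have := h (- (ip v v + 1) / (2 * ip u v)).
  have -> : 2 * (- (ip v v + 1) / (2 * ip u v)) * ip u v = - (ip v v + 1) by field.
  lra.
have up : 0 < ip u u by rewrite lt0r u0 ip_ge0.
have := ip_ge0 ((- ip u v / ip u u) *: u + v); rewrite ip_expand.
have -> : (- ip u v / ip u u) ^+ 2 * ip u u + 2 * (- ip u v / ip u u) * ip u v + ip v v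
  = ip v v - ip u v ^+ 2 / ip u u by field.
by rewrite subr_ge0 ler_pdivrMr // mulrC.
Qed.

Lemma ip_normD u v : nrm (u + v) <= nrm u + nrm v.
Proof.
rewrite -ler_sqr ?nnegrE ?addr_ge0 ?ip_norm_ge0 // sqrrD !ip_norm_sqr.
have := ip_expand 1 u v; rewrite scale1r => ->.
have := ip_cauchy_schwarz u v; have := ler_norm (ip u v); nra.
Qed.

Lemma ip_normN u : nrm (- u) = nrm u.
Proof. by rewrite /ip_norm (linear_formN (ipL _)) (linear_formN (ipLr _)) opprK. Qed.

Lemma ip_normB u v : nrm (u - v) <= nrm u + nrm v.
Proof. by rewrite -(ip_normN v) ip_normD. Qed.

Definition bounded_form (a : E -> R) :=
  linear_form a /\ exists2 C : R, 0 <= C & forall v, `|a v| <= C * nrm v.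

(* A near-minimiser of |v|^2/2 - a v almost represents [a]; no completeness is needed. *)
Lemma riesz_approx (a : E -> R) (e : R) : bounded_form a -> 0 < e ->
  exists psi, forall v, `|ip psi v - a v| <= e * nrm v.
Proof.
move=> [aL [C C0 aC]] e0.
pose J v := ip v v / 2 - a v.
have Jlb v : - (C ^+ 2 / 2) <= J v.
  have := aC v; rewrite ler_norml => /andP[_ h]; rewrite /J -ip_norm_sqr.
  by have := sqr_ge0 (nrm v - C); rewrite sqrrB; lra.
pose S : set R := range J.
have S_inf : has_inf S.
  by split; [exists (J 0); exists 0|exists (- (C ^+ 2 / 2)) => _ [v _ <-]].
have e2 : 0 < e ^+ 2 / 2 by rewrite divr_gt0 // exprn_gt0.
have [_ [psi _ <-] hpsi] := inf_adherent e2 S_inf.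
have Jpsi v : J psi - e ^+ 2 / 2 <= J v.
  have : inf S <= J v by apply: ge_inf; [case: S_inf|exists v].
  lra.
exists psi => v; set d := ip psi v - a v.
(* Near-minimality along the line [psi + t v]. At the optimal [t] it reads
   [d ^+ 2 <= e ^+ 2 * ip v v], which is why the slack is [e ^+ 2 / 2]. *)
have h t : 0 <= t * d + t ^+ 2 / 2 * ip v v + e ^+ 2 / 2.
  have := Jpsi (t *: v + psi); rewrite /J ip_expand aL (ipC v psi) /d; lra.
have [v0|v0] := eqVneq (ip v v) 0.
  have -> : d = 0.
    apply/eqP/negPn/negP => d0; have := h (- (e ^+ 2 / 2 + 1) / d).
    rewrite v0 mulr0 addr0 divfK //; lra.
  by rewrite normr0 mulr_ge0 // ?ip_norm_ge0 // ltW.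
have vp : 0 < ip v v by rewrite lt0r v0 ip_ge0.
rewrite -ler_sqr ?nnegrE ?mulr_ge0 ?ip_norm_ge0 ?(ltW e0) // exprMn ip_norm_sqr real_normK ?num_real //.
have := h (- d / ip v v).
have -> : - d / ip v v * d + (- d / ip v v) ^+ 2 / 2 * ip v v = - (d ^+ 2 / ip v v) / 2 by field.
move=> h'; rewrite -ler_pdivrMr //; lra.
Qed.

(** * Galerkin approximations and their weak limit *)

Section StationaryFlow.
Variables (f : E -> R) (b : E -> E -> E -> R).
Hypothesis fB : bounded_form f.
Hypothesis bL1 : forall v w, linear_form (fun u => b u v w).
Hypothesis bL2 : forall u w, linear_form (fun v => b u v w).
Hypothesis bL3 : forall u v, linear_form (b u v).
Hypothesis b_skew : forall u, b u u u = 0.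

(** The unknowns are the coefficients [c] of a combination of [s]. Multiplying equation [i] by [c i]
    and summing removes the convection by [b_skew]; this yields coercivity and, the regularising
    term being nonnegative, the energy inequality. *)
Lemma galerkin (s : seq E) (eta : R) : 0 < eta -> exists u,
  (forall phi, phi \in s -> `|ip u phi + b u u phi - f phi| <= eta) /\
  ip u u <= f u + eta.
Proof.
move=> eta0; have [fL [C C0 fC]] := fB.
pose n := size s; pose t (i : 'I_n) := nth 0 s i.
pose lc (c : 'I_n -> R) : E := \sum_i c i *: t i.
(* From [f u <= C * nrm u <= nrm u ^+ 2 + C ^+ 2 / 4]. *)
pose K := C ^+ 2 / 4.
have K0 : 0 <= K by rewrite /K divr_ge0 ?sqr_ge0.
(* The term [e * c i] makes the system coercive even if [s] is linearly dependent. *)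
pose e := (eta / 2) ^+ 2 / (K + eta).
have e0 : 0 < e by rewrite divr_gt0 ?exprn_gt0 //; lra.
pose P i c := ip (lc c) (t i) + b (lc c) (lc c) (t i) - f (t i) + e * c i.
have lcB c c' : lc c - lc c' = lc (fun i => c i - c' i).
  by rewrite /lc -sumrB; apply: eq_bigr => i _; rewrite scalerBl.
have lcbound (g : E -> R) c (d : R) : linear_form g -> 0 <= d ->
    (forall j, `|c j| <= d) -> `|g (lc c)| <= d * \sum_j `|g (t j)|.
  move=> gL d0 cd; rewrite (linear_form_sum gL); apply: le_trans (ler_norm_sum _ _ _) _.
  by rewrite mulr_sumr; apply: ler_sum => j _; rewrite normrM ler_wpM2r.
have PL (r : R) : 0 < r -> exists2 L : R, 0 <= L & box_lipschitz P r L.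
  move=> r0.
  pose M i := \sum_j `|ip (t j) (t i)|.
  pose B i := \sum_j (\sum_k `|b (t j) (t k) (t i)|).
  have M0 i : 0 <= M i by rewrite sumr_ge0.
  have B0 i : 0 <= B i by rewrite sumr_ge0 // => j _; rewrite sumr_ge0.
  have B0' i : 0 <= \sum_k (\sum_j `|b (t j) (t k) (t i)|) by rewrite sumr_ge0 // => j _; rewrite sumr_ge0.
  have bb c c' d d' i : 0 <= d -> 0 <= d' -> (forall j, `|c j| <= d) -> (forall j, `|c' j| <= d') ->
      `|b (lc c) (lc c') (t i)| <= d * d' * B i.
    move=> d0 d'0 cd cd'; apply: le_trans (lcbound _ _ _ (bL1 _ _) d0 cd) _.
    rewrite -mulrA ler_wpM2l // mulr_sumr; apply: ler_sum => j _.
    exact: (lcbound (fun v => b (t j) v (t i)) c' d' (bL2 _ _) d'0 cd').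
  exists (\sum_i (M i + 2 * r * B i) + e).
    apply: addr_ge0 (ltW e0); apply: sumr_ge0 => i _; rewrite addr_ge0 //.
    by rewrite mulr_ge0 //; lra.
  move=> i c c' d cr cr' cd; have d0 : 0 <= d by apply: le_trans (cd i).
  have -> : P i c - P i c' = ip (lc c - lc c') (t i) +
      b (lc c - lc c') (lc c) (t i) + b (lc c') (lc c - lc c') (t i) + e * (c i - c' i).
    rewrite /P (linear_formB (ipL _)) (linear_formB (bL1 _ _)) (linear_formB (bL2 _ _)); ring.
  rewrite lcB.
  have h1 := lcbound _ _ d (ipL (t i)) d0 cd.
  have h2 := bb _ c d r i d0 (ltW r0) cd cr.
  have h3 := bb c' _ r d i (ltW r0) d0 cr' cd.
  have h4 : `|e * (c i - c' i)| <= e * d by rewrite normrM (gtr0_norm e0) ler_wpM2l // ltW.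
  apply: le_trans (ler_normD _ _) _; rewrite mulrDl; apply: lerD h4.
  apply: le_trans (ler_normD _ _) _.
  apply: le_trans (lerD (le_trans (ler_normD _ _) (lerD h1 h2)) h3) _.
  rewrite -/(M i); rewrite (_ : _ + _ = (M i + 2 * r * B i) * d); last by ring.
  rewrite ler_wpM2r // (bigD1 i) //= lerDl sumr_ge0 // => j _.
  by rewrite addr_ge0 // mulr_ge0 //; lra.
have Psum c : \sum_i P i c * c i = ip (lc c) (lc c) - f (lc c) + e * \sum_i c i ^+ 2.
  rewrite -[ip _ _ - f _]addr0 -[X in _ - _ + X](b_skew (lc c)).
  rewrite [X in X - _](linear_form_sum (ipLr (lc c)) c t).
  rewrite [X in _ - X](linear_form_sum fL c t).
  rewrite [X in _ - _ + X + _](linear_form_sum (bL3 (lc c) (lc c)) c t).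
  rewrite mulr_sumr -sumrB -!big_split /=.
  by apply: eq_bigr => i _; rewrite /P; ring.
have fK u : f u <= ip u u + K.
  have := fC u; rewrite ler_norml => /andP[_]; rewrite -ip_norm_sqr /K.
  by have := sqr_ge0 (nrm u - C / 2); rewrite sqrrB; lra.
have Pc c : e * (\sum_i c i ^+ 2) - K <= \sum_i P i c * c i.
  by rewrite Psum; have := fK (lc c); lra.
have [r r0 hr] := coercive_approx_zero e0 K0 PL Pc.
pose eta' := Num.min (eta / 2) (eta / (n%:R * r + 1)).
have nr : 0 <= n%:R * r by rewrite mulr_ge0 // ltW.
have eta'0 : 0 < eta' by rewrite /eta' lt_min !divr_gt0 //; lra.
have e1 : eta' <= eta / 2 by rewrite /eta' ge_min lexx.
have e2 : n%:R * r * eta' <= eta.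
  have : eta' <= eta / (n%:R * r + 1) by rewrite /eta' ge_min lexx orbT.
  by rewrite ler_pdivlMr; [nra|lra].
have [c [cr hc]] := hr _ eta'0.
have up : \sum_j P j c * c j <= eta.
  apply: le_trans (e2); rewrite -mulrA mulr_natl -[X in _ *+ X](card_ord n) -sumr_const.
  apply: ler_sum => j _; apply: le_trans (ler_norm _) _; rewrite normrM mulrC.
  by apply: ler_pM.
have c2 : 0 <= \sum_i c i ^+ 2 by apply: sumr_ge0 => i _; rewrite sqr_ge0.
exists (lc c); split; last by move: up; rewrite Psum; nra.
(* The energy balance bounds [e * \sum_i c i ^+ 2] by [K + eta], hence the square of [e * c i] by
   [e * (K + eta) = (eta / 2) ^+ 2]: this is what fixes [e]. *)
have ec i : `|e * c i| <= eta / 2.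
  have h : e * \sum_i c i ^+ 2 <= K + eta.
    by move: up; rewrite Psum; have := fK (lc c); lra.
  have h' : e * c i ^+ 2 <= K + eta.
    apply: le_trans h; rewrite ler_wpM2l ?(ltW e0) // (bigD1 i) //= lerDl.
    by apply: sumr_ge0 => j _; rewrite sqr_ge0.
  rewrite -ler_sqr ?nnegrE ?normr_ge0 //; last lra.
  rewrite real_normK ?num_real // exprMn expr2 -mulrA.
  apply: le_trans (ler_wpM2l (ltW e0) h') _.
  by rewrite /e divfK //; lra.
move=> phi phis; have [i it] : exists i : 'I_n, phi = t i.
  have hi : (index phi s < n)%N by rewrite index_mem.
  by exists (Ordinal hi); rewrite /t nth_index.
rewrite it; have := hc i; have := ec i.
have -> : ip (lc c) (t i) + b (lc c) (lc c) (t i) - f (t i) = P i c - e * c i by rewrite /P; ring.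
have := ler_normB (P i c) (e * c i); lra.
Qed.

(** Weak continuity of [b u u phi] in [u] on bounded sets, stated without sequences: once the
    finitely many functionals [a i] nearly agree on [u] and [v], only an arbitrarily small multiple
    of the norms remains. *)
Hypothesis b_compact : forall phi (e : R), 0 < e ->
  exists (I : finType) (a : I -> E -> R), (forall i, bounded_form (a i)) /\
    forall u v, `|b u u phi - b v v phi| <=
      (nrm u + nrm v) * Num.sqrt (e * nrm (u - v) ^+ 2 + \sum_i a i (u - v) ^+ 2).

(* [E] need not be complete or separable: weak limits are taken along an ultrafilter on finite
   families, and the limit is represented by the fast Cauchy sequence [psi]. *)
Theorem stationary_approx : exists psi : nat -> E,
  [/\ forall k l, nrm (psi k - psi l) <= (1/2) ^+ k + (1/2) ^+ l,
      forall phi (e : R), 0 < e -> \forall k \near \oo,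
        `|ip (psi k) phi + b (psi k) (psi k) phi - f phi| <= e
    & forall e : R, 0 < e -> \forall k \near \oo, ip (psi k) (psi k) <= f (psi k) + e].
Proof.
have [fL [C C0 fC]] := fB.
have eta0 (s : seq E) : 0 < (size s).+1%:R^-1 :> R by rewrite invr_gt0.
have /choice [u hu] : forall s : seq E, exists u,
    (forall phi, phi \in s -> `|ip u phi + b u u phi - f phi| <= (size s).+1%:R^-1) /\
    ip u u <= f u + (size s).+1%:R^-1 by move=> s; exact: galerkin.
(* The energy inequality gives [x ^+ 2 <= C * x + 1] for [x = nrm (u s)], which excludes
   [x > C + 1]. *)
have u_bound s : nrm (u s) <= C + 1.
  have [_] := hu s; have := fC (u s); rewrite ler_norml => /andP[_].
  have : (size s).+1%:R^-1 <= 1 :> R by rewrite invf_le1 // ler1n.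
  rewrite -ip_norm_sqr expr2; have := ip_norm_ge0 (u s).
  move: (nrm (u s)) (f (u s)) (_^-1) => x y z x0 h1 h2 h3; rewrite leNgt; apply/negP => hx.
  have hx' : 0 <= x - (C + 1) by lra.
  by have := mulr_ge0 x0 hx'; rewrite mulrBr mulrDr mulr1 (mulrC x C); lra.
(* The clause on sizes makes the tolerance [(size s).+1%:R^-1] tend to 0 along the filter. Inclusion
   alone would not, as [E] may be small; repetitions such as [nseq N 0] supply the long families. *)
pose above (s0 : seq E) : set (seq E) := [set s : seq E | {subset s0 <= s} /\ (size s0 <= size s)%N].
have aboveF : ProperFilter (filter_from setT above).
  apply: filter_from_proper; last by move=> s _; exists s; split.
  apply: filter_from_filter; first by exists [::].
  move=> s1 s2 _ _; exists (s1 ++ s2) => // s [h1 h2]; split; split.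
  - by move=> x xs; apply: h1; rewrite mem_cat xs.
  - by apply: leq_trans h2; rewrite size_cat leq_addr.
  - by move=> x xs; apply: h1; rewrite mem_cat xs orbT.
  - by apply: leq_trans h2; rewrite size_cat leq_addl.
have [U [UU aboveU]] := ultraFilterLemma aboveF.
have U_above s0 : U (above s0) by apply: aboveU; exists s0.
have U_mem phi : \forall s \near U, phi \in s.
  by apply: filterS (U_above [:: phi]) => s [h _]; apply: h; rewrite inE eqxx.
have U_size (e : R) : 0 < e -> \forall s \near U, (size s).+1%:R^-1 <= e.
  move=> e0; pose N := Num.truncn e^-1.
  apply: filterS (U_above (nseq N 0)) => s [_]; rewrite size_nseq => Ns.
  rewrite invf_ple ?posrE // ltW //; apply: lt_le_trans (truncnS_gt _) _.
  by rewrite ler_nat.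
have /choice [ell hell] : forall phi, exists l : R, forall e : R, 0 < e ->
    \forall s \near U, `|ip (u s) phi - l| <= e.
  move=> phi; apply: (@ultra_bounded_limit _ _ _ _ ((C + 1) * nrm phi)).
  apply: filterE => s; apply: le_trans (ip_cauchy_schwarz _ _) _.
  by rewrite ler_wpM2r ?ip_norm_ge0.
have le_eps (x y : R) : (forall e : R, 0 < e -> x <= y + e) -> x <= y.
  by move=> h; apply/ler_addgt0Pr.
have ellB : bounded_form ell.
  split=> [c v w|].
    have : `|ell (c *: v + w) - (c * ell v + ell w)| <= 0.
      apply: le_eps => e e0; rewrite add0r.
      have e1 : 0 < e / (`|c| + 2) by rewrite divr_gt0 // ltr_wpDl.
      have [s [[h1 h2] h3]] := filter_ex (filterI (filterI (hell (c *: v + w) _ e1) (hell v _ e1)) (hell w _ e1)).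
      move: h1; rewrite (ipLr (u s)) => h1.
      have -> : ell (c *: v + w) - (c * ell v + ell w) =
        c * (ip (u s) v - ell v) + (ip (u s) w - ell w) -
        (c * ip (u s) v + ip (u s) w - ell (c *: v + w)) by ring.
      apply: le_trans (ler_normB _ _) _; apply: le_trans (lerD (ler_normD _ _) h1) _.
      rewrite normrM; apply: le_trans (lerD (lerD (ler_wpM2l _ h2) h3) (lexx _)) _ => //.
      have : e / (`|c| + 2) * (`|c| + 2) = e by rewrite divfK // gt_eqF // ltr_wpDl.
      by move: (e / _) => q hq; lra.
    by rewrite normr_le0 subr_eq0 => /eqP.
  exists (C + 1); first by lra.
  move=> v; apply: le_eps => e e0; have [s hs] := filter_ex (hell v _ e0).
  have h1 : `|ip (u s) v| <= (C + 1) * nrm v.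
    by apply: le_trans (ip_cauchy_schwarz _ _) _; rewrite ler_wpM2r ?ip_norm_ge0.
  have -> : ell v = ip (u s) v - (ip (u s) v - ell v) by ring.
  by apply: le_trans (ler_normB _ _) _; exact: lerD.
have half0 k : 0 < (1/2) ^+ k :> R by rewrite exprn_gt0.
have half1 k : (1/2) ^+ k <= 1 :> R by rewrite exprn_ile1 //; lra.
have half_small (e : R) : 0 < e -> \forall k \near \oo, (1/2) ^+ k <= e.
  move=> e0; have /cvgrPdist_le /(_ e e0) : (1/2) ^+ k @[k --> \oo] --> (0 : R).
    by apply: cvg_expr; rewrite ger0_norm; lra.
  by apply: filterS => k; rewrite sub0r normrN gtr0_norm.
have /choice [psi hpsi] : forall k, exists psi, forall v, `|ip psi v - ell v| <= (1/2) ^+ k * nrm v.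
  by move=> k; apply: riesz_approx.
exists psi.
(* Compare the two approximate representations of [ell] at [psi k - psi l] itself, then divide by
   its norm. *)
have psi_cauchy k l : nrm (psi k - psi l) <= (1/2) ^+ k + (1/2) ^+ l.
  set d := psi k - psi l; have [d0|d0] := eqVneq (nrm d) 0.
    by rewrite d0 addr_ge0 // ltW.
  have dp : 0 < nrm d by rewrite lt0r d0 ip_norm_ge0.
  rewrite -(ler_pM2r dp) -expr2 ip_norm_sqr {1}/d (linear_formB (ipL _)).
  have -> : ip (psi k) d - ip (psi l) d = (ip (psi k) d - ell d) - (ip (psi l) d - ell d) by ring.
  apply: le_trans (ler_norm _) _; apply: le_trans (ler_normB _ _) _.
  by rewrite mulrDl; apply: lerD.
pose M := nrm (psi 0%N) + 2.
have psi_bound k : nrm (psi k) <= M.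
  have -> : psi k = (psi k - psi 0%N) + psi 0%N by rewrite subrK.
  apply: le_trans (ip_normD _ _) _; rewrite /M addrC lerD2l.
  by apply: le_trans (psi_cauchy k 0%N) _; have := half1 k; rewrite expr0; lra.
have M0 : 0 <= M by apply: le_trans (psi_bound 0%N); exact: ip_norm_ge0.
(* Bounded forms converge along the Galerkin approximations to their limit along [psi]. *)
have weak_lim a (e : R) : bounded_form a -> 0 < e -> \forall k \near \oo,
    \forall s \near U, `|a (u s) - a (psi k)| <= e.
  move=> aB e0; have [aL _] := aB.
  pose e1 := e / (2 * (C + 1 + M)).
  have e10 : 0 < e1 by rewrite divr_gt0 //; lra.
  have [chi hchi] := riesz_approx aB e10.
  pose N := nrm chi; have N0 : 0 <= N := ip_norm_ge0 _.
  have e4 : 0 < e / (4 * (N + 1)) by rewrite divr_gt0 //; lra.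
  have e40 : 0 < e / 4 by rewrite divr_gt0.
  apply: filterS (half_small _ e4) => k hk.
  apply: filterS (hell chi _ e40) => s hs.
  set v := u s - psi k.
  have av : a (u s) - a (psi k) = a v by rewrite (linear_formB aL).
  have vb : nrm v <= C + 1 + M by apply: le_trans (ip_normB _ _) _; exact: lerD.
  have h1 : `|a v - ip chi v| <= e / 2.
    rewrite distrC; apply: le_trans (hchi v) _; apply: le_trans (ler_wpM2l (ltW e10) vb) _.
    by rewrite /e1 invfM mulrA divfK // gt_eqF //; lra.
  have h2 : `|ip chi v| <= e / 2.
    have -> : ip chi v = (ip (u s) chi - ell chi) - (ip (psi k) chi - ell chi).
      by rewrite (linear_formB (ipLr _)) !(ipC chi); ring.
    apply: le_trans (ler_normB _ _) _.
    have : `|ip (psi k) chi - ell chi| <= e / 4.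
      apply: le_trans (hpsi _ _) _; rewrite -/N.
      have : e / (4 * (N + 1)) * (N + 1) = e / 4 by field; lra.
      move: hk; rewrite -/N; set q := e / _ => hq hq'; have := half0 k; nra.
    lra.
  rewrite av (_ : a v = (a v - ip chi v) + ip chi v); last by rewrite subrK.
  by apply: le_trans (ler_normD _ _) _; lra.
split => //.
- move=> phi e e0.
  pose D := C + 1 + M; have D1 : 1 <= D by rewrite /D; lra.
  have e4 : 0 < e / 4 by lra.
  (* One half of [(e / 4 / D) ^+ 2] pays for the norm term, the other for the functionals [a i]; the
     factor [nrm (u s) + nrm (psi k) <= D] then leaves [e / 4]. *)
  have [e1 e1E e10] : exists2 e1 : R, (e / 4 / D) ^+ 2 = e1 + e1 & 0 < e1.
    by exists ((e / 4 / D) ^+ 2 / 2); [lra|rewrite divr_gt0 ?exprn_gt0 ?divr_gt0 //; lra].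
  have D2 : 0 < e1 / D ^+ 2 by rewrite divr_gt0 // exprn_gt0 //; lra.
  have [I [a [aB ha]]] := b_compact phi D2.
  pose n := #|I|.
  pose e2 := Num.sqrt (e1 / n.+1%:R).
  have e20 : 0 < e2 by rewrite sqrtr_gt0 divr_gt0.
  have H1 : \forall k \near \oo, forall i, \forall s \near U, `|a i (u s) - a i (psi k)| <= e2.
    by apply: filter_forall => i; exact: weak_lim.
  have H2 : \forall k \near \oo, (1/2) ^+ k * nrm phi <= e / 4.
    have q0 : 0 < e / 4 / (nrm phi + 1) by rewrite divr_gt0 //; have := ip_norm_ge0 phi; lra.
    apply: filterS (half_small _ q0) => k; have := ip_norm_ge0 phi => p0.
    rewrite ler_pdivlMr; last lra.
    by have := half0 k; nra.
  near=> k.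
  have h1 : forall i, \forall s \near U, `|a i (u s) - a i (psi k)| <= e2 by near: k.
  have h2 : (1/2) ^+ k * nrm phi <= e / 4 by near: k.
  have e8 : 0 < e / 8 by lra.
  have [s [[[h3 h4] h5] h6]] := filter_ex (filterI (filterI (filterI (filter_forall _ h1) (U_mem phi))
     (hell phi _ e8)) (U_size _ e8)).
  have [/(_ phi h4) hs _] := hu s.
  move: (_.+1%:R^-1) h6 hs => z h6 hs.
  have hsq : Num.sqrt (e1 / D ^+ 2 * nrm (u s - psi k) ^+ 2 + \sum_i a i (u s - psi k) ^+ 2)
      <= e / 4 / D.
    rewrite -[leRHS](@ger0_norm _ (e / 4 / D)) ?divr_ge0 //; try lra.
    rewrite -sqrtr_sqr; apply: ler_wsqrtr.
    rewrite e1E; apply: lerD.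
      rewrite mulrAC ler_pdivrMr ?exprn_gt0; try lra.
      rewrite ler_wpM2l ?(ltW e10) // lerXn2r ?nnegrE ?ip_norm_ge0 //; first lra.
      by apply: le_trans (ip_normB _ _) _; exact: lerD.
    apply: (@le_trans _ _ (\sum_(i : I) e1 / n.+1%:R)).
      apply: ler_sum => i _; rewrite -[leRHS]sqr_sqrtr -/e2; last exact: divr_ge0 (ltW e10) (ler0n _ _).
      have [aL _] := aB i; rewrite (linear_formB aL) -[leLHS]real_normK ?num_real //.
      by rewrite lerXn2r ?nnegrE ?(ltW e20).
    rewrite sumr_const -/n -[leLHS]mulr_natr -mulrA [_^-1 * _]mulrC.
    by rewrite ler_piMr ?(ltW e10) // ler_pdivrMr // mul1r ler_nat.
  have hb : `|b (u s) (u s) phi - b (psi k) (psi k) phi| <= e / 4.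
    apply: le_trans (ha _ _) _.
    have uk : nrm (u s) + nrm (psi k) <= D by exact: lerD.
    apply: le_trans (ler_pM _ _ uk hsq) _ => //.
    - by rewrite addr_ge0 ?ip_norm_ge0.
    - by rewrite mulrC divfK //; lra.
  have h7 := hpsi k phi.
  have -> : ip (psi k) phi + b (psi k) (psi k) phi - f phi =
    (ip (psi k) phi - ell phi) - (ip (u s) phi - ell phi) +
    (ip (u s) phi + b (u s) (u s) phi - f phi) - (b (u s) (u s) phi - b (psi k) (psi k) phi) by ring.
  apply: le_trans (ler_normB _ _) _.
  have := ler_normD ((ip (psi k) phi - ell phi) - (ip (u s) phi - ell phi)) (ip (u s) phi + b (u s) (u s) phi - f phi).
  have := ler_normB (ip (psi k) phi - ell phi) (ip (u s) phi - ell phi).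
  lra.
- move=> e e0; have e4 : 0 < e / 4 by lra.
  have q0 : 0 < e / (8 * (M + 1)) by rewrite divr_gt0 //; lra.
  near=> k.
  have h1 : \forall s \near U, `|f (u s) - f (psi k)| <= e / 4 by near: k; exact: weak_lim.
  have h2 : (1/2) ^+ k <= e / (8 * (M + 1)) by near: k; exact: half_small.
  have e8 : 0 < e / 8 by lra.
  have [s [[h3 h4] h5]] := filter_ex (filterI (filterI h1 (hell (psi k) _ e8)) (U_size _ e4)).
  have [_ hs] := hu s.
  move: (_.+1%:R^-1) h5 hs => z h5 hs.
  have h6 := hpsi k (psi k).
  have h7 : (1/2) ^+ k * nrm (psi k) <= e / 8.
    have : e / (8 * (M + 1)) * (M + 1) = e / 8 by field; lra.
    have := psi_bound k; have := ip_norm_ge0 (psi k); have := half0 k.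
    move: h2; set q := e / (8 * _); nra.
  (* Weak lower semicontinuity: the expanded square bounds [2 * ip (u s) (psi k) - ip (psi k) (psi
     k)] by [ip (u s) (u s)], and [ip (u s) (psi k)] is close to [ell (psi k)], itself close to
     [ip (psi k) (psi k)]. *)
  have h8 := ip_ge0 (u s - psi k); move: h8.
  rewrite (linear_formB (ipL _)) !(linear_formB (ipLr _)) (ipC (psi k) (u s)).
  move: h3 h4 h6; rewrite !ler_norml => /andP[h31 h32] /andP[h41 h42] /andP[h61 h62].
  lra.
Unshelve. all: by end_near. Qed.

End StationaryFlow.
End PreHilbert.

(** * Square integrable functions *)

Lemma quadratic_discriminant (R : realType) (a b c : R) : 0 <= a ->
  (forall t, 0 <= t ^+ 2 * a + 2 * t * b + c) -> b ^+ 2 <= a * c.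
Proof.
move=> a0 h; have c0 : 0 <= c by have := h 0; rewrite expr0n mulr0 !mul0r !add0r.
have [az|az] := eqVneq a 0.
  have [-> |b0] := eqVneq b 0; first by rewrite expr0n mulr_ge0.
  have := h (- (c + 1) / (2 * b)).
  have -> : (- (c + 1) / (2 * b)) ^+ 2 * a + 2 * (- (c + 1) / (2 * b)) * b + c = -1.
    by rewrite az; field.
  lra.
have := h (- b / a).
have -> : (- b / a) ^+ 2 * a + 2 * (- b / a) * b + c = c - b ^+ 2 / a by field.
by rewrite subr_ge0 ler_pdivrMr ?lt0r ?az // mulrC.
Qed.

Section SquareIntegrable.
Context d (T : measurableType d) (R : realType).
Variables (mu : {measure set T -> \bar R}) (D : set T).
Hypothesis mD : measurable D.
Implicit Types f g : T -> R.

Definition sqint f :=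
  measurable_fun D f /\ (\int[mu]_(x in D) (f x ^+ 2)%:E < +oo)%E.

Definition l2dot f g : R := \int[mu]_(x in D) (f x * g x).

Let sq_ge0 f x : (0 <= (f x ^+ 2)%:E)%E. Proof. by rewrite lee_fin sqr_ge0. Qed.

Let msq f : measurable_fun D f -> measurable_fun D (EFin \o (fun x => f x ^+ 2 : R)).
Proof. by move=> mf; apply/measurable_EFinP; exact: measurable_funX. Qed.

Lemma sqint_sqr f : sqint f -> mu.-integrable D (EFin \o (fun x => f x ^+ 2 : R)).
Proof.
move=> [mf fi]; apply/integrableP; split; first exact: msq.
by rewrite (eq_integral (fun x => (f x ^+ 2)%:E)) // => x _; rewrite gee0_abs //; exact: sq_ge0.
Qed.

Lemma integral_sqr f : sqint f ->
  (\int[mu]_(x in D) (f x ^+ 2)%:E)%E = (l2dot f f)%:E.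
Proof. by move=> /sqint_sqr fi; rewrite /l2dot /Rintegral fineK // integrable_fin_num. Qed.

Lemma sqint_mul f g : sqint f -> sqint g -> mu.-integrable D (EFin \o (fun x => f x * g x : R)).
Proof.
move=> sf sg.
apply: (@le_integrable _ _ _ mu D mD _ (EFin \o (fun x => f x ^+ 2 + g x ^+ 2 : R))).
- by apply/measurable_EFinP; apply: measurable_funM; [exact: sf.1|exact: sg.1].
- move=> x _; rewrite !abse_EFin lee_fin (ger0_norm (addr_ge0 (sqr_ge0 _) (sqr_ge0 _))).
  rewrite normrM -(real_normK (num_real (f x))) -(real_normK (num_real (g x))).
  have := sqr_ge0 (`|f x| - `|g x|); have := normr_ge0 (f x); have := normr_ge0 (g x); nra.
- apply: eq_integrable (integrableD mD (sqint_sqr sf) (sqint_sqr sg)) => //.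
Qed.

Lemma sqint_lin a f g : sqint f -> sqint g -> sqint (fun x => a * f x + g x).
Proof.
move=> sf sg; split.
  by apply: measurable_funD; [apply: measurable_funM => //; exact: sf.1|exact: sg.1].
have h := integrableD mD (integrableZl mD (2 * a ^+ 2) (sqint_sqr sf)) (integrableZl mD 2 (sqint_sqr sg)).
apply: le_lt_trans (integrable_lty mD h).
apply: ge0_le_integral => //.
- by move=> x _; rewrite lee_fin sqr_ge0.
- apply: (@msq (fun x => a * f x + g x)); apply: measurable_funD; last exact: sg.1.
  by apply: measurable_funM => //; exact: sf.1.
- by case/integrableP: h.
move=> x _ /=; rewrite -!EFinM -EFinD lee_fin.
by have := sqr_ge0 (a * f x - g x); nra.
Qed.

Lemma sqint0 : sqint (fun=> 0).
Proof. by split; [exact: measurable_cst|rewrite expr0n integral0]. Qed.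

Lemma sqintZ a f : sqint f -> sqint (fun x => a * f x).
Proof.
by move=> sf; have := sqint_lin a sf sqint0; congr sqint; apply/funext => x; rewrite addr0.
Qed.

Lemma sqintD f g : sqint f -> sqint g -> sqint (fun x => f x + g x).
Proof.
move=> sf sg; have := sqint_lin 1 sf sg.
by congr sqint; apply/funext => x; rewrite mul1r.
Qed.

Lemma sqintB f g : sqint f -> sqint g -> sqint (fun x => f x - g x).
Proof.
move=> sf sg; have := sqint_lin (-1) sg sf.
by congr sqint; apply/funext => x; rewrite mulN1r addrC.
Qed.

Lemma eq_sqint f g : {in D, f =1 g} -> sqint f -> sqint g.
Proof.
move=> fg [mf fi]; split; first exact: eq_measurable_fun mf.
by rewrite (eq_integral (fun x => (f x ^+ 2)%:E)) // => x xD; rewrite fg.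
Qed.

Lemma sqint_le f g : measurable_fun D f -> (forall x, D x -> `|f x| <= `|g x|) ->
  sqint g -> sqint f.
Proof.
move=> mf fg sg; split => //; apply: le_lt_trans sg.2.
apply: ge0_le_integral => //; [exact: msq|exact: msq sg.1|].
move=> x Dx; rewrite lee_fin -(real_normK (num_real (f x))) -(real_normK (num_real (g x))).
by rewrite lerXn2r ?nnegrE // fg.
Qed.

Lemma sqint_bounded f (c : T -> R) (C : R) : sqint f -> measurable_fun D c ->
  (forall x, D x -> `|c x| <= C) -> sqint (fun x => f x * c x).
Proof.
move=> sf mc cC; apply: (@sqint_le _ (fun x => C * f x)); last exact: sqintZ.
  by apply: measurable_funM => //; exact: sf.1.
move=> x Dx; rewrite !normrM mulrC ler_wpM2r //.
by apply: le_trans (cC x Dx) (ler_norm _).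
Qed.

Lemma l2dotC f g : l2dot f g = l2dot g f.
Proof. by apply: eq_Rintegral => x _; rewrite mulrC. Qed.

Lemma l2dot_lin a f g h : sqint f -> sqint g -> sqint h ->
  l2dot (fun x => a * f x + g x) h = a * l2dot f h + l2dot g h.
Proof.
move=> sf sg sh; rewrite /l2dot -RintegralZl //; last exact: sqint_mul.
rewrite -RintegralD //; last exact: sqint_mul.
  by apply: eq_Rintegral => x _; rewrite mulrDl mulrA.
by have := sqint_mul (sqintZ a sf) sh; congr integrable; apply/funext => x /=; rewrite mulrA.
Qed.

Lemma l2dot_linr a f g h : sqint f -> sqint g -> sqint h ->
  l2dot h (fun x => a * f x + g x) = a * l2dot h f + l2dot h g.
Proof. by move=> sf sg sh; rewrite l2dotC l2dot_lin // !(l2dotC h). Qed.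

Lemma l2dotB f g h : sqint f -> sqint g -> sqint h ->
  l2dot (fun x => f x - g x) h = l2dot f h - l2dot g h.
Proof.
move=> sf sg sh; have := l2dot_lin (-1) sg sf sh.
rewrite mulN1r [RHS]addrC => <-; apply: eq_Rintegral => x _; by rewrite mulN1r [- g x + _]addrC.
Qed.

Lemma l2dot_ge0 f : 0 <= l2dot f f.
Proof. by apply: Rintegral_ge0 => x _; rewrite -expr2 sqr_ge0. Qed.

Lemma le_l2dot f g : measurable_fun D f -> (forall x, D x -> `|f x| <= `|g x|) ->
  sqint g -> l2dot f f <= l2dot g g.
Proof.
move=> mf fg sg; have sf := sqint_le mf fg sg.
apply: le_Rintegral => //; [exact: sqint_mul|exact: sqint_mul|move=> x Dx].
by rewrite -!expr2 -(real_normK (num_real (f x))) -(real_normK (num_real (g x)))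
  lerXn2r ?nnegrE // fg.
Qed.

Lemma l2dot_bounded f (c : T -> R) (C : R) : sqint f -> measurable_fun D c ->
  (forall x, D x -> `|c x| <= C) -> 0 <= C ->
  l2dot (fun x => f x * c x) (fun x => f x * c x) <= C ^+ 2 * l2dot f f.
Proof.
move=> sf mc cC C0.
rewrite (_ : C ^+ 2 * _ = l2dot (fun x => C * f x) (fun x => C * f x)); last first.
  rewrite /l2dot -RintegralZl //; last exact: sqint_mul.
  by apply: eq_Rintegral => x _; rewrite expr2; ring.
apply: le_l2dot; last exact: sqintZ.
  by apply: measurable_funM => //; exact: sf.1.
move=> x Dx; rewrite !normrM mulrC ler_wpM2r //.
by apply: le_trans (cC x Dx) (ler_norm _).
Qed.

Lemma l2dot_cauchy_schwarz f g : sqint f -> sqint g ->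
  l2dot f g ^+ 2 <= l2dot f f * l2dot g g.
Proof.
move=> sf sg; apply: quadratic_discriminant; first exact: l2dot_ge0.
move=> t; have := l2dot_ge0 (fun x => t * f x + g x).
rewrite l2dot_lin //; last exact: sqint_lin.
rewrite 2!(l2dotC _ (fun x => t * f x + g x)) !l2dot_lin // (l2dotC g f).
by move=> h; apply: le_trans h _; rewrite le_eqVlt; apply/orP; left; apply/eqP; ring.
Qed.

Lemma l2dot_cs f g : sqint f -> sqint g ->
  `|l2dot f g| <= Num.sqrt (l2dot f f) * Num.sqrt (l2dot g g).
Proof.
move=> sf sg; rewrite -ler_sqr ?nnegrE ?mulr_ge0 ?sqrtr_ge0 //.
by rewrite exprMn !sqr_sqrtr ?l2dot_ge0 // real_normK ?num_real // l2dot_cauchy_schwarz.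
Qed.

Lemma limn_einf_le (u : (\bar R)^nat) (M : \bar R) :
  (\forall n \near \oo, u n <= M)%E -> (limn_einf u <= M)%E.
Proof.
move=> [N _ uM]; rewrite limn_einf_lim; apply: lime_le; first exact: is_cvg_einfs.
apply: nearW => n; apply: (@le_trans _ _ (u (maxn n N))).
  by apply: ereal_inf_lbound; exists (maxn n N) => //=; rewrite leq_maxl.
by apply: uM => /=; rewrite leq_maxr.
Qed.

Lemma sum_half_le (a : R) n : 0 <= a -> \sum_(0 <= k < n) a * (1/2) ^+ k <= 2 * a.
Proof.
move=> a0; suff -> : \sum_(0 <= k < n) a * (1/2) ^+ k = 2 * a * (1 - (1/2) ^+ n).
  by have : 0 <= (1/2 : R) ^+ n by [exact: exprn_ge0]; nra.
elim: n => [|n IH]; first by rewrite big_nil expr0 subrr mulr0.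
by rewrite big_nat_recr //= IH exprS; lra.
Qed.

Lemma nneseries_half_lty (a : nat -> R) (C : R) :
  (forall k, 0 <= a k <= C * (1/2) ^+ k) -> (\sum_(0 <= k <oo) (a k)%:E < +oo)%E.
Proof.
move=> ha; have C0 : 0 <= C by have /andP[h /(le_trans h)] := ha 0%N; rewrite expr0 mulr1.
apply: (@le_lt_trans _ _ (2 * C)%:E); last by rewrite ltry.
apply: lime_le.
  by apply: is_cvg_nneseries => k _ _; rewrite lee_fin; have /andP[] := ha k.
apply: nearW => n /=; rewrite sumEFin lee_fin; apply: le_trans (sum_half_le n C0).
by apply: ler_sum => k _; have /andP[] := ha k.
Qed.

Let cauchy_rate_le (C : R) (k l : nat) : (k <= l)%N ->
  (C * ((1/2) ^+ l + (1/2) ^+ k)) ^+ 2 <= (2 * C * (1/2) ^+ k) ^+ 2.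
Proof.
move=> kl; rewrite (mulrC 2 C) -(mulrA C 2).
have qk : 0 <= (1/2 : R) ^+ k by exact: exprn_ge0.
have ql : 0 <= (1/2 : R) ^+ l by exact: exprn_ge0.
have qlk : (1/2 : R) ^+ l <= (1/2) ^+ k by apply: ler_wiXn2l => //; lra.
move: ((1/2) ^+ k) ((1/2) ^+ l) qk ql qlk => q r q0 r0 rq.
rewrite [leLHS]exprMn [leRHS]exprMn ler_wpM2l ?sqr_ge0 //.
by rewrite lerXn2r ?nnegrE //; lra.
Qed.

(* Weighting the increments by [2 ^ k] makes the square function integrable, and its
   finiteness forces absolute convergence since [2 d <= 2 ^- k + 2 ^ k * d ^ 2]. *)
Lemma l2_complete (f : nat -> T -> R) (C : R) : (forall k, sqint (f k)) ->
  (forall k l, l2dot (fun x => f k x - f l x) (fun x => f k x - f l x) <=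
     (C * ((1/2) ^+ k + (1/2) ^+ l)) ^+ 2) ->
  exists g, sqint g /\ forall k,
    l2dot (fun x => g x - f k x) (fun x => g x - f k x) <= (2 * C * (1/2) ^+ k) ^+ 2.
Proof.
move=> sf hf; pose dd k x : R := 2 ^+ k * (f k.+1 x - f k x) ^+ 2.
pose S x : \bar R := (\sum_(0 <= k <oo) (dd k x)%:E)%E.
have dd0 k x : 0 <= dd k x by apply: mulr_ge0; [exact: exprn_ge0|exact: sqr_ge0].
have mdd k : measurable_fun D (fun x => dd k x).
  apply: measurable_funM => //; apply: measurable_funX.
  exact: (sqintB (sf k.+1) (sf k)).1.
have mS : measurable_fun D S.
  by apply: ge0_emeasurable_sum => k *; [rewrite lee_fin|apply/measurable_EFinP].
have h2 k : (2 : R) ^+ k * (1/2) ^+ k = 1 by rewrite -exprMn mulrC divfK // expr1n.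
have intS : (\int[mu]_(x in D) S x < +oo)%E.
  rewrite /S (@integral_nneseries _ _ _ mu D mD (fun k x => (dd k x)%:E)); first last.
  - by move=> k x _; rewrite lee_fin.
  - by move=> k; apply/measurable_EFinP.
  have E k : (\int[mu]_(x in D) (dd k x)%:E)%E =
      (2 ^+ k * l2dot (fun x => f k.+1 x - f k x) (fun x => f k.+1 x - f k x))%:E.
    rewrite EFinM -integral_sqr; last exact: sqintB.
    rewrite -ge0_integralZl ?lee_fin ?exprn_ge0 //.
      by apply/measurable_EFinP/measurable_funX; exact: (sqintB (sf k.+1) (sf k)).1.
    by move=> x _; rewrite lee_fin sqr_ge0.
  under eq_eseriesr => k _ do rewrite E.
  apply: (@nneseries_half_lty _ (4 * C ^+ 2)) => k; rewrite mulr_ge0 ?l2dot_ge0 ?exprn_ge0 //=.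
  apply: le_trans (ler_wpM2l _ (hf k.+1 k)) _; first exact: exprn_ge0.
  have -> : 4 * C ^+ 2 * (1/2) ^+ k = 2 ^+ k * (2 * C * (1/2) ^+ k) ^+ 2.
    rewrite -[LHS]mul1r -[X in X * _](h2 k); move: (2 ^+ k) ((1/2) ^+ k) => p q; ring.
  have q0 : 0 <= (1/2 : R) ^+ k by exact: exprn_ge0.
  rewrite ler_wpM2l ?exprn_ge0 // (exprS (1/2)) (mulrC 2 C) -(mulrA C 2).
  move: ((1/2) ^+ k) q0 => q q0; rewrite [leLHS]exprMn [leRHS]exprMn ler_wpM2l ?sqr_ge0 //.
  by rewrite lerXn2r ?nnegrE //; lra.
pose A := D `&` [set x | S x \is a fin_num].
have mA : measurable A by exact: emeasurable_fin_num.
have aeA : {ae mu, forall x, D x -> A x}.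
  have iS : mu.-integrable D S.
    apply/integrableP; split => //; rewrite (eq_integral S) // => x _.
    by rewrite gee0_abs // /S nneseries_ge0 // => k _ _; rewrite lee_fin.
  by apply: filterS (integrable_ae mD iS) => x h Dx; split => //; exact: h.
(* On the null set where [S] is infinite the sequence is replaced by 0, so that the limit exists at
   every point of [D] and is measurable. *)
pose h k x := f k x * \1_A x.
have mh k : measurable_fun D (h k).
  by apply: measurable_funM; [exact: (sf k).1|exact: measurable_indic].
have cvh x : D x -> cvgn (fun k => h k x).
  move=> Dx; case: (pselect (A x)) => [Ax|nAx]; last first.
    rewrite (_ : (fun k => h k x) = cst 0); first exact: is_cvg_cst.
    by apply/funext => k; rewrite /h indicE memNset // mulr0.
  have -> : (fun k => h k x) = (fun k => f k x).
    by apply/funext => k; rewrite /h indicE mem_set // mulr1.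
  pose v k := f k.+1 x - f k x.
  have cv : cvgn (series v).
    apply: normed_cvg; apply: nondecreasing_is_cvgn.
      by apply/nondecreasing_seqP => n; rewrite /series /= [leRHS]big_nat_recr //= lerDl normr_ge0.
    exists ((2 + fine (S x)) / 2) => _ [n _ <-]; rewrite /series /=.
    have Sn : \sum_(0 <= k < n) dd k x <= fine (S x).
      have [_ Sfin] := Ax; rewrite -lee_fin fineK // -sumEFin.
      by apply: nneseries_lim_ge => k _; rewrite lee_fin.
    have := @sum_half_le 1 n ler01; rewrite mulr1 => hn.
    rewrite ler_pdivlMr // mulr_suml; apply: le_trans (lerD hn Sn).
    rewrite -big_split /=; apply: ler_sum => k _; rewrite mul1r /dd -/(v k) -(real_normK (num_real (v k))).
    have e : (1/2 : R) ^+ k + 2 ^+ k * `|v k| ^+ 2 - `|v k| * 2 = 2 ^+ k * (`|v k| - (1/2) ^+ k) ^+ 2.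
      move: (h2 k); move: (2 ^+ k) ((1/2) ^+ k) `|v k| => p q w pq.
      transitivity (p * w ^+ 2 - 2 * w * (p * q) + (p * q) * q); last by ring.
      by rewrite pq; ring.
    by rewrite -subr_ge0 e; apply: mulr_ge0; [exact: exprn_ge0|exact: sqr_ge0].
  have -> : (fun k => f k x) = (fun k => f 0%N x + series v k).
    by apply/funext => k; rewrite (eq_sum_telescope (fun k => f k x) k).
  by apply: is_cvgD => //; exact: is_cvg_cst.
pose g x := limn (fun k => h k x).
have hg x : D x -> (fun k => h k x) @ \oo --> g x by exact: cvh.
have mg : measurable_fun D g by apply: (measurable_fun_cvg mh).
(* Fatou's lemma in [l] carries the Cauchy bound over to the limit; for [l >= k] the two rates add
   up to at most [2 * (1/2) ^+ k]. *)
have fatou_k k : (\int[mu]_(x in D) ((g x - f k x) ^+ 2)%:E <= ((2 * C * (1/2) ^+ k) ^+ 2)%:E)%E.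
  have -> : (\int[mu]_(x in D) ((g x - f k x) ^+ 2)%:E =
      \int[mu]_(x in D) limn_einf (fun l => ((h l x - f k x) ^+ 2)%:E))%E.
    apply: eq_integral => x /set_mem Dx; apply/esym.
    apply: (cvg_limn_einf_sup _).1; apply: cvg_EFin; first exact: nearW.
    by under eq_fun do rewrite /= expr2; rewrite expr2; apply: cvgM; apply: cvgB; (exact: hg || exact: cvg_cst).
  apply: le_trans (fatou _ _ _ _) _ => //.
  - by move=> l; apply/measurable_EFinP/measurable_funX/measurable_funB; [exact: mh|exact: (sf k).1].
  - by move=> l x _; rewrite lee_fin sqr_ge0.
  apply: limn_einf_le; exists k => // l /= kl.
  have -> : (\int[mu]_(x in D) ((h l x - f k x) ^+ 2)%:E = \int[mu]_(x in D) ((f l x - f k x) ^+ 2)%:E)%E.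
    apply: ae_eq_integral => //.
    - by apply/measurable_EFinP/measurable_funX/measurable_funB; [exact: mh|exact: (sf k).1].
    - by apply/measurable_EFinP/measurable_funX; exact: (sqintB (sf l) (sf k)).1.
    by apply: filterS aeA => x hA Dx; rewrite /h indicE mem_set ?mulr1 //; exact: hA.
  rewrite integral_sqr ?lee_fin; last exact: sqintB.
  exact: le_trans (hf l k) (cauchy_rate_le _ kl).
have sg0 : sqint (fun x => g x - f 0%N x).
  split; first by apply: measurable_funB => //; exact: (sf 0%N).1.
  by apply: le_lt_trans (fatou_k 0%N) _; rewrite ltry.
have sg : sqint g.
  by apply: eq_sqint (sqintD sg0 (sf 0%N)) => x _; rewrite subrK.
exists g; split => // k; rewrite -lee_fin -integral_sqr //; exact: sqintB.
Qed.

End SquareIntegrable.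

(** * Calculus on the plane *)

Section PlaneAnalysis.
Variable R : realType.
Implicit Types (f g : R * R -> R) (x : R * R).
Local Notation D := (halfplane R : set (plane R)).
Local Notation mu := (lebesgue2 R).

(** The measurable structure of [plane R] is the product one, so topology has to be tied to it: an
    open set is the countable union of the rational boxes that it contains. *)
Lemma open_measurable_plane (U : set (R * R)) : open U -> measurable (U : set (plane R)).
Proof.
move=> oU.
pose box (a b c d : rat) : set (plane R) :=
  `]ratr a, ratr b[%classic `*` `]ratr c, ratr d[%classic.
have -> : (U : set (plane R)) = \bigcup_a \bigcup_b \bigcup_c \bigcup_d
    (if pselect (box a b c d `<=` U) then box a b c d else set0).
  apply/seteqP; split => [x Ux|x [a aT [b bT [c cT [d dT]]]]]; last first.
    by case: pselect => // bU /bU.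
  have /nbhs_ballP [e /= e0 eU] : nbhs x U by exact: open_nbhs_nbhs.
  have L (t : R) : exists2 p : rat * rat, ratr p.1 < t < ratr p.2 &
      forall s, ratr p.1 < s < ratr p.2 -> ball t e s.
    have [p] := rat_in_itvoo (ltac:(by rewrite ltrBlDr ltrDl) : t - e < t).
    have [q] := rat_in_itvoo (ltac:(by rewrite ltrDl) : t < t + e).
    rewrite !in_itv /= => /andP[q1 q2] /andP[p1 p2]; exists (p, q) => /=; first by rewrite p2.
    move=> s /andP[s1 s2]; rewrite /ball /= ltr_norml; apply/andP; split; lra.
  have [[a b] /= x1 hab] := L x.1; have [[c d] /= x2 hcd] := L x.2.
  exists a => //; exists b => //; exists c => //; exists d => //.
  case: pselect => [bU|nbU]; first by split; rewrite /= in_itv.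
  by case: nbU => y [/=]; rewrite !in_itv /= => y1 y2; apply: eU; split; [exact: hab|exact: hcd].
do 4 (apply: bigcupT_measurable_rat => ?); case: pselect => bU /=; last exact: measurable0.
by apply: measurableX; exact: measurable_itv.
Qed.

Lemma closed_measurable_plane (U : set (R * R)) : closed U -> measurable (U : set (plane R)).
Proof.
move=> cU; rewrite -(setCK U); apply: measurableC; apply: open_measurable_plane.
exact: closed_openC.
Qed.

Lemma compact_measurable_plane (K : set (R * R)) : compact K -> measurable (K : set (plane R)).
Proof.
move=> /(compact_closed _) cK; apply: closed_measurable_plane; apply: cK.
exact: norm_hausdorff.
Qed.

Lemma open_continuous_measurable_plane (U : set (R * R)) f : open U ->
  (forall x, U x -> {for x, continuous f}) ->
  measurable_fun (U : set (plane R)) (f : plane R -> R).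
Proof.
move=> oU cf; apply: (measurability _ (RGenOInfty.measurableE R)) => //.
move=> /= _ [_ [a ->] <-].
apply: open_measurable_plane; rewrite openE => x [Ux fx].
apply: filterI; first exact: open_nbhs_nbhs.
by apply: (cf x Ux); apply: open_nbhs_nbhs; split => //; exact: interval_open.
Qed.

Lemma continuous_measurable_plane f : continuous f ->
  measurable_fun [set: plane R] (f : plane R -> R).
Proof. by move=> cf; apply: open_continuous_measurable_plane; [exact: openT|move=> x _; exact: cf]. Qed.

Lemma open_halfplane : open (halfplane R).
Proof.
rewrite (_ : halfplane R = snd @^-1` `]0, +oo[%classic).
  by apply: open_comp; [move=> x _; exact: cvg_snd|exact: interval_open].
by apply/funext => x; rewrite /= in_itv /= andbT.
Qed.

Lemma measurable_halfplane : measurable D.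
Proof. exact: open_measurable_plane open_halfplane. Qed.

Definition slice (j : 'I_2) f x : R -> R :=
  fun t => f (if j == 0 then (t, x.2) else (x.1, t)).

Definition coord (j : 'I_2) x : R := if j == 0 then x.1 else x.2.

Let growthE j f x :
  (fun h : R => h^-1 *: ((f \o shift x) (h *: std_vec R j) - f x)) =
  (fun h : R => h^-1 *: ((slice j f x \o shift (coord j x)) (h *: 1) - slice j f x (coord j x))).
Proof.
apply/funext => h /=; rewrite /slice /coord; case: x => a b /=.
congr (_ *: (f _ - f _)); case: j => -[|[|//]] ? //=; rewrite /std_vec /=;
  by congr (_, _); rewrite /= ?scaler0 ?add0r // [LHS]/=.
Qed.

(** The two difference quotients are the same function, so a partial derivative is an ordinary
    derivative along a line. *)
Lemma is_derive_slice j f x df :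
  is_derive x (std_vec R j) f df <-> is_derive (coord j x) 1 (slice j f x) df.
Proof.
split=> -[]; rewrite /derivable /derive.
  by rewrite growthE => h1 h2; split.
by rewrite -growthE => h1 h2; split.
Qed.

Lemma continuous_slice j f x : continuous f -> continuous (slice j f x).
Proof.
move=> cf t; rewrite /slice; case: (j == 0).
  apply: (@continuous_comp _ _ _ (fun t => (t, x.2)) f); last exact: cf.
  exact: (cvg_pair cvg_id (cvg_cst _)).
apply: (@continuous_comp _ _ _ (fun t => (x.1, t)) f); last exact: cf.
exact: (cvg_pair (cvg_cst _) cvg_id).
Qed.

Lemma integral_off d (T : measurableType d) (m : {measure set T -> \bar R}) (A : set T)
  (f : T -> \bar R) : (forall t, ~ A t -> f t = 0%E) ->
  (\int[m]_(t in A) f t = \int[m]_t f t)%E.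
Proof.
move=> f0; rewrite integral_mkcond; apply: eq_integral => x _.
by rewrite patchE; case: ifPn => // /negP xA; rewrite f0 // => Ax; apply: xA; rewrite inE.
Qed.

Lemma ftc_segment (g G : R -> R) a b : a <= b ->
  (forall t : R, is_derive t 1 g (G t)) -> continuous G ->
  (\int[lebesgue_measure]_(x in `[a, b]) (G x)%:E = (g b - g a)%:E)%E.
Proof.
rewrite le_eqVlt => /predU1P[<- _ _|ab dg cG].
  by rewrite set_itv1 integral_set1 subrr.
have cg t : {for t, continuous g}.
  by apply/differentiable_continuous/derivable1_diffP; have [] := dg t.
rewrite (@continuous_FTC2 _ G g a b ab) ?EFinB //.
- exact: continuous_subspaceT.
- split=> [t _||]; first by have [] := dg t.
    by apply: cvg_at_right_filter; exact: cg.
  by apply: cvg_at_left_filter; exact: cg.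
- by move=> t _; rewrite derive1E; have [] := dg t.
Qed.

(** The bounds are strict: the function vanishes on the border of the box, its side on the axis
    included, and integration by parts leaves no boundary term. *)
Definition csupp (M : R) f :=
  forall x, f x != 0 -> [/\ `|x.1| < M, 0 < x.2 & x.2 < M].

Definition cc_fun f := continuous f /\ exists M, csupp M f.

Lemma csupp_le M N f : M <= N -> csupp M f -> csupp N f.
Proof. by move=> MN h x /h[? ? ?]; split => //; lra. Qed.

Lemma cc_mul f g : cc_fun f -> continuous g -> cc_fun (fun x => f x * g x).
Proof.
move=> [cf [M hM]] cg; split; first by move=> x; apply: cvgM; [exact: cf|exact: cg].
by exists M => x fg; apply: hM; apply: contraNneq fg => ->; rewrite mul0r.
Qed.

Lemma cc_lin a f g : cc_fun f -> cc_fun g -> cc_fun (fun x => a * f x + g x).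
Proof.
move=> [cf [M hM]] [cg [N hN]]; split.
  by move=> x; apply: cvgD; [apply: cvgM; [exact: cvg_cst|exact: cf]|exact: cg].
exists (Num.max M N) => x h.
have [f0|f0] := eqVneq (f x) 0; last by apply: csupp_le hM _ f0; rewrite le_max lexx.
have [g0|g0] := eqVneq (g x) 0; last by apply: csupp_le hN _ g0; rewrite le_max lexx orbT.
by move: h; rewrite f0 g0 mulr0 addr0 eqxx.
Qed.

Lemma cc0 : cc_fun (fun=> 0).
Proof. by split; [move=> x; exact: cvg_cst|exists 0 => x; rewrite eqxx]. Qed.

Definition square (M : R) : set (plane R) := `[- M, M]%classic `*` `[- M, M]%classic.

Lemma csupp_square M f x : csupp M f -> ~ square M x -> f x = 0.
Proof.
move=> hM nx; apply/eqP/negPn/negP => /hM[h1 h2 h3]; apply: nx.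
move: h1; rewrite ltr_norml => /andP[? ?].
by split; rewrite /= in_itv /=; apply/andP; split; lra.
Qed.

Lemma measurable_square M : measurable (square M).
Proof. by apply: measurableX; exact: measurable_itv. Qed.

Lemma square_lty M : (mu (square M) < +oo)%E.
Proof.
have -> : mu (square M) =
    (lebesgue_measure `[(- M)%R, M]%classic * lebesgue_measure `[(- M)%R, M]%classic)%E.
  by apply: product_measure1E; exact: measurable_itv.
by rewrite lebesgue_measure_itv /=; case: ifP => _; rewrite ?mule0 // -EFinB -EFinM ltry.
Qed.

Lemma cc_bounded f : cc_fun f -> exists2 C : R, 0 <= C & forall x, `|f x| <= C.
Proof.
move=> [cf [M hM]].
have cK : compact (square M : set (R * R)) by apply: compact_setX; exact: segment_compact.
have /compact_bounded[B [_ hB]] : compact (f @` (square M : set (R * R))).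
  by apply: continuous_compact => //; exact: continuous_subspaceT.
exists (Num.max 0 (B + 1)); first by rewrite le_max lexx.
move=> x; case: (pselect (square M x)) => [sx|nx]; last first.
  by rewrite (csupp_square hM nx) normr0 le_max lexx.
rewrite le_max; apply/orP; right; apply: (hB (B + 1)); first by rewrite ltrDl.
by exists x.
Qed.

Lemma cc_integrable f : cc_fun f -> mu.-integrable setT (EFin \o f).
Proof.
move=> ccf; have [C C0 hC] := cc_bounded ccf; have [cf [M hM]] := ccf.
have mf := continuous_measurable_plane cf.
apply: (@le_integrable _ _ _ mu setT measurableT _ (EFin \o (fun x => C * \1_(square M) x))).
- exact/measurable_EFinP.
- move=> x _; rewrite !abse_EFin lee_fin normrM (ger0_norm C0) indicE.
  case: (boolP (x \in square M)) => xM; first by rewrite normr1 mulr1 hC.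
  by rewrite (csupp_square hM) ?normr0 ?mulr0 // => sx; move: xM; rewrite mem_set.
- apply: eq_integrable (integrableZl measurableT C (_ : mu.-integrable setT (EFin \o \1_(square M)))) => //.
  apply/integrableP; split.
    by apply/measurable_EFinP; apply: measurable_indic; exact: measurable_square.
  rewrite (eq_integral (EFin \o \1_(square M))); last first.
    by move=> x _; rewrite gee0_abs // lee_fin indicE.
  rewrite /comp integral_indic ?setIT //; [exact: square_lty|exact: measurable_square].
Qed.

Lemma cc_integrableD f : cc_fun f -> mu.-integrable D (EFin \o f).
Proof.
move=> /cc_integrable; apply: integrableS => //; exact: measurable_halfplane.
Qed.

Lemma cc_sqint f : cc_fun f -> sqint mu D f.
Proof.
move=> ccf; split.
  apply: (@measurable_funS _ _ _ _ setT) => //.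
  exact: continuous_measurable_plane ccf.1.
have h := cc_integrableD (cc_mul ccf ccf.1).
by have := integrable_lty measurable_halfplane h.
Qed.

(** Integrate first along direction [j]: on each line the integral of [G] is the increment of [g]
    between [- B] and [B], where [g] vanishes. The half-plane may be replaced by the plane since [G]
    vanishes outside it. *)
Lemma cc_int_partial j g G : cc_fun G -> (exists M, csupp M g) ->
  (forall x, is_derive x (std_vec R j) g (G x)) -> \int[mu]_(x in D) G x = 0.
Proof.
move=> ccG [N hN] dg; have [cG [M hM]] := ccG.
have iG := cc_integrable ccG.
pose B := Num.max 0 (Num.max M N).
have B0 : 0 <= B by rewrite le_max lexx.
have {}hM : csupp B G by apply: csupp_le hM; rewrite !le_max lexx orbT.
have {}hN : csupp B g by apply: csupp_le hN; rewrite !le_max lexx !orbT.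
rewrite /Rintegral integral_off; last first.
  move=> x Dx; have [-> //|/hM[_ x2 _]] := eqVneq (G x) 0; by exfalso.
have line x : (forall t, B <= `|t| -> slice j g x t = 0) ->
    (forall t, B <= `|t| -> slice j G x t = 0) ->
    (\int[lebesgue_measure]_t (slice j G x t)%:E = 0)%E.
  move=> g0 G0.
  transitivity (\int[lebesgue_measure]_(t in `[(- B)%R, B]) (slice j G x t)%:E)%E.
    apply/esym/integral_off => t /= tB; rewrite G0 //; move: tB; rewrite in_itv /= -ler_norml => /negP.
    by rewrite -ltNge => /ltW.
  have dsl (t : R) : is_derive t 1 (slice j g x) (slice j G x t).
    pose y := if j == 0 then (t, x.2) else (x.1, t).
    have := (is_derive_slice j g y (G y)).1 (dg y).
    by rewrite /y /slice /coord; case: (j == 0).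
  have BB : - B <= B by lra.
  rewrite (ftc_segment BB dsl (@continuous_slice j G x cG)).
  by rewrite !g0 ?subrr ?normrN ?ger0_norm.
have zero f y : csupp B f -> B <= `|y.1| \/ B <= `|y.2| -> f y = 0.
  move=> hf hy; apply/eqP/negPn/negP => /hf[h1 h2 h3].
  by move: hy; rewrite (gtr0_norm h2) !leNgt h1 h3 => -[].
case: (eqVneq j 0) => [j0|j1].
  rewrite -integral21_prod_meas1 // /fubini_G.
  under eq_integral => y _.
    rewrite (_ : (\int[lebesgue_measure]_x (EFin \o G) (x, y) = 0)%E); last first.
      have := line (0, y); rewrite /slice j0 eqxx /=; apply => t tB; apply: zero => //; by left.
    over.
  by rewrite integral0.
rewrite -integral12_prod_meas1 // /fubini_F.
under eq_integral => y _.
  rewrite (_ : (\int[lebesgue_measure]_x (EFin \o G) (y, x) = 0)%E); last first.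
    have := line (y, 0); rewrite /slice (negbTE j1) /=; apply => t tB; apply: zero => //; by right.
  over.
by rewrite integral0.
Qed.

End PlaneAnalysis.

(** * Solenoidal test fields *)

Lemma is_derive_lin (R : realType) (V : normedModType R) (f g : V -> R) x v a df dg :
  is_derive x v f df -> is_derive x v g dg ->
  is_derive x v (fun y => a * f y + g y) (a * df + dg).
Proof. by move=> hf hg; exact: (is_deriveD (is_deriveZ a hf) hg). Qed.

Section TestFunctions.
Variable R : realType.
Implicit Types (f g : R * R -> R) (x : R * R).

Lemma iter_partial_lin a f g (s : seq 'I_2) : smooth f -> smooth g ->
  iter_partial s (fun x => a * f x + g x) =
  (fun x => a * iter_partial s f x + iter_partial s g x).
Proof.
move=> sf sg; elim: s => // j s IH /=; rewrite IH; apply/funext => x.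
by have [] := is_derive_lin a (derivableP ((sf s).2 j x)) (derivableP ((sg s).2 j x)).
Qed.

Lemma smooth_lin a f g : smooth f -> smooth g -> smooth (fun x => a * f x + g x).
Proof.
move=> sf sg s; rewrite iter_partial_lin //; split.
  move=> x; apply: cvgD; last exact: (sg s).1.
  by apply: cvgM; [exact: cvg_cst|exact: (sf s).1].
move=> j x.
by have [] := is_derive_lin a (derivableP ((sf s).2 j x)) (derivableP ((sg s).2 j x)).
Qed.

Lemma test_lin a f g : test_function f -> test_function g ->
  test_function (fun x => a * f x + g x).
Proof.
move=> [sf cf hf] [sg cg hg].
have sub : closure [set x | a * f x + g x != 0] `<=`
    closure [set x | f x != 0] `|` closure [set x | g x != 0].
  rewrite -closureU; apply: closure_subset => x /= h.
  case: (eqVneq (f x) 0) => [f0|]; last by left.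
  by right; move: h; rewrite f0 mulr0 add0r.
split; first exact: smooth_lin.
- apply: (subclosed_compact _ (compactU cf cg) sub); exact: closed_closure.
- by move=> x /sub[/hf|/hg].
Qed.

Lemma test_fun0 : test_function (fun _ : R * R => 0 : R).
Proof.
have E s : iter_partial s (fun _ : R * R => 0 : R) = (fun _ => 0).
  elim: s => //= j s ->; apply/funext => x; rewrite /partial; exact: derive_cst.
rewrite /test_function (_ : [set x | _] = set0); last first.
  by apply/seteqP; split => x //=; rewrite eqxx.
rewrite closure0; split => //; last exact: compact0.
move=> s; rewrite E; split; first by move=> x; exact: cvg_cst.
by move=> j x; exact: derivable_cst.
Qed.

Lemma test_near0 f x : ~ closure [set y | f y != 0] x -> \forall y \near x, f y = 0.
Proof.
move=> nx; have /closed_openC oC := @closed_closure _ [set y | f y != 0].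
apply: filterS (open_nbhs_nbhs (conj oC nx)) => y /= ny.
by apply/eqP/negPn/negP => fy; apply: ny; exact: subset_closure.
Qed.

Lemma test_partial_off f j x : ~ closure [set y | f y != 0] x -> partial j f x = 0.
Proof.
move=> /test_near0 h; rewrite /partial (@near_eq_derive _ _ _ _ (cst 0)) ?derive_cst //.
Qed.

Lemma test_csupp f : test_function f -> exists2 M : R, 0 < M &
  forall x, closure [set y | f y != 0] x -> [/\ `|x.1| < M, 0 < x.2 & x.2 < M].
Proof.
move=> [_ cf hf]; have [B [_ hB]] := compact_bounded cf.
exists (Num.max 1 (B + 2)); first by rewrite lt_max ltr01.
move=> x cx; have := hB (B + 1) _ x cx; rewrite ltrDl ltr01 => /(_ isT).
rewrite [X in X -> _]/= prod_normE ge_max => /andP[h1 h2]; have := hf x cx; rewrite /= => x2.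
have h3 := ler_norm x.2.
by split => //; rewrite lt_max; apply/orP; right; lra.
Qed.

Lemma test_cc f : test_function f -> cc_fun f.
Proof.
move=> tf; split; first by have [sf _ _] := tf; exact: (sf [::]).1.
have [M _ hM] := test_csupp tf; exists M => x fx; apply: hM; exact: subset_closure.
Qed.

Lemma test_partial_cc f j : test_function f -> cc_fun (partial j f).
Proof.
move=> tf; split; first by have [sf _ _] := tf; exact: (sf [:: j]).1.
have [M _ hM] := test_csupp tf; exists M => x fx; apply: hM; apply: contrapT => nx.
by move: fx; rewrite (test_partial_off j nx) eqxx.
Qed.

Lemma test_is_derive f j x : test_function f ->
  is_derive x (std_vec R j) f (partial j f x).
Proof. by move=> [sf _ _]; split => //; exact: (sf [::]).2. Qed.

Lemma partial_lin a f g j : test_function f -> test_function g ->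
  partial j (fun x => a * f x + g x) = (fun x => a * partial j f x + partial j g x).
Proof. by move=> [sf _ _] [sg _ _]; exact: (iter_partial_lin a [:: j] sf sg). Qed.

Lemma solenoidal_lin a (u v : 'I_2 -> R * R -> R) :
  solenoidal_test u -> solenoidal_test v -> solenoidal_test (a *: u + v).
Proof.
move=> [tu du] [tv dv]; split=> [i|x]; first exact: test_lin.
have E i : partial i ((a *: u + v) i) x = a * partial i (u i) x + partial i (v i) x.
  by rewrite -[RHS]/((fun x => a * partial i (u i) x + partial i (v i) x) x) -partial_lin.
under eq_bigr => i _ do rewrite E.
by rewrite big_split /= -mulr_sumr du dv mulr0 addr0.
Qed.

Lemma solenoidal0 : solenoidal_test (0 : 'I_2 -> R * R -> R).
Proof.
split=> [i|x]; first exact: test_fun0.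
by rewrite big1 // => i _; rewrite /partial; exact: derive_cst.
Qed.

End TestFunctions.

Definition solenoidal (R : realType) : {pred ('I_2 -> R * R -> R)} :=
  fun u => `[< solenoidal_test u >].

Lemma solenoidal_submod (R : realType) : submod_closed (@solenoidal R).
Proof.
split; first by apply/asboolP; exact: solenoidal0.
by move=> a u v /asboolP su /asboolP sv; apply/asboolP; exact: solenoidal_lin.
Qed.

HB.instance Definition _ (R : realType) :=
  GRing.isSubmodClosed.Build R ('I_2 -> R * R -> R) (@solenoidal R) (@solenoidal_submod R).

(** As a submodule of the function space, the solenoidal test fields become the [lmodType] to which
    the abstract existence result applies. *)
Record solfield (R : realType) :=
  SolField { solval :> 'I_2 -> R * R -> R; solvalP : solval \in @solenoidal R }.

HB.instance Definition _ (R : realType) := [isSub for @solval R].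
HB.instance Definition _ (R : realType) := [Choice of solfield R by <:].
HB.instance Definition _ (R : realType) := [SubChoice_isSubLmodule of solfield R by <:].

Lemma is_derive_mul (R : realType) (V : normedModType R) (f g : V -> R) x v df dg :
  is_derive x v f df -> is_derive x v g dg ->
  is_derive x v (fun y => f y * g y) (f x * dg + g x * df).
Proof. by move=> hf hg; exact: (is_deriveM hf hg). Qed.

(** * Dirichlet product, convection form and force *)

Section EnergyForms.
Variable R : realType.
Local Notation D := (halfplane R : set (plane R)).
Local Notation mu := (lebesgue2 R).
Local Notation E := (solfield R).
Local Notation dot := (l2dot mu D).
Implicit Types u v w : E.

Lemma solfield_test u i : test_function (u i).
Proof. by have /asboolP[+ _] := solvalP u; exact. Qed.

Lemma solfield_div u x : \sum_(i < 2) partial i (u i) x = 0.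
Proof. by have /asboolP[_ +] := solvalP u; exact. Qed.

Lemma solfield_lin a u v i : solval (a *: u + v) i = (fun x => a * u i x + v i x).
Proof. by []. Qed.

Lemma solfield_partial_lin a u v i j :
  partial j (solval (a *: u + v) i) = (fun x => a * partial j (u i) x + partial j (v i) x).
Proof. by rewrite solfield_lin; apply: partial_lin; exact: solfield_test. Qed.

Lemma solfield_cc u i : cc_fun (u i).
Proof. exact: test_cc (solfield_test u i). Qed.

Lemma solfield_partial_cc u i j : cc_fun (partial j (u i)).
Proof. exact: test_partial_cc (solfield_test u i). Qed.

Lemma solfield_sqint u i : sqint mu D (u i).
Proof. exact: cc_sqint (solfield_cc u i). Qed.

Lemma solfield_partial_sqint u i j : sqint mu D (partial j (u i)).
Proof. exact: cc_sqint (solfield_partial_cc u i j). Qed.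

Definition dirichlet u v : R :=
  \sum_(i < 2) \sum_(j < 2) dot (partial j (u i)) (partial j (v i)).

Definition convection u v w : R :=
  \sum_(i < 2) \sum_(j < 2) dot (fun x => u j x * partial j (v i) x) (w i).

Let mD : measurable D := @measurable_halfplane R.

Lemma dirichletL w : linear_form (dirichlet ^~ w).
Proof.
move=> c u v; rewrite /dirichlet mulr_sumr -big_split; apply: eq_bigr => i _ /=.
rewrite mulr_sumr -big_split; apply: eq_bigr => j _ /=.
by rewrite solfield_partial_lin l2dot_lin //; exact: solfield_partial_sqint.
Qed.

Lemma dirichletC u v : dirichlet u v = dirichlet v u.
Proof. by apply: eq_bigr => i _; apply: eq_bigr => j _; exact: l2dotC. Qed.

Lemma dirichlet_ge0 u : 0 <= dirichlet u u.
Proof. by do 2 (apply: sumr_ge0 => ? _); exact: l2dot_ge0. Qed.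

Lemma convection_sqint u v i j : sqint mu D (fun x => u j x * partial j (v i) x).
Proof. exact: cc_sqint (cc_mul (solfield_cc u j) (solfield_partial_cc v i j).1). Qed.

Lemma convectionL1 v w : linear_form (fun u => convection u v w).
Proof.
move=> c u u'; rewrite /convection mulr_sumr -big_split; apply: eq_bigr => i _ /=.
rewrite mulr_sumr -big_split; apply: eq_bigr => j _ /=.
rewrite -l2dot_lin //; try exact: convection_sqint; last exact: solfield_sqint.
apply: eq_Rintegral => x _.
rewrite [LHS](_ : _ = (c * u j x + u' j x) * partial j (v i) x * w i x) //; ring.
Qed.

Lemma convectionL2 u w : linear_form (fun v => convection u v w).
Proof.
move=> c v v'; rewrite /convection mulr_sumr -big_split; apply: eq_bigr => i _ /=.
rewrite mulr_sumr -big_split; apply: eq_bigr => j _ /=.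
rewrite -l2dot_lin //; try exact: convection_sqint; last exact: solfield_sqint.
by apply: eq_Rintegral => x _; rewrite solfield_partial_lin; ring.
Qed.

Lemma convectionL3 u v : linear_form (convection u v).
Proof.
move=> c w w'; rewrite /convection mulr_sumr -big_split; apply: eq_bigr => i _ /=.
rewrite mulr_sumr -big_split; apply: eq_bigr => j _ /=.
exact: (l2dot_linr mD c (solfield_sqint w i) (solfield_sqint w' i) (convection_sqint u v i j)).
Qed.

(** The derivative in direction [j] of [u j * v i * w i] integrates to 0. The term [S i], which
    contains div u and hence vanishes, is added so that each summand becomes such a derivative. *)
Lemma convection_antisym u v w : convection u v w = - convection u w v.
Proof.
apply/eqP; rewrite -addr_eq0; apply/eqP.
pose S i := dot (fun x => \sum_(j < 2) partial j (u j) x) (fun x => v i x * w i x).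
have S0 i : S i = 0.
  rewrite /S /l2dot (@eq_Rintegral _ _ _ _ _ (fun=> 0)); first by rewrite /Rintegral integral0.
  by move=> x _; rewrite solfield_div mul0r.
rewrite /convection -big_split /=; apply: big1 => i _; rewrite -[LHS]addr0 -[X in _ + X = _](S0 i).
have ccvw : cc_fun (fun x => v i x * w i x) := cc_mul (solfield_cc v i) (solfield_cc w i).1.
have svw := cc_sqint ccvw.
have -> : S i = \sum_(j < 2) dot (partial j (u j)) (fun x => v i x * w i x).
  rewrite /S; under eq_fun do rewrite big_ord_recl big_ord1.
  rewrite big_ord_recl big_ord1.
  have := l2dot_lin mD 1 (solfield_partial_sqint u ord0 ord0)
    (solfield_partial_sqint u (lift ord0 ord0) (lift ord0 ord0)) svw.
  by rewrite mul1r => <-; apply: eq_Rintegral => x _; rewrite mul1r.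
rewrite -!big_split /=; apply: big1 => j _.
pose g x := u j x * (v i x * w i x).
pose G x := u j x * (v i x * partial j (w i) x + w i x * partial j (v i) x) +
  (v i x * w i x) * partial j (u j) x.
have cc1 : cc_fun (fun x => u j x * partial j (v i) x * w i x).
  exact: cc_mul (cc_mul (solfield_cc u j) (solfield_partial_cc v i j).1) (solfield_cc w i).1.
have cc2 : cc_fun (fun x => u j x * partial j (w i) x * v i x).
  exact: cc_mul (cc_mul (solfield_cc u j) (solfield_partial_cc w i j).1) (solfield_cc v i).1.
have cc3 : cc_fun (fun x => partial j (u j) x * (v i x * w i x)).
  exact: cc_mul (solfield_partial_cc u j j) ccvw.1.
have dg x : is_derive x (std_vec R j) g (G x).
  apply: is_derive_mul; first exact/test_is_derive/solfield_test.
  apply: is_derive_mul; exact/test_is_derive/solfield_test.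
have GE : G = fun x => 1 * (1 * (u j x * partial j (v i) x * w i x)
    + u j x * partial j (w i) x * v i x) + partial j (u j) x * (v i x * w i x).
  by apply/funext => x; rewrite /G; ring.
have ccG : cc_fun G by rewrite GE; exact: cc_lin (cc_lin _ cc1 cc2) cc3.
have ccg : exists M, csupp M g := (cc_mul (solfield_cc u j) ccvw.1).2.
have := cc_int_partial ccG ccg dg; rewrite /l2dot => <-.
rewrite -RintegralD //; try exact: cc_integrableD.
rewrite -RintegralD //; last exact: cc_integrableD.
- by apply: eq_Rintegral => x _; rewrite /G; ring.
- by have := cc_integrableD (cc_lin 1 cc1 cc2); congr integrable; apply/funext => x /=; rewrite mul1r.
Qed.

Lemma convection_skew u : convection u u u = 0.
Proof. by have := convection_antisym u u u; lra. Qed.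

Lemma dirichlet_field u i :
  \sum_(j < 2) dot (partial j (u i)) (partial j (u i)) <= dirichlet u u.
Proof.
rewrite /dirichlet [leRHS](bigD1 i) //= lerDl.
by apply: sumr_ge0 => k _; apply: sumr_ge0 => j _; exact: l2dot_ge0.
Qed.

Lemma dirichlet_norm_component u i j :
  Num.sqrt (dot (partial j (u i)) (partial j (u i))) <= ip_norm dirichlet u.
Proof.
apply: ler_wsqrtr; apply: le_trans (dirichlet_field u i).
by rewrite [leRHS](bigD1 j) //= lerDl; apply: sumr_ge0 => k _; exact: l2dot_ge0.
Qed.

Section Force.
Variable F : 'I_2 * 'I_2 -> R * R -> R.
Hypothesis sF : forall ij, sqint mu D (F ij).

Definition force v : R := \sum_(i < 2) \sum_(j < 2) dot (F (i, j)) (partial j (v i)).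

Lemma forceB : bounded_form dirichlet force.
Proof.
split=> [c u v|].
  rewrite /force mulr_sumr -big_split; apply: eq_bigr => i _ /=.
  rewrite mulr_sumr -big_split; apply: eq_bigr => j _ /=.
  rewrite solfield_partial_lin.
  exact: (l2dot_linr mD c (solfield_partial_sqint u i j) (solfield_partial_sqint v i j) (sF _)).
exists (\sum_(i < 2) \sum_(j < 2) Num.sqrt (dot (F (i, j)) (F (i, j)))).
  by do 2 (apply: sumr_ge0 => ? _); exact: sqrtr_ge0.
move=> v; rewrite /force mulr_suml; apply: le_trans (ler_norm_sum _ _ _) _.
apply: ler_sum => i _; rewrite mulr_suml; apply: le_trans (ler_norm_sum _ _ _) _.
apply: ler_sum => j _; apply: le_trans (l2dot_cs mD _ _) _ => //.
  exact: solfield_partial_sqint.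
by rewrite ler_wpM2l ?sqrtr_ge0 // dirichlet_norm_component.
Qed.

End Force.

End EnergyForms.

(** * Hardy inequality in the half-plane *)

(* With [c], [s] the cosine and sine of the polar angle, the difference of the two sides is
   [p ^ 2 * (1/4 - s/8 - c^2/64 + c^2/(8 s) - 1/(16 s))]. *)
Lemma hardy_field_ineq (R : realType) (x y p q : R) : 0 < y -> 0 < p -> 0 < q ->
  p ^+ 2 * (x ^+ 2 + y ^+ 2) = 1 -> q * y = 1 ->
  1/16 * (4 * q ^+ 2 + q * p) <=
  (1/2 * p ^+ 2 - x ^+ 2 * p ^+ 4 - 1/8 * (y * p ^+ 3) + 3/8 * (x ^+ 2 * y * p ^+ 5)) +
  (1/2 * q ^+ 2 + 1/2 * p ^+ 2 - y ^+ 2 * p ^+ 4 - 3/8 * (x ^+ 2 * y * p ^+ 5)) -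
  (x * (1/2 * p ^+ 2) - 1/8 * (x * y * p ^+ 3)) ^+ 2 -
  (- (1/2) * q + 1/2 * (y * p ^+ 2) + 1/8 * (x ^+ 2 * p ^+ 3)) ^+ 2.
Proof.
move=> y0 p0 q0 pxy qy.
pose c := x * p; pose s := y * p; pose t := q / p.
have qE : q = t * p by rewrite /t divfK // gt_eqF.
have ts : t * s = 1 by rewrite -qy /t /s; field; rewrite gt_eqF.
have cs : c ^+ 2 = 1 - s ^+ 2 by rewrite -pxy /c /s; ring.
have s0 : 0 < s by exact: mulr_gt0.
have t0 : 0 < t by exact: divr_gt0.
have s1 : s <= 1 by have := sqr_ge0 c; nra.
have main : 0 <= 1/4 - 1/8 * s - 1/64 * c ^+ 2 + 1/8 * c ^+ 2 * t - 1/16 * t.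
  have -> : 1/4 - 1/8 * s - 1/64 * c ^+ 2 + 1/8 * c ^+ 2 * t - 1/16 * t =
     t * (1/4 * s - 1/8 * s * s - 1/64 * c ^+ 2 * s + 1/8 * c ^+ 2 - 1/16) +
     (1 - t * s) * (1/4 - 1/8 * s - 1/64 * c ^+ 2) by field.
  rewrite ts subrr mul0r addr0 cs; apply: mulr_ge0; first exact: ltW.
  (* With [c ^+ 2 = 1 - s ^+ 2] the factor is [1/16 + 15/64 s - 1/4 s^2 + 1/64 s^3], which is
     positive for [0 < s <= 1]. *)
  have : 0 <= s * s * s by rewrite !mulr_ge0 // ltW.
  rewrite expr2; nra.
rewrite -subr_ge0; set d := (X in 0 <= X).
suff -> : d = p ^+ 2 * (1/4 - 1/8 * s - 1/64 * c ^+ 2 + 1/8 * c ^+ 2 * t - 1/16 * t).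
  by rewrite mulr_ge0 // sqr_ge0.
have e1 : d = p ^+ 2 * (1/4 * t ^+ 2 - 1/16 * t + 1 - (c ^+ 2 + s ^+ 2) - 1/8 * s
   - (c * (1/2 - 1/8 * s)) ^+ 2 - (- (1/2) * t + 1/2 * s + 1/8 * c ^+ 2) ^+ 2).
  by rewrite /d qE /c /s; field.
rewrite e1; congr (_ * _); apply/eqP; rewrite -subr_eq0; apply/eqP.
(* The two sides agree modulo [c ^+ 2 + s ^+ 2 = 1] and [t * s = 1]; these are the cofactors of the
   two relations. *)
transitivity ((c ^+ 2 + s ^+ 2 - 1) * (- (5/4) - 1/64 * c ^+ 2) + (t * s - 1) * (1/2)); last first.
  by rewrite ts cs; field.
by field.
Qed.

Section Hardy.
Variable R : realType.
Implicit Types (f : R * R -> R) (x : R * R).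
Local Notation D := (halfplane R : set (plane R)).
Local Notation mu := (lebesgue2 R).
Local Notation dot := (l2dot mu D).
Let mD : measurable D := @measurable_halfplane R.

Definition inv_radius x : R := (eucl x)^-1.
Definition inv_height x : R := (x.2)^-1.

Lemma radius_sqr_gt0 x : halfplane R x -> 0 < x.1 ^+ 2 + x.2 ^+ 2.
Proof. by rewrite /halfplane /= => x0; rewrite ltr_wpDl ?sqr_ge0 // exprn_gt0. Qed.

Lemma eucl_gt0 x : halfplane R x -> 0 < eucl x.
Proof. by move=> /radius_sqr_gt0; rewrite /eucl sqrtr_gt0. Qed.

Lemma inv_radius_gt0 x : halfplane R x -> 0 < inv_radius x.
Proof. by move=> /eucl_gt0; rewrite /inv_radius invr_gt0. Qed.

Lemma is_derive_coord (i j : 'I_2) x :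
  is_derive x (std_vec R j) (coord i) ((i == j)%:R : R).
Proof.
apply/is_derive_slice.
have -> : slice j (coord i) x = if i == j then id else cst (coord i x).
  apply/funext => t; rewrite /slice /coord.
  by case: i => -[|[|//]] ?; case: j => -[|[|//]] ?.
by case: eqP => _; [exact: is_derive_id|exact: is_derive_cst].
Qed.

Lemma is_derive_inv_height j x : halfplane R x ->
  is_derive x (std_vec R j) inv_height (- (j == 1)%:R * inv_height x ^+ 2).
Proof.
move=> x0; apply/is_derive_slice.
rewrite /inv_height /slice /coord; case: (eqVneq j 0) => [->|j0] /=.
  by rewrite oppr0 mul0r; exact: is_derive_cst.
have -> : j == 1 by case: j j0 => -[|[|//]].
have xn : x.2 != 0 by rewrite gt_eqF.
have := @is_deriveV R id x.2 1 1 xn (is_derive_id _ _).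
by rewrite scaler1 mulN1r exprVn.
Qed.

Lemma is_derive_inv_radius j x : halfplane R x ->
  is_derive x (std_vec R j) inv_radius (- coord j x * inv_radius x ^+ 3).
Proof.
move=> x0; apply/is_derive_slice.
pose c := x.1 ^+ 2 + x.2 ^+ 2 - coord j x ^+ 2.
have -> : slice j inv_radius x = fun t => (Num.sqrt (t ^+ 2 + c))^-1.
  apply/funext => t; rewrite /slice /inv_radius /eucl /c /coord.
  by case: (j == 0) => /=; congr ((Num.sqrt _)^-1); ring.
pose t := coord j x.
have tE : t ^+ 2 + c = x.1 ^+ 2 + x.2 ^+ 2 by rewrite /t /c; ring.
have tp : 0 < t ^+ 2 + c by rewrite tE radius_sqr_gt0.
have d1 : is_derive t 1 (fun t : R => t ^+ 2 + c) (2 * t).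
  have := is_derive_lin 1 (is_derive_mul (is_derive_id t 1) (is_derive_id t 1)) (is_derive_cst c t 1).
  rewrite addr0 mulr1 mul1r -mulr2n mulr_natl.
  by congr is_derive; apply/funext => u; rewrite /= mul1r expr2.
have d2 := @is_derive1_comp R Num.sqrt (fun t : R => t ^+ 2 + c) t _ _ (is_derive1_sqrt tp) d1.
have sn : Num.sqrt (t ^+ 2 + c) != 0 by rewrite gt_eqF // sqrtr_gt0.
have := @is_deriveV R _ t _ 1 sn d2.
congr is_derive; rewrite /= tE /inv_radius -/(eucl x) in sn *.
by rewrite /GRing.scale /= -/t; field.
Qed.

Let contM f g x : {for x, continuous f} -> {for x, continuous g} ->
  {for x, continuous (fun y => f y * g y)}.
Proof. by move=> cf cg; exact: (cvgM cf cg). Qed.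

Let contD f g x : {for x, continuous f} -> {for x, continuous g} ->
  {for x, continuous (fun y => f y + g y)}.
Proof. by move=> cf cg; exact: (cvgD cf cg). Qed.

Let contX f n x : {for x, continuous f} -> {for x, continuous (fun y => f y ^+ n)}.
Proof. by move=> cf; exact: (continuous_comp cf (@exprn_continuous _ n _)). Qed.

Let contC (c : R) x : {for x, continuous (fun _ : R * R => c)}.
Proof. exact: cvg_cst. Qed.

Let cont1 x : {for x, continuous (fun y : R * R => y.1)}.
Proof. exact: cvg_fst. Qed.

Let cont2 x : {for x, continuous (fun y : R * R => y.2)}.
Proof. exact: cvg_snd. Qed.

Lemma continuous_inv_height x : halfplane R x -> {for x, continuous inv_height}.
Proof. by move=> x0; apply: cvgV; [rewrite gt_eqF|exact: cvg_snd]. Qed.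

Lemma continuous_eucl x : {for x, continuous (@eucl R)}.
Proof.
apply: (@continuous_comp _ _ _ (fun y : R * R => y.1 ^+ 2 + y.2 ^+ 2) Num.sqrt).
  by apply: contD; apply: contX; [exact: cont1|exact: cont2].
exact: sqrt_continuous.
Qed.

Lemma continuous_inv_radius x : halfplane R x -> {for x, continuous inv_radius}.
Proof.
by move=> x0; apply: cvgV; [rewrite gt_eqF // eucl_gt0|exact: continuous_eucl].
Qed.

Lemma is_derive_pow f n x v df : is_derive x v f df ->
  is_derive x v (fun y => f y ^+ n.+1) (n.+1%:R * f x ^+ n * df).
Proof. by move=> h; have := is_deriveX n.+1 h; rewrite exprfctE. Qed.

(** A weight singular on the boundary does no harm: the support of [f] lies in the half-plane, and
    [f] vanishes near every point outside its support, so the product is continuous on the whole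
    plane. *)
Lemma test_cc_mul f c : test_function f -> (forall x, halfplane R x -> {for x, continuous c}) ->
  cc_fun (fun x => f x * c x).
Proof.
move=> tf cD; have [cf [M hM]] := test_cc tf; split; last first.
  by exists M => x h; apply: hM; apply: contraNneq h => ->; rewrite mul0r.
move=> x; case: (pselect (closure [set y | f y != 0] x)) => [cx|/test_near0 nx].
  by apply: cvgM; [exact: cf|apply: cD; have [_ _] := tf; exact].
have fx : f x * c x = 0 by rewrite (nbhs_singleton nx) mul0r.
apply: (@near_cst_continuous _ _ 0).
by apply: filterS nx => y ->; rewrite mul0r.
Qed.

(* The field A = - e_2 / (2 x_2) + x / (2 |x|^2) + x_1 (- x_2, x_1) / (8 |x|^3), for which
   div A - |A|^2 >= hardy_weight / 16. *)
Let field1 x := x.1 * (1/2 * inv_radius x ^+ 2) - 1/8 * (x.1 * x.2 * inv_radius x ^+ 3).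
Let field2 x := - (1/2) * inv_height x + 1/2 * (x.2 * inv_radius x ^+ 2) +
  1/8 * (x.1 ^+ 2 * inv_radius x ^+ 3).

Let dfield1 x : halfplane R x -> is_derive x (std_vec R 0) field1
  (1/2 * inv_radius x ^+ 2 - x.1 ^+ 2 * inv_radius x ^+ 4 -
   1/8 * (x.2 * inv_radius x ^+ 3) + 3/8 * (x.1 ^+ 2 * x.2 * inv_radius x ^+ 5)).
Proof.
move=> Dx.
have d1 := is_derive_coord 0 0 x; have d2 := is_derive_coord 1 0 x.
have dr := is_derive_inv_radius 0 Dx.
have A := is_derive_mul d1 (is_derive_pow 1 dr).
have B := is_derive_mul (is_derive_mul d1 d2) (is_derive_pow 2 dr).
have := is_derive_lin (1/2) A (is_derive_lin (- (1/8)) B (is_derive_cst 0 x _)).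
have -> : (fun y => 1/2 * (coord 0 y * inv_radius y ^+ 2) + (- (1/8) *
  (coord 0 y * coord 1 y * inv_radius y ^+ 3) + cst 0 y)) = field1.
  by apply/funext => y; rewrite /field1 /coord /=; field.
by congr is_derive; rewrite /coord /=; field.
Qed.

Let dfield2 x : halfplane R x -> is_derive x (std_vec R 1) field2
  (1/2 * inv_height x ^+ 2 + 1/2 * inv_radius x ^+ 2 - x.2 ^+ 2 * inv_radius x ^+ 4 -
   3/8 * (x.1 ^+ 2 * x.2 * inv_radius x ^+ 5)).
Proof.
move=> Dx.
have d1 := is_derive_coord 0 1 x; have d2 := is_derive_coord 1 1 x.
have dr := is_derive_inv_radius 1 Dx; have dh := is_derive_inv_height 1 Dx.
have A := is_derive_mul d2 (is_derive_pow 1 dr).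
have B := is_derive_mul (is_derive_pow 1 d1) (is_derive_pow 2 dr).
have := is_derive_lin (1/2) A (is_derive_lin (1/8) B (is_derive_lin (- (1/2)) dh (is_derive_cst 0 x _))).
have -> : (fun y => 1/2 * (coord 1 y * inv_radius y ^+ 2) + (1/8 *
  (coord 0 y ^+ 2 * inv_radius y ^+ 3) + (- (1/2) * inv_height y + cst 0 y))) = field2.
  by apply/funext => y; rewrite /field2 /coord /=; field.
by congr is_derive; rewrite /coord /=; field.
Qed.

(** On the half-plane this is the inverse of [omega0]; its two terms are the inverses of [omega2]
    and [omega1]. *)
Definition hardy_weight x := 4 * inv_height x ^+ 2 + inv_height x * inv_radius x.

Lemma continuous_hardy_weight x : halfplane R x -> {for x, continuous hardy_weight}.
Proof.
move=> Dx; have h := continuous_inv_height Dx; have r := continuous_inv_radius Dx.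
apply: contD; last exact: contM.
by apply: contM; [exact: contC|exact: contX].
Qed.

Lemma cc_int_lin a f g : cc_fun f -> cc_fun g ->
  \int[mu]_(x in D) (a * f x + g x) = a * \int[mu]_(x in D) f x + \int[mu]_(x in D) g x.
Proof.
move=> cf cg; rewrite -RintegralZl //; last exact: cc_integrableD.
rewrite -RintegralD //; last exact: cc_integrableD.
have := cc_integrableD (cc_lin a cf (cc0 R)).
by congr integrable; apply/funext => x /=; rewrite addr0.
Qed.

Let cc_int_sum p1 p2 g1 g2 : cc_fun p1 -> cc_fun p2 -> cc_fun g1 -> cc_fun g2 ->
  \int[mu]_(x in D) g1 x = 0 -> \int[mu]_(x in D) g2 x = 0 ->
  \int[mu]_(x in D) (16 * p1 x + (16 * p2 x + (16 * g1 x + (16 * g2 x + 0)))) =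
  16 * (\int[mu]_(x in D) p1 x + \int[mu]_(x in D) p2 x).
Proof.
move=> c1 c2 c3 c4 i1 i2.
do 4 (rewrite cc_int_lin //; last by do ?[exact: cc0|apply: cc_lin]).
have -> : \int[mu]_(x in D) 0 = 0 :> R by rewrite /Rintegral integral0.
by rewrite i1 i2 !mulr0 !addr0 mulrDr.
Qed.

Let mono a b c d x := x.1 ^+ a * x.2 ^+ b * inv_radius x ^+ c * inv_height x ^+ d.

Let cmono (k : R) a b c d x : halfplane R x -> {for x, continuous (fun y => k * mono a b c d y)}.
Proof.
move=> Dx; have r := continuous_inv_radius Dx; have h := continuous_inv_height Dx.
apply: contM; first exact: contC.
apply: contM; last by apply: contX.
apply: contM; last by apply: contX.
by apply: contM; apply: contX; [exact: cont1|exact: cont2].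
Qed.

Theorem hardy_test f : test_function f ->
  \int[mu]_(x in D) (f x * (f x * hardy_weight x)) <=
  16 * \sum_(j < 2) dot (partial j f) (partial j f).
Proof.
move=> tf.
pose df1 x := 1/2 * inv_radius x ^+ 2 - x.1 ^+ 2 * inv_radius x ^+ 4 -
   1/8 * (x.2 * inv_radius x ^+ 3) + 3/8 * (x.1 ^+ 2 * x.2 * inv_radius x ^+ 5).
pose df2 x := 1/2 * inv_height x ^+ 2 + 1/2 * inv_radius x ^+ 2 - x.2 ^+ 2 * inv_radius x ^+ 4 -
   3/8 * (x.1 ^+ 2 * x.2 * inv_radius x ^+ 5).
have cfield1 x : halfplane R x -> {for x, continuous field1}.
  move=> Dx; rewrite (_ : field1 = fun y => 1/2 * mono 1 0 2 0 y + - (1/8) * mono 1 1 3 0 y).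
    by apply: contD; exact: cmono.
  by apply/funext => y; rewrite /field1 /mono; field.
have cfield2 x : halfplane R x -> {for x, continuous field2}.
  move=> Dx; rewrite (_ : field2 = fun y =>
    - (1/2) * mono 0 0 0 1 y + 1/2 * mono 0 1 2 0 y + 1/8 * mono 2 0 3 0 y).
    by apply: contD; [apply: contD|]; exact: cmono.
  by apply/funext => y; rewrite /field2 /mono; field.
have cdf1 x : halfplane R x -> {for x, continuous df1}.
  move=> Dx; rewrite (_ : df1 = fun y => 1/2 * mono 0 0 2 0 y + -1 * mono 2 0 4 0 y +
    - (1/8) * mono 0 1 3 0 y + 3/8 * mono 2 1 5 0 y).
    by apply: contD; [apply: contD; [apply: contD|]|]; exact: cmono.
  by apply/funext => y; rewrite /df1 /mono; field.
have cdf2 x : halfplane R x -> {for x, continuous df2}.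
  move=> Dx; rewrite (_ : df2 = fun y => 1/2 * mono 0 0 0 2 y + 1/2 * mono 0 0 2 0 y +
    -1 * mono 0 2 4 0 y + - (3/8) * mono 2 1 5 0 y).
    by apply: contD; [apply: contD; [apply: contD|]|]; exact: cmono.
  by apply/funext => y; rewrite /df2 /mono; field.
have cf x j : {for x, continuous (partial j f)} by exact: (test_partial_cc j tf).1.
have cf0 x : {for x, continuous f} by exact: (test_cc tf).1.
pose G (j : 'I_2) (A dA : R * R -> R) x : R := f x * (2 * partial j f x * A x + f x * dA x).
have intG (j : 'I_2) (A dA : R * R -> R) : (forall x, halfplane R x -> {for x, continuous A}) ->
    (forall x, halfplane R x -> {for x, continuous dA}) ->
    (forall x, halfplane R x -> is_derive x (std_vec R j) A (dA x)) ->
    cc_fun (G j A dA) /\ \int[mu]_(x in D) G j A dA x = 0.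
  move=> cA cdA hA.
  have ccG : cc_fun (G j A dA).
    apply: test_cc_mul => // x Dx; have a := cA x Dx; have da := cdA x Dx.
    by apply: contD; apply: contM => //; apply: contM => //; exact: contC.
  split => //; apply: (@cc_int_partial _ j (fun x => f x * (f x * A x))) => //.
    have : cc_fun (fun x => f x * (f x * A x)).
      by apply: test_cc_mul => // x Dx; apply: contM => //; exact: cA.
    by case.
  move=> x; case: (pselect (halfplane R x)) => [Dx|nDx].
    have := is_derive_mul (test_is_derive j x tf) (is_derive_mul (test_is_derive j x tf) (hA x Dx)).
    by congr is_derive; rewrite /G; ring.
  have nx : ~ closure [set y | f y != 0] x by have [_ _ hf] := tf; move=> /hf.
  have n0 := test_near0 nx; rewrite /G (nbhs_singleton n0) mul0r.
  refine (near_eq_is_derive _ (is_derive_cst (0 : R) x (std_vec R j))).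
  by apply: filterS n0 => y ->; rewrite mul0r.
have [cc1 i1] := intG 0 field1 df1 cfield1 cdf1 dfield1.
have [cc2 i2] := intG 1 field2 df2 cfield2 cdf2 dfield2.
have ccw : cc_fun (fun x => f x * (f x * hardy_weight x)).
  by apply: test_cc_mul => // x Dx; apply: contM => //; exact: continuous_hardy_weight.
have ccp j : cc_fun (fun x => partial j f x * partial j f x).
  by apply: cc_mul; [exact: test_partial_cc|exact: (test_partial_cc j tf).1].
(* [G j A dA] is the derivative of [f ^+ 2 * A], so [P] is 16 times |grad f|^2 + div (f^2 A) and has
   the same integral as 16 |grad f|^2. The weighted square lies below [P] pointwise, by |grad f + f
   A|^2 >= 0 and [hardy_field_ineq]. *)
pose P x := 16 * (partial 0 f x * partial 0 f x) + (16 * (partial 1 f x * partial 1 f x) +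
  (16 * G 0 field1 df1 x + (16 * G 1 field2 df2 x + 0))).
have ccP : cc_fun P by do 4 apply: cc_lin => //; exact: cc0.
have -> : 16 * \sum_(j < 2) dot (partial j f) (partial j f) = \int[mu]_(x in D) P x.
  by rewrite (cc_int_sum (ccp 0) (ccp 1) cc1 cc2 i1 i2) big_ord_recl big_ord1.
apply: le_Rintegral => //; [exact: cc_integrableD|exact: cc_integrableD|move=> x Dx].
have h1 := radius_sqr_gt0 Dx; have h2 := eucl_gt0 Dx.
have y0 : 0 < x.2 by [].
have q0 : 0 < inv_height x by rewrite /inv_height invr_gt0.
have p0 := inv_radius_gt0 Dx.
have pxy : inv_radius x ^+ 2 * (x.1 ^+ 2 + x.2 ^+ 2) = 1.
  have <- : eucl x ^+ 2 = x.1 ^+ 2 + x.2 ^+ 2 by rewrite sqr_sqrtr // ltW.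
  by rewrite /inv_radius exprVn mulVf // expf_eq0 /= gt_eqF.
have qy : inv_height x * x.2 = 1 by rewrite mulVf // gt_eqF.
have := hardy_field_ineq y0 p0 q0 pxy qy.
rewrite /P /G -/(df1 x) -/(df2 x) -/(field1 x) -/(field2 x) /hardy_weight.
move: (partial 0 f x) (partial 1 f x) (f x) (field1 x) (field2 x) (df1 x) (df2 x) => d1 d2 v A1 A2 B1 B2.
move: (inv_height x) (inv_radius x) => q p key.
have := sqr_ge0 (d1 + A1 * v); have := sqr_ge0 (d2 + A2 * v); have := sqr_ge0 v.
move=> v2; have := ler_wpM2l v2 key; rewrite !expr2; lra.
Qed.

End Hardy.

(** * Local compactness *)

Section IntervalEstimates.
Variable R : realType.
Local Notation leb := (@lebesgue_measure R).
Implicit Types (g G : R -> R) (a b : R).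

Let mco a b : measurable (`[a, b[%classic : set (measurableTypeR R)).
Proof. exact: measurable_itv. Qed.

Lemma continuous_integrable_itv g a b : continuous g ->
  leb.-integrable `[a, b[ (EFin \o g).
Proof.
move=> cg.
have h : leb.-integrable `[a, b] (EFin \o g).
  apply: continuous_compact_integrable; first exact: segment_compact.
  exact: continuous_subspaceT.
apply: integrableS h => //.
by apply: subset_itvl; rewrite bnd_simp.
Qed.

Lemma continuous_sqint_itv g a b : continuous g -> sqint leb `[a, b[ g.
Proof.
move=> cg; split.
  by apply: (@measurable_funS _ _ _ _ setT) => //; exact: continuous_measurable_fun.
have cg2 : continuous (fun t => g t * g t) by move=> t; exact: (cvgM (cg t) (cg t)).
by have := integrable_lty (mco _ _) (continuous_integrable_itv a b cg2).
Qed.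

Lemma itv_length a b : a <= b -> \int[leb]_(t in `[a, b[) 1 = b - a.
Proof.
rewrite le_eqVlt => /predU1P[->|ab]; first by rewrite subrr set_itvco0 ?Rintegral_set0.
have E : leb `[a, b[%classic = (b - a)%:E by rewrite lebesgue_measure_itv /= lte_fin ab EFinB.
by rewrite (Rintegral_cst leb (mco a b)) [X in fine X]E mul1r.
Qed.

Lemma itv_cauchy_schwarz g a b : a <= b -> continuous g ->
  (\int[leb]_(t in `[a, b[) g t) ^+ 2 <= (b - a) * \int[leb]_(t in `[a, b[) (g t * g t).
Proof.
move=> ab cg.
have c1 : continuous (fun _ : R => 1 : R) by move=> t; exact: cvg_cst.
have := l2dot_cauchy_schwarz (mco _ _) (continuous_sqint_itv a b c1) (continuous_sqint_itv a b cg).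
rewrite /l2dot; under [X in X ^+ 2]eq_Rintegral do rewrite mul1r.
by under [X in X * _]eq_Rintegral do rewrite mul1r; rewrite itv_length.
Qed.

Lemma itv_oscillation g G a b s t : (forall t : R, is_derive t 1 g (G t)) -> continuous G ->
  a <= s < b -> a <= t < b ->
  (g t - g s) ^+ 2 <= (b - a) * \int[leb]_(r in `[a, b[) (G r * G r).
Proof.
move=> dg cG; wlog st : s t / s <= t => [h sab tab|].
  by have [st|/ltW ts] := leP s t; [exact: h|rewrite -sqrrN opprB; exact: h].
move=> /andP[as_ sb] /andP[at_ tb].
have cG2 : continuous (fun t => G t * G t) by move=> r; exact: (cvgM (cG r) (cG r)).
have ftc : \int[leb]_(r in `[s, t[) G r = g t - g s.
  rewrite Rintegral_itv_bndo_bndc; last exact: continuous_integrable_itv.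
  by rewrite /Rintegral (ftc_segment st dg cG).
rewrite -ftc; apply: le_trans (itv_cauchy_schwarz st cG) _.
have h0 c d : 0 <= \int[leb]_(r in `[c, d[) (G r * G r).
  by apply: Rintegral_ge0 => r _; rewrite -expr2 sqr_ge0.
apply: ler_pM => //; [lra|lra|].
have hf c d := integrable_fin_num (mco c d) (continuous_integrable_itv c d cG2).
rewrite -lee_fin /Rintegral !fineK; [|exact: hf|exact: hf].
apply: ge0_subset_integral => //.
- by apply/measurable_EFinP; apply: (@measurable_funS _ _ _ _ setT) => //; exact: continuous_measurable_fun.
- by move=> r _; rewrite lee_fin -expr2 sqr_ge0.
- by move=> r /=; rewrite !in_itv /= => /andP[? ?]; apply/andP; split; lra.
Qed.

End IntervalEstimates.

Lemma eq_le_refl (R : realType) (u v : R) : u = v -> u <= v.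
Proof. by move=> ->. Qed.

(** * Poincare inequality on a square cell *)

Section CellEstimate.
Variable R : realType.
Local Notation leb := (@lebesgue_measure R).
Local Notation D := (halfplane R : set (plane R)).
Local Notation mu := (lebesgue2 R).
Implicit Types (f : R * R -> R) (x : R * R).

Let mco (a b : R) : measurable (`[a, b[%classic : set (measurableTypeR R)).
Proof. exact: measurable_itv. Qed.

Lemma slice_is_derive f j x (t : R) : test_function f ->
  is_derive t 1 (slice j f x) (slice j (partial j f) x t).
Proof.
move=> tf; pose y := if j == 0 then (t, x.2) else (x.1, t).
have := (is_derive_slice j f y (partial j f y)).1 (test_is_derive j y tf).
by rewrite /y /slice /coord; case: (j == 0).
Qed.

(** Half-open, so that the cells of a grid partition a strip exactly and their indicators add up to
    its indicator. *)
Definition cell (al be d : R) : set (plane R) := `[al, al + d[%classic `*` `[be, be + d[%classic.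

Lemma measurable_cell al be d : measurable (cell al be d).
Proof. by apply: measurableX. Qed.

Definition cell_sqr (j : 'I_2) f al be d x : R :=
  partial j f x ^+ 2 * \1_(cell al be d) x.

Lemma cell_sqr_ge0 j f al be d x : 0 <= cell_sqr j f al be d x.
Proof. by rewrite mulr_ge0 ?sqr_ge0 // indicE. Qed.

Lemma measurable_cell_sqr j f al be d : test_function f ->
  measurable_fun [set: plane R] (cell_sqr j f al be d : plane R -> R).
Proof.
move=> tf; apply: measurable_funM; last exact: measurable_indic (measurable_cell _ _ _).
apply: measurable_funX; apply: continuous_measurable_plane.
exact: (test_partial_cc j tf).1.
Qed.

Lemma cell_sqr_integrable j f al be d : test_function f ->
  mu.-integrable setT (EFin \o (cell_sqr j f al be d : plane R -> R)).
Proof.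
move=> tf; have c := test_partial_cc j tf.
apply: (le_integrable measurableT _ _ (cc_integrable (cc_mul c c.1))).
  by apply/measurable_EFinP; exact: measurable_cell_sqr.
move=> x _; rewrite lee_fin (ger0_norm (cell_sqr_ge0 _ _ _ _ _ _)) /cell_sqr.
rewrite normrM -expr2 real_normK ?num_real // ler_piMr ?sqr_ge0 // indicE.
Qed.

Let inner_horizontal f al be d x : test_function f -> `[be, be + d[%classic x.2 ->
  (\int[leb]_s (cell_sqr 0 f al be d (s, x.2))%:E)%E =
  (\int[leb]_(s in `[al, al + d[) (slice 0 (partial 0 f) x s * slice 0 (partial 0 f) x s))%:E.
Proof.
move=> tf xJ; have cs := @continuous_slice R 0 _ x (test_partial_cc 0 tf).1.
have cs2 : continuous (fun t => slice 0 (partial 0 f) x t * slice 0 (partial 0 f) x t).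
  by move=> t; exact: (cvgM (cs t) (cs t)).
have hf := integrable_fin_num (mco _ _) (continuous_integrable_itv al (al + d) cs2).
rewrite /Rintegral fineK; last exact: hf.
rewrite [RHS]integral_mkcond; apply: eq_integral => s _.
rewrite patchE /cell_sqr indicE; case: ifPn => sI.
  by rewrite mem_set ?mulr1 ?expr2 //; split => //=; move/set_mem: sI.
by rewrite memNset ?mulr0 // => -[/= h _]; move/negP: sI; apply; exact: mem_set.
Qed.

Let inner_vertical f al be d (s : R) : test_function f -> `[al, al + d[%classic s ->
  (\int[leb]_t (cell_sqr 1 f al be d (s, t))%:E)%E =
  (\int[leb]_(t in `[be, be + d[) (slice 1 (partial 1 f) (s, 0) t * slice 1 (partial 1 f) (s, 0) t))%:E.
Proof.
move=> tf sI; have cs := @continuous_slice R 1 _ (s, 0) (test_partial_cc 1 tf).1.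
have cs2 : continuous (fun t => slice 1 (partial 1 f) (s, 0) t * slice 1 (partial 1 f) (s, 0) t).
  by move=> t; exact: (cvgM (cs t) (cs t)).
have hf := integrable_fin_num (mco _ _) (continuous_integrable_itv be (be + d) cs2).
rewrite /Rintegral fineK; last exact: hf.
rewrite [RHS]integral_mkcond; apply: eq_integral => t _.
rewrite patchE /cell_sqr indicE; case: ifPn => tJ.
  by rewrite mem_set ?mulr1 ?expr2 //; split => //=; move/set_mem: tJ.
by rewrite memNset ?mulr0 // => -[/= _ h]; move/negP: tJ; apply; exact: mem_set.
Qed.

(** Join [x] to the point [(s, be)] of the lower edge by a horizontal and then a vertical segment
    inside the cell, with the one-dimensional estimate on each. *)
Let oscillation_cell f al be d x s : test_function f -> 0 < d ->
  cell al be d x -> `[al, al + d[%classic s ->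
  (((f x - f (s, be)) ^+ 2)%:E <= (2 * d)%:E *
    (\int[leb]_s (cell_sqr 0 f al be d (s, x.2))%:E + \int[leb]_t (cell_sqr 1 f al be d (s, t))%:E))%E.
Proof.
move=> tf d0 [x1 x2] sI.
rewrite inner_horizontal // inner_vertical // -EFinD -EFinM lee_fin.
have h1 : (f x - f (s, x.2)) ^+ 2 <= d * \int[leb]_(s in `[al, al + d[)
    (slice 0 (partial 0 f) x s * slice 0 (partial 0 f) x s).
  have := @itv_oscillation R (slice 0 f x) (slice 0 (partial 0 f) x) al (al + d) s x.1
    (fun t => slice_is_derive 0 x t tf) (continuous_slice (test_partial_cc 0 tf).1).
  rewrite {1 2}/slice /= addrAC subrr add0r -surjective_pairing; apply.
    by move: sI; rewrite /= in_itv.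
  by move: x1; rewrite /= in_itv.
have h2 : (f (s, x.2) - f (s, be)) ^+ 2 <= d * \int[leb]_(t in `[be, be + d[)
    (slice 1 (partial 1 f) (s, 0) t * slice 1 (partial 1 f) (s, 0) t).
  have := @itv_oscillation R (slice 1 f (s, 0)) (slice 1 (partial 1 f) (s, 0)) be (be + d) be x.2
    (fun t => slice_is_derive 1 (s, 0) t tf) (continuous_slice (test_partial_cc 1 tf).1).
  rewrite {1 2}/slice /= addrAC subrr add0r; apply; first by rewrite lexx ltrDl.
  by move: x2; rewrite /= in_itv.
move: h1 h2; set A := \int[_]_(_ in _) _; set B := \int[_]_(_ in _) _ => h1 h2.
have := sqr_ge0 (f x - f (s, x.2) - (f (s, x.2) - f (s, be))).
move: h1 h2; move: (f x) (f (s, x.2)) (f (s, be)) => u v w; rewrite !expr2; lra.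
Qed.

Definition cell_energy j f al be d : R := \int[mu]_x (cell_sqr j f al be d x).

Lemma EFin_cell_energy j f al be d : test_function f ->
  (\int[mu]_x (cell_sqr j f al be d x)%:E)%E = (cell_energy j f al be d)%:E.
Proof.
move=> tf; have h := integrable_fin_num measurableT (cell_sqr_integrable j al be d tf).
by rewrite /cell_energy /Rintegral fineK.
Qed.

Let mcellE j f al be d : test_function f ->
  measurable_fun [set: plane R] (EFin \o (cell_sqr j f al be d : plane R -> R)).
Proof. by move=> tf; apply/measurable_EFinP; exact: measurable_cell_sqr. Qed.

Let cell0 j f al be d (x : plane R) : (0 <= (EFin \o (cell_sqr j f al be d : plane R -> R)) x)%E.
Proof. by rewrite lee_fin cell_sqr_ge0. Qed.

Let length_co (a d : R) : 0 < d -> leb `[a, a + d[%classic = d%:E.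
Proof.
move=> d0; rewrite lebesgue_measure_itv /= lte_fin ltrDl d0.
by rewrite -EFinD addrAC subrr add0r.
Qed.

(** Plays the role of the cell mean in the Poincare inequality. An edge is used because the
    vanishing of test functions on the axis bounds it directly by the vertical derivative. *)
Definition edge_integral f al be d : R := \int[leb]_(s in `[al, al + d[) f (s, be).

(** [d * f x] is the edge integral plus the integral over the edge of [f x - f (s, be)].
    Cauchy-Schwarz and [oscillation_cell], integrated in [s], bound the square of the second
    part. *)
Let cell_average f al be d x : test_function f -> 0 < d -> cell al be d x ->
  ((d ^+ 2 * f x ^+ 2)%:E <= (2 * edge_integral f al be d ^+ 2 +
     4 * d ^+ 2 * cell_energy 1 f al be d)%:E +
    (4 * d ^+ 3)%:E * \int[leb]_s (cell_sqr 0 f al be d (s, x.2))%:E)%E.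
Proof.
move=> tf d0 Qx; have [x1 x2] := Qx.
have osc s := oscillation_cell tf d0 Qx (s := s).
set a := (\int[leb]_s _)%E in osc *.
have [A aA] : exists A, a = A%:E by rewrite /a inner_horizontal //; eexists.
have ce : continuous (fun s => f (s, be)).
  by have := @continuous_slice R 0 f (0, be) (test_cc tf).1.
pose h s := f x - f (s, be).
have ch : continuous h by move=> s; apply: (cvgB (cvg_cst _) (ce s)).
have ch2 : continuous (fun s => h s * h s) by move=> s; exact: (cvgM (ch s) (ch s)).
have al_d : al <= al + d by rewrite lerDl ltW.
have cs := itv_cauchy_schwarz al_d ch.
have ih2 := continuous_integrable_itv al (al + d) ch2.
pose b (s : measurableTypeR R) : \bar R := (\int[leb]_t (cell_sqr 1 f al be d (s, t))%:E)%E.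
have mb : measurable_fun setT b.
  have := measurable_fun_fubini_tonelli_F (m2 := leb) _ (mcellE 1 al be d tf) (cell0 1 f al be d).
  by [].
have b0 s : (0 <= b s)%E by apply: integral_ge0 => t _; exact: cell0.
have up : (\int[leb]_(s in `[al, (al + d)%R[) (h s * h s)%:E <=
    (2 * d * (d * A + cell_energy 1 f al be d))%:E)%E.
  apply: (@le_trans _ _ (\int[leb]_(s in `[al, (al + d)%R[) ((2 * d)%:E * (a + b s)))%E).
    apply: ge0_le_integral => //.
    - by move=> s _; rewrite lee_fin -expr2 sqr_ge0.
    - by case/integrableP: ih2.
    - apply: emeasurable_funM; first exact: measurable_cst.
      apply: emeasurable_funD; first exact: measurable_cst.
      exact: (measurable_funS measurableT).
  have a0 : (0 <= a)%E by apply: integral_ge0 => t _; exact: cell0.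
  have mbI : measurable_fun `[al, (al + d)%R[ b by exact: (measurable_funS measurableT).
  rewrite ge0_integralZl //; first last.
  - by rewrite lee_fin mulr_ge0 // ltW.
  - by move=> s _; exact: adde_ge0.
  - by apply: emeasurable_funD => //; exact: measurable_cst.
  rewrite (EFinM (2 * d)); apply: lee_wpmul2l; first by rewrite lee_fin mulr_ge0 // ltW.
  rewrite ge0_integralD //.
  rewrite EFinD; apply: leeD.
    by rewrite (integral_cst leb (mco al (al + d)) a) [X in (_ * X)%E](length_co al d0) aA -EFinM mulrC.
  rewrite -EFin_cell_energy //.
  rewrite (fubini_tonelli1 _ (mcellE 1 al be d tf) (cell0 1 f al be d)).
  exact: ge0_subset_integral.
have up' : \int[leb]_(s in `[al, al + d[) (h s * h s) <= 2 * d * (d * A + cell_energy 1 f al be d).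
  by rewrite -lee_fin /Rintegral fineK // integrable_fin_num.
have hint : \int[leb]_(s in `[al, al + d[) h s = d * f x - edge_integral f al be d.
  rewrite RintegralB //; [|exact: continuous_integrable_itv (fun t => cvg_cst _)|exact: continuous_integrable_itv].
  by rewrite (Rintegral_cst leb (mco al (al + d))) [X in fine X](length_co al d0) /= mulrC.
rewrite aA -EFinM -EFinD lee_fin; move: cs up'; rewrite hint addrAC subrr add0r.
move: (edge_integral f al be d) (cell_energy 1 f al be d) (\int[leb]_(_ in _) _) (f x) d0 => m p H v dp h1 h2.
have := sqr_ge0 (d * v - 2 * m); have := ler_wpM2l (ltW dp) h2; rewrite !expr2 !exprS expr0 mulr1 in h1 *.
nra.
Qed.

(** [cell_average] integrated over the cell: its area [d ^+ 2] matches the factor on the left, and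
    the horizontal energy, independent of [x.1], picks up one more factor [d]. *)
Lemma cell_poincare f al be d : test_function f -> 0 < d ->
  (\int[mu]_x (f x ^+ 2 * \1_(cell al be d) x)%:E <=
   (2 * edge_integral f al be d ^+ 2 + 4 * d ^+ 2 *
     (cell_energy 0 f al be d + cell_energy 1 f al be d))%:E)%E.
Proof.
move=> tf d0; pose Q := cell al be d; have mQ : measurable Q := measurable_cell al be d.
pose c := 2 * edge_integral f al be d ^+ 2 + 4 * d ^+ 2 * cell_energy 1 f al be d.
have p10 : 0 <= cell_energy 1 f al be d by apply: Rintegral_ge0 => x _; exact: cell_sqr_ge0.
have c0 : 0 <= c.
  by apply: addr_ge0; apply: mulr_ge0 => //; [exact: sqr_ge0|apply: mulr_ge0 => //; exact: sqr_ge0].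
pose a (y : measurableTypeR R) : \bar R := (\int[leb]_s (cell_sqr 0 f al be d (s, y))%:E)%E.
have ma : measurable_fun setT a.
  by have := measurable_fun_fubini_tonelli_G (m1 := leb) _ (mcellE 0 al be d tf) (cell0 0 f al be d).
have a0 y : (0 <= a y)%E by apply: integral_ge0 => t _; exact: cell0.
have mQi : measurable_fun [set: plane R] (EFin \o (\1_Q : plane R -> R)).
  by apply/measurable_EFinP; exact: measurable_indic.
have i0 (x : plane R) : (0 <= (\1_Q x : R)%:E)%E by rewrite lee_fin.
pose w (x : plane R) : \bar R := ((\1_Q x : R)%:E * a x.2)%E.
have mw : measurable_fun [set: plane R] w.
  by apply: emeasurable_funM => //; apply: measurableT_comp ma _; exact: measurable_snd.
have w0 x : (0 <= w x)%E by exact: mule_ge0.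
have muQ : mu Q = (d ^+ 2)%:E.
  have -> : mu Q = (leb `[al, (al + d)%R[%classic * leb `[be, (be + d)%R[%classic)%E.
    by apply: product_measure1E.
  by rewrite !length_co // -EFinM expr2.
have wint : (\int[mu]_x w x <= (d * cell_energy 0 f al be d)%:E)%E.
  rewrite (fubini_tonelli2 _ mw w0) /fubini_G EFinM -EFin_cell_energy //.
  rewrite (fubini_tonelli2 _ (mcellE 0 al be d tf) (cell0 0 f al be d)).
  rewrite -ge0_integralZl ?lee_fin ?(ltW d0) //.
  apply: ge0_le_integral => //.
  - by move=> y _; apply: integral_ge0 => s _; exact: w0.
  - exact: (measurable_fun_fubini_tonelli_G w mw w0).
  - by apply: emeasurable_funM => //; exact: measurable_cst.
  move=> y _; rewrite /w /=.
  have m1 : measurable_fun [set: measurableTypeR R] (fun s => (\1_Q (s, y))%:E : \bar R).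
    exact: (measurableT_comp mQi (pair2_measurable y)).
  rewrite ge0_integralZr //.
  apply: lee_wpmul2r => //; rewrite -(length_co al d0).
  apply: (@le_trans _ _ (\int[leb]_s (\1_(`[al, (al + d)%R[%classic : set (measurableTypeR R)) s)%:E)%E).
    apply: ge0_le_integral => //.
    - by apply/measurable_EFinP; exact: measurable_indic.
    move=> s _; rewrite lee_fin !indicE; case: (boolP ((s, y) \in Q)) => [/set_mem[/= h _]|_ //].
    by rewrite mem_set.
  by rewrite integral_indic // setIT.
have mf2 : measurable_fun [set: plane R] (EFin \o (fun x : plane R => f x ^+ 2 * \1_Q x : R)).
  apply/measurable_EFinP; apply: measurable_funM; last exact: measurable_indic.
  by apply: measurable_funX; apply: continuous_measurable_plane; exact: (test_cc tf).1.
have f20 (x : plane R) : (0 <= (f x ^+ 2 * \1_Q x)%:E)%E.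
  by rewrite lee_fin mulr_ge0 ?sqr_ge0.
have d2 : 0 < d ^+ 2 by rewrite exprn_gt0.
rewrite -(@lee_pmul2l _ (d ^+ 2)%:E) ?lte_fin //.
rewrite -ge0_integralZl ?lee_fin ?(ltW d2) //.
apply: (@le_trans _ _ (\int[mu]_x (c%:E * (\1_Q x : R)%:E + (4 * d ^+ 3)%:E * w x))%E).
  apply: ge0_le_integral => //.
  - by move=> x _; apply: mule_ge0 => //; rewrite lee_fin ltW.
  - by apply: emeasurable_funM => //; exact: measurable_cst.
  - by apply: emeasurable_funD; apply: emeasurable_funM => //; exact: measurable_cst.
  move=> x _; rewrite /w indicE; case: (boolP (x \in Q)) => [/set_mem xQ|_].
    by rewrite mulr1 mule1 mul1e -EFinM; exact: cell_average.
  by rewrite mulr0 !mule0 mul0e mule0 adde0.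
have d30 : (0 <= (4 * d ^+ 3)%:E)%E by rewrite lee_fin mulr_ge0 // exprn_ge0 // ltW.
rewrite ge0_integralD //; first last.
- by apply: emeasurable_funM => //; exact: measurable_cst.
- by move=> x _; exact: mule_ge0.
- by apply: emeasurable_funM => //; exact: measurable_cst.
- by move=> x _; apply: mule_ge0 => //; rewrite lee_fin.
rewrite ge0_integralZl ?lee_fin // (ge0_integralZl mu) //.
rewrite integral_indic // setIT muQ.
apply: le_trans (leeD (lexx _) (lee_wpmul2l d30 wint)) _.
rewrite -!EFinM -EFinD lee_fin /c.
move: (cell_energy 0 f al be d) (cell_energy 1 f al be d) (edge_integral f al be d) => p q m.
by apply: eq_le_refl; ring.
Qed.

End CellEstimate.

(** * Quantitative Rellich estimate on a strip *)

Section Rellich.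
Variable R : realType.
Local Notation leb := (@lebesgue_measure R).
Local Notation D := (halfplane R : set (plane R)).
Local Notation mu := (lebesgue2 R).
Local Notation dot := (l2dot mu D).
Implicit Types (f g : R * R -> R) (x : R * R).

Let mco (a b : R) : measurable (`[a, b[%classic : set (measurableTypeR R)).
Proof. exact: measurable_itv. Qed.

Lemma indic_grid (a d t : R) n : 0 < d ->
  \sum_(i < n) (\1_(`[a + i%:R * d, a + i%:R * d + d[%classic : set R) t : R) =
  \1_(`[a, a + n%:R * d[%classic : set R) t.
Proof.
move=> d0; elim: n => [|n IH].
  by rewrite big_ord0 mul0r addr0 set_itvco0 // indic0.
rewrite big_ord_recr /= IH !indicE !mem_setE !in_itv /=.
have -> : a + n.+1%:R * d = a + n%:R * d + d by rewrite -natr1; ring.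
have nd : 0 <= n%:R * d by rewrite mulr_ge0 // ltW.
move: (n%:R * d) nd => s s0.
case: (leP a t) => h1; case: (ltP t (a + s)) => h2; case: (ltP t (a + s + d)) => h3 /=;
  rewrite ?addr0 ?add0r //; lra.
Qed.

(** The box starts on the axis, so that each vertical line in it begins where test functions
    vanish. *)
Definition strip (M : R) : set (plane R) := `[- M, M[%classic `*` `[0, M[%classic.

Lemma measurable_strip M : measurable (strip M).
Proof. by apply: measurableX. Qed.

Lemma indic_prod (A B : set R) x : \1_(A `*` B) x = \1_A x.1 * \1_B x.2 :> R.
Proof.
rewrite !indicE; case: (boolP (x.1 \in A)) => hA; case: (boolP (x.2 \in B)) => hB.
- by rewrite mem_set ?mulr1 //; split; exact: set_mem.
- by rewrite memNset ?mulr0 // => -[_ /mem_set]; exact/negP.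
- by rewrite memNset ?mul0r // => -[/mem_set + _]; exact/negP.
- by rewrite memNset ?mul0r // => -[/mem_set + _]; exact/negP.
Qed.

Lemma strip_grid (M d : R) N x : 0 < d -> M = N%:R * d ->
  \1_(strip M) x = \sum_(p : 'I_(2 * N) * 'I_N)
    \1_(cell (- M + p.1%:R * d) (p.2%:R * d) d) x :> R.
Proof.
move=> d0 MN.
transitivity (\sum_(i < 2 * N) \sum_(j < N) (\1_(cell (- M + i%:R * d) (j%:R * d) d) x : R)).
  rewrite /strip indic_prod.
  have -> : `[- M, M[%classic = `[- M, - M + (2 * N)%:R * d[%classic :> set R.
    have -> // : - M + (2 * N)%:R * d = M.
    by rewrite natrM -mulrA -MN mulr_natl mulr2n addKr.
  have -> : `[0, M[%classic = `[0, 0 + N%:R * d[%classic :> set R by rewrite -MN add0r.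
  rewrite -!indic_grid // mulr_suml; apply: eq_bigr => i _.
  by rewrite mulr_sumr; apply: eq_bigr => j _; rewrite /cell indic_prod add0r.
by rewrite pair_bigA.
Qed.

Lemma edge_integral_lin c f g al be d : test_function f -> test_function g ->
  edge_integral (fun x => c * f x + g x) al be d =
  c * edge_integral f al be d + edge_integral g al be d.
Proof.
move=> tf tg.
have cf : continuous (fun s => f (s, be)) by exact: (@continuous_slice R 0 f (0, be) (test_cc tf).1).
have cg : continuous (fun s => g (s, be)) by exact: (@continuous_slice R 0 g (0, be) (test_cc tg).1).
have ccf : continuous (fun s => c * f (s, be)) by move=> s; exact: (cvgM (cvg_cst c) (cf s)).
have i1 := continuous_integrable_itv al (al + d) cf.
have i2 := continuous_integrable_itv al (al + d) cg.
have i3 := continuous_integrable_itv al (al + d) ccf.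
by rewrite /edge_integral RintegralD // RintegralZl.
Qed.

Lemma test_sqr_integral h : cc_fun h -> (\int[mu]_x (h x ^+ 2)%:E = (dot h h)%:E)%E.
Proof.
move=> ch; rewrite -integral_sqr; [|exact: measurable_halfplane|exact: cc_sqint].
rewrite [RHS]integral_off // => x Dx; have [cf [M hM]] := ch.
by have [->|/hM[_ x2 _]] := eqVneq (h x) 0; [rewrite expr0n|exfalso].
Qed.

(** As [f] vanishes at height 0, [f (s, be)] is an increment along a vertical segment of length at
    most [M]; this makes the edge integrals bounded functionals for the Dirichlet norm. *)
Lemma edge_integral_bound f al be d M : test_function f -> 0 < d -> 0 <= be < M ->
  edge_integral f al be d ^+ 2 <= d * M * dot (partial 1 f) (partial 1 f).
Proof.
move=> tf d0 /andP[be0 beM].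
have cf : continuous (fun s => f (s, be)) by exact: (@continuous_slice R 0 f (0, be) (test_cc tf).1).
have cf2 : continuous (fun s => f (s, be) * f (s, be)) by move=> s; exact: (cvgM (cf s) (cf s)).
have ab : al <= al + d by rewrite lerDl ltW.
apply: le_trans (itv_cauchy_schwarz ab cf) _.
rewrite addrAC subrr add0r -mulrA ler_wpM2l ?(ltW d0) //.
have M0 : 0 < M by lra.
have hp := test_partial_cc 1 tf.
pose h (x : plane R) : \bar R := ((partial 1 f x ^+ 2 : R)%:E)%E.
have mh : measurable_fun [set: plane R] h.
  apply/measurable_EFinP; apply: measurable_funX; apply: continuous_measurable_plane.
  exact: hp.1.
have h0 x : (0 <= h x)%E by rewrite lee_fin sqr_ge0.
pose b (s : measurableTypeR R) : \bar R := (\int[leb]_t h (s, t))%E.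
have mb : measurable_fun setT b.
  by have := measurable_fun_fubini_tonelli_F (m2 := leb) _ mh h0.
have b0 s : (0 <= b s)%E by apply: integral_ge0 => t _; exact: h0.
have i2 := continuous_integrable_itv al (al + d) cf2.
rewrite -lee_fin /Rintegral fineK; last exact: (integrable_fin_num (mco _ _) i2).
rewrite EFinM -test_sqr_integral // (fubini_tonelli1 _ mh h0) /fubini_F.
apply: (@le_trans _ _ (\int[leb]_(s in `[al, (al + d)%R[) (M%:E * b s))%E).
  apply: ge0_le_integral => //.
  - by move=> s _; rewrite lee_fin -expr2 sqr_ge0.
  - by case/integrableP: i2.
  - apply: emeasurable_funM; first exact: measurable_cst.
    exact: (measurable_funS measurableT).
  move=> s _.
  have cs := @continuous_slice R 1 _ (s, 0) hp.1.
  have := @itv_oscillation R (slice 1 f (s, 0)) (slice 1 (partial 1 f) (s, 0)) 0 M 0 be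
    (fun t => slice_is_derive 1 (s, 0) t tf) cs.
  rewrite lexx M0 be0 beM => /(_ isT isT); rewrite subr0.
  have -> : slice 1 f (s, 0) 0 = 0.
    rewrite /slice /=; have [c0 [B hB]] := test_cc tf.
    by apply/eqP/negPn/negP => /hB[_ /=]; rewrite ltxx.
  rewrite subr0 -lee_fin expr2 => /le_trans; apply.
  have cs2 : continuous (fun t => slice 1 (partial 1 f) (s, 0) t * slice 1 (partial 1 f) (s, 0) t).
    by move=> t; exact: (cvgM (cs t) (cs t)).
  have i3 := continuous_integrable_itv 0 M cs2.
  rewrite EFinM /Rintegral fineK; last exact: (integrable_fin_num (mco _ _) i3).
  apply: lee_wpmul2l; first by rewrite lee_fin ltW.
  have mbs : measurable_fun [set: measurableTypeR R] (fun t => h (s, t)).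
    exact: (measurableT_comp mh (pair1_measurable s)).
  exact: (@ge0_subset_integral _ _ _ leb `[0, M[%classic setT (mco _ _) measurableT
    (fun t => h (s, t)) mbs (fun t _ => h0 (s, t)) (fun t _ => I)).
apply: le_trans.
  apply: (@ge0_subset_integral _ _ _ leb _ setT) => //.
  - by apply: emeasurable_funM => //; exact: measurable_cst.
  - by move=> s _; apply: mule_ge0 => //; rewrite lee_fin ltW.
by rewrite ge0_integralZl // lee_fin ltW.
Qed.

(** Summing [cell_poincare] over a grid: the mesh makes the energy term small, and the edge
    integrals of the finitely many cells are the exceptional functionals. *)
Theorem rellich (M e : R) : 0 < M -> 0 < e ->
  exists (I : finType) (a : I -> (R * R -> R) -> R),
  [/\ forall i, exists2 C : R, 0 <= C & forall f, test_function f ->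
        `|a i f| <= C * Num.sqrt (dot (partial 1 f) (partial 1 f)),
      forall i c f g, test_function f -> test_function g ->
        a i (fun x => c * f x + g x) = c * a i f + a i g
    & forall f, test_function f ->
        dot (fun x => f x * \1_(strip M) x) (fun x => f x * \1_(strip M) x) <=
        e * (dot (partial 0 f) (partial 0 f) + dot (partial 1 f) (partial 1 f)) +
        \sum_i a i f ^+ 2].
Proof.
move=> M0 e0.
(* The mesh will be [M / N%:R], and the energy term of [cell_poincare] carries 4 times its
   square. *)
have [N N0 Ne] : exists2 N : nat, (0 < N)%N & 4 * (M / N%:R) ^+ 2 <= e.
  exists (Num.truncn (4 * M ^+ 2 / e)).+1 => //.
  have := truncnS_gt (4 * M ^+ 2 / e); move: (Num.truncn _).+1 (ltn0Sn (Num.truncn (4 * M ^+ 2 / e))) => N N0 hN.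
  have N1 : 1 <= N%:R :> R by rewrite ler1n.
  move: (N%:R : R) hN N1 => n hN n1 {N0}.
  have np : 0 < n by lra.
  rewrite ltr_pdivrMr // in hN.
  rewrite expr_div_n mulrA ler_pdivrMr ?exprn_gt0 //; apply: (le_trans (ltW hN)).
  by rewrite mulrC (ler_pM2l e0) expr2; apply: ler_peMl => //; exact: ltW.
pose d := M / N%:R.
have d0 : 0 < d by rewrite divr_gt0 // ltr0n.
have MN : M = N%:R * d by rewrite /d mulrC divfK // pnatr_eq0 -lt0n.
exists ('I_(2 * N) * 'I_N)%type.
pose al (p : 'I_(2 * N) * 'I_N) := - M + p.1%:R * d.
pose be (p : 'I_(2 * N) * 'I_N) := p.2%:R * d.
(* The factor [Num.sqrt 2] absorbs the 2 in front of the squared edge integral. *)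
exists (fun p f => Num.sqrt 2 * edge_integral f (al p) (be p) d); split.
- move=> p; exists (Num.sqrt 2 * Num.sqrt (d * M)); first by rewrite mulr_ge0 ?sqrtr_ge0.
  move=> f tf; rewrite normrM ger0_norm ?sqrtr_ge0 // -mulrA ler_wpM2l ?sqrtr_ge0 //.
  rewrite -sqrtrM; last by apply: mulr_ge0; exact: ltW.
  rewrite -sqrtr_sqr; apply: ler_wsqrtr.
  apply: edge_integral_bound => //.
  by rewrite mulr_ge0 ?(ltW d0) //= MN ltr_pM2r // ltr_nat.
- by move=> p c f g tf tg; rewrite edge_integral_lin //; ring.
- move=> f tf.
  have stp x : \1_(strip M) x = \sum_p \1_(cell (al p) (be p) d) x :> R by exact: strip_grid.
  have E k : \sum_p cell_energy k f (al p) (be p) d <= dot (partial k f) (partial k f).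
    rewrite -lee_fin -sumEFin; under eq_bigr do rewrite -EFin_cell_energy //.
    rewrite -ge0_integral_sum //; last 2 first.
    + by move=> p; apply/measurable_EFinP; exact: measurable_cell_sqr.
    + by move=> p x _; rewrite lee_fin cell_sqr_ge0.
    rewrite -test_sqr_integral; last exact: test_partial_cc.
    apply: ge0_le_integral => //.
    + by move=> x _; apply: sume_ge0 => p _; rewrite lee_fin cell_sqr_ge0.
    + by apply: emeasurable_sum => p; apply/measurable_EFinP; exact: measurable_cell_sqr.
    + apply/measurable_EFinP; apply: measurable_funX; apply: continuous_measurable_plane.
      exact: (test_partial_cc k tf).1.
    move=> x _; rewrite sumEFin lee_fin /cell_sqr -mulr_sumr -stp.
    by rewrite ler_piMr ?sqr_ge0 // indicE lern1 leq_b1.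
  have sf : sqint mu D (fun x => f x * \1_(strip M) x).
    apply: (@sqint_bounded _ _ _ mu D (@measurable_halfplane R) _ _ 1 (cc_sqint (test_cc tf))).
      exact: measurable_indic (measurable_strip M).
    by move=> x _; rewrite indicE normr_nat lern1 leq_b1.
  have ms : measurable_fun [set: plane R] (fun x => ((f x * \1_(strip M) x) ^+ 2)%:E).
    apply/measurable_EFinP; apply: measurable_funX; apply: measurable_funM.
      by apply: continuous_measurable_plane; exact: (test_cc tf).1.
    exact: measurable_indic (measurable_strip M).
  rewrite -lee_fin -integral_sqr //; last exact: measurable_halfplane.
  apply: (@le_trans _ _ (\sum_p \int[mu]_x (f x ^+ 2 * \1_(cell (al p) (be p) d) x)%:E)%E).
    have mc p : measurable_fun [set: plane R]
        (fun x => (f x ^+ 2 * \1_(cell (al p) (be p) d) x)%:E).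
      apply/measurable_EFinP; apply: measurable_funM; last exact: measurable_indic (measurable_cell _ _ _).
      by apply: measurable_funX; apply: continuous_measurable_plane; exact: (test_cc tf).1.
    have c0 p x : (0 <= (f x ^+ 2 * \1_(cell (al p) (be p) d) x)%:E)%E.
      by rewrite lee_fin; apply: mulr_ge0; rewrite ?sqr_ge0 // indicE.
    rewrite -ge0_integral_sum //.
    have p0 x : [set: plane R] x -> (0 <= ((f x * \1_(strip M) x) ^+ 2)%:E)%E.
      by move=> _; rewrite lee_fin sqr_ge0.
    have := @ge0_subset_integral _ _ _ mu _ _ (@measurable_halfplane R) measurableT _ ms p0
      (@subsetT _ D).
    move=> /le_trans; apply.
    apply: ge0_le_integral => //.
      exact: emeasurable_sum.
    move=> x _; rewrite sumEFin lee_fin -mulr_sumr -stp exprMn indicE.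
    by case: (_ \in _); rewrite ?expr1n ?expr0n.
  apply: le_trans (lee_sum _ (fun p _ => cell_poincare (al p) (be p) tf d0)) _.
  rewrite sumEFin lee_fin addrC big_split /=; apply: lerD.
    by apply: ler_sum => p _; rewrite exprMn sqr_sqrtr.
  rewrite -mulr_sumr big_split /=.
  have := lerD (E 0) (E 1).
  have : 0 <= \sum_p cell_energy 0 f (al p) (be p) d + \sum_p cell_energy 1 f (al p) (be p) d.
    by apply: addr_ge0; apply: sumr_ge0 => p _; apply: Rintegral_ge0 => x _; exact: cell_sqr_ge0.
  rewrite -/d in Ne.
  move: (\sum_p _ + _) (dot _ _ + _) => a b a0 ab; nra.
Qed.

End Rellich.

Lemma sqr_sum_le (R : realType) (s t : R) : (s + t) ^+ 2 <= (s ^+ 2 + t ^+ 2) * 2.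
Proof. by have := sqr_ge0 (s - t); rewrite -subr_ge0; nra. Qed.

(** * Compactness of the convection form *)

Section ConvectionCompact.
Variable R : realType.
Local Notation D := (halfplane R : set (plane R)).
Local Notation mu := (lebesgue2 R).
Local Notation dot := (l2dot mu D).
Local Notation E := (solfield R).
Local Notation nrm := (ip_norm (@dirichlet R)).
Implicit Types (f g : R * R -> R) (x : R * R) (u v w phi : E).

Let mD : measurable D := @measurable_halfplane R.

Definition cut (M : R) f x : R := f x * \1_(strip M) x.

Lemma cut_sqint M f : sqint mu D f -> sqint mu D (cut M f).
Proof.
move=> sf; apply: (@sqint_bounded _ _ _ mu D mD _ _ 1 sf).
  exact: measurable_indic (measurable_strip M).
by move=> x _; rewrite indicE normr_nat lern1 leq_b1.
Qed.

(** [rellich] with [e = 1], its functionals being bounded by the energy in turn: a Poincare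
    inequality on the strip. *)
Lemma cut_bound (M : R) : 0 < M -> exists2 C : R, 0 <= C &
  forall f, test_function f ->
    dot (cut M f) (cut M f) <=
    C * (dot (partial 0 f) (partial 0 f) + dot (partial 1 f) (partial 1 f)).
Proof.
move=> M0; have [I [a [aB _ h]]] := rellich M0 (@ltr01 R).
have /choice[C hC] : forall i, exists C : R, 0 <= C /\ forall f, test_function f ->
    `|a i f| <= C * Num.sqrt (dot (partial 1 f) (partial 1 f)).
  by move=> i; have [C ? ?] := aB i; exists C.
exists (1 + \sum_i C i ^+ 2); first by rewrite addr_ge0 ?sumr_ge0 // => i _; exact: sqr_ge0.
move=> f tf; apply: le_trans (h f tf) _; rewrite mulrDl lerD2l.
apply: (@le_trans _ _ ((\sum_i C i ^+ 2) * dot (partial 1 f) (partial 1 f))).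
  rewrite mulr_suml; apply: ler_sum => i _.
  rewrite -(sqr_sqrtr (l2dot_ge0 mu D (partial 1 f))) -exprMn -(real_normK (num_real (a i f))).
  have [C0 hCi] := hC i.
  by rewrite lerXn2r ?nnegrE //; [rewrite mulr_ge0 ?sqrtr_ge0|exact: hCi].
apply: ler_wpM2l; first by apply: sumr_ge0 => i _; exact: sqr_ge0.
by rewrite lerDr l2dot_ge0.
Qed.

Lemma cc_family (I : finType) (f : I -> R * R -> R) : (forall i, cc_fun (f i)) ->
  exists M B : R, [/\ 0 < M, 0 <= B, forall i x, `|f i x| <= B &
    forall i x, f i x * \1_(strip M) x = f i x].
Proof.
move=> cf; have /choice[m hm] : forall i, exists M, csupp M (f i) by move=> i; case: (cf i).
have /choice[b hb] : forall i, exists C : R, 0 <= C /\ forall x, `|f i x| <= C.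
  by move=> i; have [C ? ?] := cc_bounded (cf i); exists C.
exists (1 + \sum_i `|m i|), (\sum_i b i); split.
- by apply: ltr_wpDr => //; exact: sumr_ge0.
- by apply: sumr_ge0 => i _; case: (hb i).
- move=> i x; apply: le_trans ((hb i).2 x) _; rewrite (bigD1 i) //= lerDl.
  by apply: sumr_ge0 => k _; case: (hb k).
move=> i x; have [->|fx] := eqVneq (f i x) 0; first by rewrite mul0r.
have le : m i <= 1 + \sum_i `|m i|.
  rewrite (bigD1 i) //= addrCA; apply: le_trans (ler_norm _) _; rewrite lerDl.
  by apply: addr_ge0 => //; exact: sumr_ge0.
have [h1 h2 h3] := csupp_le le (hm i) fx.
rewrite indicE mem_set ?mulr1 //; move: (1 + _) h1 h3 => M h1 h3.
by move: h1; rewrite ltr_norml => /andP[a1 a2]; split; rewrite /= in_itv /= ?(ltW a1) ?(ltW h2) ?h3.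
Qed.

Let cutn M f := Num.sqrt (dot (cut M f) (cut M f)).

(** [phi i] lives in the strip, so the cut-off can be moved onto [w j]: the difference of two fields
    is measured locally, and [u] only through its gradient. *)
Lemma dot_convection_transport (M B : R) u w phi i j : 0 <= B ->
  (forall x, `|phi i x| <= B) -> (forall x, cut M (phi i) x = phi i x) ->
  `|dot (fun x => w j x * partial j (u i) x) (phi i)| <= B * cutn M (w j) * nrm u.
Proof.
move=> B0 hB hM.
have mphi : measurable_fun D (phi i) := (solfield_sqint phi i).1.
have sw := cut_sqint M (solfield_sqint w j).
have sp := sqint_bounded mD sw mphi (fun x _ => hB x).
have -> : dot (fun x => w j x * partial j (u i) x) (phi i) =
          dot (fun x => cut M (w j) x * phi i x) (partial j (u i)).
  by apply: eq_Rintegral => x _; rewrite -[in LHS]hM /cut; ring.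
apply: le_trans (l2dot_cs mD sp (solfield_partial_sqint u i j)) _.
apply: ler_pM; rewrite ?sqrtr_ge0 //; last exact: dirichlet_norm_component.
rewrite -(ger0_norm B0) -sqrtr_sqr -sqrtrM ?sqr_ge0 //; apply: ler_wsqrtr.
by apply: l2dot_bounded.
Qed.

(** The derivative falls on [phi], so both other factors are cut off: [v] is then estimated by
    [cut_bound], and the local norm of [w] remains as the small factor. *)
Lemma dot_convection_gradient (M B : R) v w phi i j : 0 <= B ->
  (forall x, `|partial j (phi i) x| <= B) ->
  (forall x, cut M (partial j (phi i)) x = partial j (phi i) x) ->
  `|dot (fun x => v j x * partial j (phi i) x) (w i)| <= B * cutn M (v j) * cutn M (w i).
Proof.
move=> B0 hB hM.
have mphi : measurable_fun D (partial j (phi i)) := (solfield_partial_sqint phi i j).1.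
have sv := cut_sqint M (solfield_sqint v j).
have sw := cut_sqint M (solfield_sqint w i).
have sp := sqint_bounded mD sv mphi (fun x _ => hB x).
have -> : dot (fun x => v j x * partial j (phi i) x) (w i) =
          dot (fun x => cut M (v j) x * partial j (phi i) x) (cut M (w i)).
  apply: eq_Rintegral => x _; rewrite -[in LHS]hM /cut indicE; case: (_ \in _) => /=; ring.
apply: le_trans (l2dot_cs mD sp sw) _.
apply: ler_wpM2r; rewrite ?sqrtr_ge0 //.
rewrite -(ger0_norm B0) -sqrtr_sqr -sqrtrM ?sqr_ge0 //; apply: ler_wsqrtr.
by apply: l2dot_bounded.
Qed.

Lemma dirichlet_components v : dirichlet v v =
  \sum_(i < 2) (dot (partial 0 (v i)) (partial 0 (v i)) + dot (partial 1 (v i)) (partial 1 (v i))).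
Proof.
rewrite /dirichlet; apply: eq_bigr => i _; rewrite big_ord_recl big_ord1.
by rewrite (_ : lift ord0 ord0 = 1) //; exact: val_inj.
Qed.

Lemma convection_diff u v phi : convection u u phi - convection v v phi =
  convection (u - v) u phi - convection v phi (u - v).
Proof.
rewrite -(convection_antisym v (u - v)) (linear_formB (convectionL1 _ _)) (linear_formB (convectionL2 _ _)).
by rewrite addrA subrK.
Qed.

Lemma convection_compact phi (e : R) : 0 < e ->
  exists (I : finType) (a : I -> E -> R), (forall i, bounded_form (@dirichlet R) (a i)) /\
    forall u v, `|convection u u phi - convection v v phi| <=
      (nrm u + nrm v) * Num.sqrt (e * nrm (u - v) ^+ 2 + \sum_i a i (u - v) ^+ 2).
Proof.
move=> e0.
pose fam (t : 'I_2 + 'I_2 * 'I_2) := match t with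
  | inl i => phi i | inr ij => partial ij.2 (phi ij.1) end.
have [M [B [M0 B0 hB hM]]] : exists M B : R, [/\ 0 < M, 0 <= B, forall i x, `|fam i x| <= B &
    forall i x, fam i x * \1_(strip M) x = fam i x].
  by apply: cc_family => -[i|[i j]]; [exact: solfield_cc|exact: solfield_partial_cc].
have [C C0 hC] := cut_bound M0.
have cutv v j : cutn M (v j) <= Num.sqrt C * nrm v.
  rewrite -sqrtrM //; apply: ler_wsqrtr; apply: le_trans (hC _ (solfield_test v j)) _.
  apply: ler_wpM2l => //; rewrite dirichlet_components (bigD1 j) //= lerDl.
  by apply: sumr_ge0 => i _; rewrite addr_ge0 // l2dot_ge0.
pose K := 2 * B * (1 + Num.sqrt C).
have K0 : 0 <= K by rewrite /K !mulr_ge0 // addr_ge0 // sqrtr_ge0.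
have main u v : `|convection u u phi - convection v v phi| <=
    K * (nrm u + nrm v) * \sum_(j < 2) cutn M ((u - v) j).
  rewrite convection_diff; move: (u - v) => w.
  have n1 := ip_norm_ge0 (@dirichlet R) u; have n2 := ip_norm_ge0 (@dirichlet R) v.
  apply: le_trans (ler_normB _ _) _.
  have A1 : `|convection w u phi| <= 2 * B * nrm u * \sum_(j < 2) cutn M (w j).
    apply: (@le_trans _ _ (\sum_(i < 2) (B * nrm u * \sum_(j < 2) cutn M (w j)))).
      apply: le_trans (ler_norm_sum _ _ _) _; apply: ler_sum => i _.
      apply: le_trans (ler_norm_sum _ _ _) _; rewrite mulr_sumr; apply: ler_sum => j _.
      rewrite mulrAC; apply: dot_convection_transport => //; first exact: (hB (inl i)).
      exact: (hM (inl i)).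
    by rewrite sumr_const card_ord -!mulrA mulr_natl.
  have A2 : `|convection v phi w| <= 2 * B * (Num.sqrt C * nrm v) * \sum_(j < 2) cutn M (w j).
    apply: (@le_trans _ _ (\sum_(i < 2) (2 * B * (Num.sqrt C * nrm v) * cutn M (w i)))).
      apply: le_trans (ler_norm_sum _ _ _) _; apply: ler_sum => i _.
      apply: (@le_trans _ _ (\sum_(j < 2) (B * (Num.sqrt C * nrm v) * cutn M (w i)))).
        apply: le_trans (ler_norm_sum _ _ _) _; apply: ler_sum => j _.
        apply: (@le_trans _ _ (B * cutn M (v j) * cutn M (w i))).
          apply: dot_convection_gradient => //; first exact: (hB (inr (i, j))).
          exact: (hM (inr (i, j))).
        apply: ler_wpM2r; first exact: sqrtr_ge0.
        by apply: ler_wpM2l => //; exact: cutv.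
      by rewrite sumr_const card_ord -!mulrA mulr_natl.
    by rewrite mulr_sumr.
  have c0 := sqrtr_ge0 C.
  have s0 : 0 <= \sum_(j < 2) cutn M (w j) by apply: sumr_ge0 => j _; exact: sqrtr_ge0.
  apply: le_trans (lerD A1 A2) _; rewrite -mulrDl; apply: ler_wpM2r => //.
  rewrite /K; move: (Num.sqrt C) c0 (nrm u) n1 (nrm v) n2 => c c0 a a0 b b0.
  rewrite -mulrDr -[leRHS]mulrA; apply: ler_wpM2l; first exact: mulr_ge0.
  rewrite mulrDl mul1r mulrDr; apply: lerD; first by rewrite lerDl.
  by rewrite lerDr mulr_ge0.
(* [2 * K ^+ 2] comes from squaring [K] times a sum of two components; the added 1 keeps the
   denominator positive. *)
pose e' := e / (2 * K ^+ 2 + 1).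
have k0 : 0 < 2 * K ^+ 2 + 1 by apply: ltr_wpDl => //; apply: mulr_ge0 => //; exact: sqr_ge0.
have e'0 : 0 < e' by rewrite divr_gt0.
have ek : 2 * K ^+ 2 * e' <= e.
  by rewrite /e' mulrA ler_pdivrMr // mulrC ler_pM2l // lerDl.
have [I [a [aB aL h]]] := rellich M0 e'0.
exists (I * 'I_2)%type; exists (fun p w => Num.sqrt 2 * K * a p.1 (w p.2)); split.
  move=> [i j] /=; split.
    move=> c u v; have -> : a i ((c *: u + v) j) = c * a i (u j) + a i (v j).
      by rewrite -aL //; exact: solfield_test.
    by ring.
  have [A A0 hA] := aB i; exists (Num.sqrt 2 * K * A).
    by apply: mulr_ge0 => //; apply: mulr_ge0 => //; exact: sqrtr_ge0.
  move=> v; rewrite normrM -[leRHS]mulrA [X in X * _ <= _]ger0_norm; last first.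
    by apply: mulr_ge0 => //; exact: sqrtr_ge0.
  apply: ler_wpM2l; first by apply: mulr_ge0 => //; exact: sqrtr_ge0.
  apply: le_trans (hA _ (solfield_test v j)) _; apply: ler_wpM2l => //.
  exact: dirichlet_norm_component.
move=> u v; apply: le_trans (main u v) _; move: (u - v) => w.
rewrite mulrAC [leLHS]mulrC; apply: ler_wpM2l.
  by apply: addr_ge0; exact: ip_norm_ge0.
rewrite -[leLHS]ger0_norm; last first.
  by apply: mulr_ge0 => //; apply: sumr_ge0 => j _; exact: sqrtr_ge0.
rewrite -sqrtr_sqr; apply: ler_wsqrtr.
have H : \sum_(j < 2) cutn M (w j) ^+ 2 <= e' * nrm w ^+ 2 + \sum_(j < 2) \sum_i a i (w j) ^+ 2.
  rewrite (ip_norm_sqr (@dirichletC R) (@dirichlet_ge0 R)) dirichlet_components mulr_sumr -big_split.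
  apply: ler_sum => j _ /=; rewrite sqr_sqrtr ?l2dot_ge0 //.
  exact: h (solfield_test w j).
have -> : \sum_(p : I * 'I_2) (Num.sqrt 2 * K * a p.1 (w p.2)) ^+ 2 =
    2 * K ^+ 2 * \sum_(j < 2) \sum_i a i (w j) ^+ 2.
  rewrite exchange_big pair_bigA mulr_sumr; apply: eq_bigr => -[i j] _ /=.
  by rewrite !exprMn sqr_sqrtr.
move: H; set S := \sum_(j < 2) \sum_i _; set q := nrm w ^+ 2.
have q0 : 0 <= q by rewrite sqr_ge0.
rewrite !big_ord_recl !big_ord0 !addr0; move: (cutn _ _) (cutn _ _) => s t.
move: S q q0 => S q q0 H.
have H1 : (K * (t + s)) ^+ 2 <= 2 * K ^+ 2 * (t ^+ 2 + s ^+ 2).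
  rewrite exprMn (mulrC 2) -[leRHS]mulrA (mulrC 2); apply: ler_wpM2l; first exact: sqr_ge0.
  exact: sqr_sum_le.
have H2 : 2 * K ^+ 2 * (t ^+ 2 + s ^+ 2) <= 2 * K ^+ 2 * (e' * q + S).
  by apply: ler_wpM2l => //; apply: mulr_ge0 => //; exact: sqr_ge0.
have H3 := ler_wpM2r q0 ek.
by apply: (le_trans H1); apply: (le_trans H2); rewrite mulrDr lerD2r mulrA.
Qed.

End ConvectionCompact.

(** * Passage to the limit *)

Section L2Convergence.
Context d (T : measurableType d) (R : realType).
Variables (mu : {measure set T -> \bar R}) (D : set T).
Hypothesis mD : measurable D.
Local Notation sqint := (sqint mu D).
Local Notation dot := (l2dot mu D).
Implicit Types (f g : nat -> T -> R) (u v c : T -> R).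

(** Square integrability is part of the notion because [l2dot] is real-valued: an infinite integral
    would be read as 0, and the convergence would say nothing. *)
Definition l2_cvg f u := [/\ forall k, sqint (f k), sqint u &
  (fun k => dot (fun x => u x - f k x) (fun x => u x - f k x)) @ \oo --> (0 : R)].

Lemma l2_cvg_half f u (C : R) : (forall k, sqint (f k)) -> sqint u ->
  (forall k, dot (fun x => u x - f k x) (fun x => u x - f k x) <= (C * (1/2) ^+ k) ^+ 2) ->
  l2_cvg f u.
Proof.
move=> sf su h; split => //.
have e : (fun k => (C * (1/2 : R) ^+ k) ^+ 2) @ \oo --> (0 : R).
  have g : (fun k => C * (1/2 : R) ^+ k) @ \oo --> (0 : R).
    rewrite -[X in _ --> X](mulr0 C); apply: cvgMr; apply: cvg_expr.
    by rewrite ger0_norm; lra.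
  by rewrite -[X in _ --> X](mulr0 0); exact: (cvgM g g).
apply: squeeze_cvgr (cvg_cst 0) e; near=> k; by rewrite l2dot_ge0 h.
Unshelve. all: by end_near.
Qed.

Lemma l2_cvg_cst u : sqint u -> l2_cvg (fun=> u) u.
Proof.
move=> su; split => //; apply: cvg_near_cst; apply: nearW => k.
have -> : (fun x => u x - u x) = (fun=> 0) by apply/funext => x; rewrite subrr.
by rewrite /l2dot; under eq_Rintegral do rewrite mul0r; rewrite /Rintegral integral0.
Qed.

Lemma l2_cvg_dot f u g v : l2_cvg f u -> l2_cvg g v ->
  (fun k => dot (f k) (g k)) @ \oo --> dot u v.
Proof.
move=> [sf su fu] [sg sv gv].
have rf : (fun k => Num.sqrt (dot (fun x => u x - f k x) (fun x => u x - f k x))) @ \oo --> (0 : R).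
  by rewrite -sqrtr0; apply: (continuous_cvg _ _ fu); exact: sqrt_continuous.
have rg : (fun k => Num.sqrt (dot (fun x => v x - g k x) (fun x => v x - g k x))) @ \oo --> (0 : R).
  by rewrite -sqrtr0; apply: (continuous_cvg _ _ gv); exact: sqrt_continuous.
move: rf rg; set a := (X in X @ \oo --> _ -> _); set b := (X in _ -> X @ \oo --> _ -> _) => a0 b0.
have E k : `|dot (f k) (g k) - dot u v| <=
    a k * b k + a k * Num.sqrt (dot v v) + Num.sqrt (dot u u) * b k.
  have suf := sqintB mD su (sf k); have svg := sqintB mD sv (sg k).
  have -> : dot (f k) (g k) - dot u v =
      dot (fun x => u x - f k x) (fun x => v x - g k x) - dot (fun x => u x - f k x) v
      - dot u (fun x => v x - g k x).
    rewrite (l2dotB mD su (sf k) svg) (l2dotB mD su (sf k) sv).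
    rewrite !(l2dotC mu D _ (fun x => v x - g k x)) !(l2dotB mD sv (sg k)) //.
    by rewrite !(l2dotC mu D _ u) !(l2dotC mu D _ (f k)); ring.
  apply: le_trans (ler_normB _ _) _; apply: lerD; last exact: l2dot_cs.
  by apply: le_trans (ler_normB _ _) _; apply: lerD; exact: l2dot_cs.
have B0 : (fun k => a k * b k + a k * Num.sqrt (dot v v) + Num.sqrt (dot u u) * b k)
    @ \oo --> (0 : R).
  have -> : 0 = 0 * 0 + 0 * Num.sqrt (dot v v) + Num.sqrt (dot u u) * 0 :> R by ring.
  by apply: cvgD; [apply: cvgD; [exact: cvgM|exact: cvgMl]|exact: cvgMr].
have d0 : (fun k => dot (f k) (g k) - dot u v) @ \oo --> (0 : R).
  have N0 : (fun k => - (a k * b k + a k * Num.sqrt (dot v v) + Num.sqrt (dot u u) * b k))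
    @ \oo --> (0 : R) by rewrite -oppr0; exact: (cvgN B0).
  by apply: squeeze_cvgr N0 B0; near=> k; rewrite -ler_norml.
have <- : (fun k => dot (f k) (g k) - dot u v + dot u v) = (fun k => dot (f k) (g k)).
  by apply/funext => k; rewrite subrK.
by rewrite -[X in _ --> X]add0r; exact: (cvgD d0 (cvg_cst _)).
Unshelve. all: by end_near.
Qed.

Lemma l2_cvgM f u c (C : R) : measurable_fun D c -> (forall x, D x -> `|c x| <= C) ->
  l2_cvg f u -> l2_cvg (fun k x => f k x * c x) (fun x => u x * c x).
Proof.
move=> mc cC [sf su fu]; have cC' x : D x -> `|c x| <= `|C|.
  by move=> /cC /le_trans; apply; exact: ler_norm.
split; [by move=> k; exact: sqint_bounded cC|exact: sqint_bounded cC|].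
have e0 : (fun k => `|C| ^+ 2 * dot (fun x => u x - f k x) (fun x => u x - f k x))
    @ \oo --> (0 : R) by rewrite -[X in _ --> X](mulr0 (`|C| ^+ 2)); exact: (cvgMr fu).
apply: squeeze_cvgr (cvg_cst 0) e0; near=> k; rewrite l2dot_ge0 /=.
have -> : (fun x => u x * c x - f k x * c x) = (fun x => (u x - f k x) * c x).
  by apply/funext => x; rewrite mulrBl.
exact: (l2dot_bounded mD (sqintB mD su (sf k)) mc cC').
Unshelve. all: by end_near.
Qed.

Lemma eq_l2dot (f1 f2 g1 g2 : T -> R) : (forall x, D x -> f1 x = f2 x) -> (forall x, D x -> g1 x = g2 x) ->
  dot f1 g1 = dot f2 g2.
Proof. by move=> hf hg; apply: eq_Rintegral => x /set_mem Dx; rewrite hf ?hg. Qed.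

Lemma eq_l2_cvg f f' u u' : (forall k x, D x -> f k x = f' k x) -> (forall x, D x -> u x = u' x) ->
  l2_cvg f u -> l2_cvg f' u'.
Proof.
move=> ff uu [sf su fu]; split.
- by move=> k; apply: eq_sqint (sf k) => x /set_mem Dx; rewrite ff.
- by apply: eq_sqint su => x /set_mem Dx; rewrite uu.
rewrite (_ : (fun k => _) = (fun k => dot (fun x => u x - f k x) (fun x => u x - f k x))) //.
by apply/funext => k; apply: eq_l2dot => x Dx; rewrite -ff // -uu.
Qed.

End L2Convergence.

Lemma cvg_sum_fin (R : realType) (I : Type) (r : seq I) (f : I -> nat -> R) (l : I -> R) :
  (forall i, f i @ \oo --> l i) ->
  (fun k => \sum_(i <- r) f i k) @ \oo --> \sum_(i <- r) l i.
Proof.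
move=> fl; elim: r => [|i r IH].
  by rewrite big_nil; under eq_fun do rewrite big_nil; exact: cvg_cst.
by rewrite big_cons; under eq_fun do rewrite big_cons; exact: (cvgD (fl i) IH).
Qed.

Section L2Norm.
Variable R : realType.
Local Notation D := (halfplane R : set (plane R)).
Local Notation mu := (lebesgue2 R).
Local Notation dot := (l2dot mu D).
Variable I : finType.
Implicit Type f : I -> R * R -> R.

Let mD : measurable D := @measurable_halfplane R.

Lemma integral_sum_sqr f : (forall i, measurable_fun D (f i)) ->
  (\int[mu]_(x in D) (\sum_i `|f i x| ^+ 2)%:E = \sum_i \int[mu]_(x in D) (f i x ^+ 2)%:E)%E.
Proof.
move=> mf; rewrite -ge0_integral_sum //.
- apply: eq_integral => x _; rewrite sumEFin; congr _%:E; apply: eq_bigr => i _.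
  by rewrite real_normK ?num_real.
- by move=> i; apply/measurable_EFinP; exact: measurable_funX.
- by move=> i x _; rewrite lee_fin sqr_ge0.
Qed.

Lemma L2norm_sqint f : (forall i, sqint mu D (f i)) ->
  L2norm (halfplane R) f = (Num.sqrt (\sum_i dot (f i) (f i)))%:E.
Proof.
move=> sf; rewrite /L2norm integral_sum_sqr; last by move=> i; case: (sf i).
under eq_bigr => i _ do rewrite (integral_sqr mD (sf i)).
by rewrite sumEFin.
Qed.

Lemma L2_sqint f : L2 f -> forall i, sqint mu D (f i).
Proof.
move=> [mf]; rewrite /L2norm integral_sum_sqr // => h i; split; first exact: mf.
have {h} : (\sum_i \int[mu]_(x in D) (f i x ^+ 2)%:E < +oo)%E.
  by move: h; case: (\sum_i _)%E => [r||]; rewrite ?ltry // /sqrte ltxx.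
apply: le_lt_trans; rewrite (bigD1 i) //= leeDl //; apply: sume_ge0 => k _.
by apply: integral_ge0 => x _; rewrite lee_fin sqr_ge0.
Qed.

Lemma sqint_L2 f : (forall i, sqint mu D (f i)) -> L2 f.
Proof. by move=> sf; split; [move=> i; case: (sf i)|rewrite L2norm_sqint // ltry]. Qed.

Lemma L2norm_cvg0 (f : nat -> I -> R * R -> R) (u : I -> R * R -> R) :
  (forall i, l2_cvg mu D (fun k => f k i) (u i)) ->
  (fun k => L2norm (halfplane R) (fun i x => f k i x - u i x)) @ \oo --> 0%E.
Proof.
move=> fu; pose w k i x := f k i x - u i x.
have sw k i : sqint mu D (w k i) by have [s1 s2 _] := fu i; exact: sqintB (s1 k) s2.
have -> : (fun k => L2norm (halfplane R) (w k)) =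
    (fun k => (Num.sqrt (\sum_i dot (w k i) (w k i)))%:E).
  by apply/funext => k; exact: L2norm_sqint.
apply: cvg_EFin; first exact: nearW.
have h : (fun k => \sum_i dot (w k i) (w k i)) @ \oo --> (0 : R).
  have wi i : (fun k => dot (w k i) (w k i)) @ \oo --> (0 : R).
    have [_ _] := fu i; rewrite (_ : (fun k => _) = (fun k => dot (w k i) (w k i))) //.
    by apply/funext => k; apply: eq_Rintegral => x _; rewrite /w; ring.
  by have := cvg_sum_fin (r := index_enum I) wi; rewrite big1.
by rewrite -[X in _ --> X]sqrtr0; apply: (continuous_cvg _ _ h); exact: sqrt_continuous.
Qed.

End L2Norm.

(** * The Hardy weight, its square root and the three weights *)

Section Weights.
Variable R : realType.
Local Notation D := (halfplane R : set (plane R)).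
Local Notation mu := (lebesgue2 R).
Local Notation dot := (l2dot mu D).
Implicit Types (f g : R * R -> R) (x : R * R).

Let mD : measurable D := @measurable_halfplane R.

Lemma hardy_weight_ge x : halfplane R x -> 4 * inv_height x ^+ 2 <= hardy_weight x.
Proof.
by move=> Dx; rewrite /hardy_weight lerDl mulr_ge0 ?invr_ge0 ?(ltW Dx) // sqrtr_ge0.
Qed.

(** Multiplication by it turns the weighted norm into a plain L^2 norm, for which [l2_complete] is
    available; its inverse is at most [x.2 / 2], so dividing it out again is harmless at bounded
    height. *)
Definition root_weight x : R := Num.sqrt (hardy_weight x).

Lemma root_weight_ge x : halfplane R x -> 2 / x.2 <= root_weight x.
Proof.
move=> Dx; have h : 0 <= 2 / x.2 by rewrite divr_ge0 // ltW.
rewrite -(ger0_norm h) -sqrtr_sqr; apply: ler_wsqrtr; apply: le_trans (hardy_weight_ge Dx).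
rewrite exprMn /inv_height; lra.
Qed.

Lemma root_weight_gt0 x : halfplane R x -> 0 < root_weight x.
Proof. by move=> Dx; apply: lt_le_trans (root_weight_ge Dx); rewrite divr_gt0. Qed.

Lemma root_weight_sqr x : halfplane R x -> root_weight x ^+ 2 = hardy_weight x.
Proof.
move=> Dx; rewrite sqr_sqrtr //; apply: le_trans (hardy_weight_ge Dx).
by rewrite mulr_ge0 // sqr_ge0.
Qed.

Lemma root_weight_inv_le x : halfplane R x -> (root_weight x)^-1 <= x.2 / 2.
Proof.
move=> Dx; rewrite -[x.2 / 2]invrK invf_div lef_pV2 ?posrE ?root_weight_gt0 ?divr_gt0 //.
exact: root_weight_ge.
Qed.

Lemma continuous_root_weight x : halfplane R x -> {for x, continuous root_weight}.
Proof.
move=> Dx; apply: (@continuous_comp _ _ _ (@hardy_weight R) Num.sqrt).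
  exact: continuous_hardy_weight.
exact: sqrt_continuous.
Qed.

Lemma measurable_on_halfplane (c : R * R -> R) :
  (forall x, halfplane R x -> {for x, continuous c}) -> measurable_fun D c.
Proof. by move=> h; apply: open_continuous_measurable_plane => //; exact: open_halfplane. Qed.

Lemma measurable_root_weight_inv : measurable_fun D (fun x => (root_weight x)^-1).
Proof.
apply: measurable_on_halfplane => x Dx; apply: cvgV; first by rewrite gt_eqF ?root_weight_gt0.
exact: continuous_root_weight.
Qed.

Lemma root_weight_cc f : test_function f -> cc_fun (fun x => f x * root_weight x).
Proof. by move=> tf; apply: test_cc_mul => // x; exact: continuous_root_weight. Qed.

Lemma hardy_root f : test_function f ->
  dot (fun x => f x * root_weight x) (fun x => f x * root_weight x) <=
  16 * \sum_(j < 2) dot (partial j f) (partial j f).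
Proof.
move=> tf; apply: le_trans (hardy_test tf); apply: eq_le_refl; apply: eq_Rintegral => x /set_mem Dx.
by rewrite -root_weight_sqr //; ring.
Qed.

Lemma omega_inverse (omega : R * R -> R) :
  [set omega0 R; omega1 R; omega2 R] omega ->
  exists w : R * R -> R, (forall x, halfplane R x -> {for x, continuous w}) /\
    forall x, halfplane R x -> (omega x)^-1 = w x /\ 0 <= w x <= hardy_weight x.
Proof.
have h0 x : halfplane R x -> 0 <= inv_height x by move=> Dx; rewrite invr_ge0 ltW.
have r0 x : halfplane R x -> 0 <= inv_radius x by move=> Dx; rewrite invr_ge0 sqrtr_ge0.
have hc := @continuous_inv_height R; have rc := @continuous_inv_radius R.
have e0 := @eucl_gt0 R.
case => [[->|->]|->].
- exists (@hardy_weight R); split; first exact: continuous_hardy_weight.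
  move=> x Dx; have x0 : 0 < x.2 by []; have ex := e0 x Dx; split; last first.
    by rewrite lexx andbT; apply: le_trans (hardy_weight_ge Dx); rewrite mulr_ge0 // sqr_ge0.
  rewrite /omega0 /hardy_weight /inv_height /inv_radius (gtr0_norm x0).
  by field; rewrite !gt_eqF //= addr_gt0 // mulr_gt0.
- exists (fun x => inv_height x * inv_radius x); split.
    by move=> x Dx; exact: (cvgM (hc x Dx) (rc x Dx)).
  move=> x Dx; have x0 : 0 < x.2 by []; split.
    by rewrite /omega1 (gtr0_norm x0) invfM.
  by rewrite mulr_ge0 ?h0 ?r0 //= /hardy_weight lerDr mulr_ge0 // sqr_ge0.
- exists (fun x => 4 * (inv_height x * inv_height x)); split.
    by move=> x Dx; exact: (cvgM (cvg_cst _) (cvgM (hc x Dx) (hc x Dx))).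
  move=> x Dx; have x0 : 0 < x.2 by []; split.
    by rewrite /omega2 (gtr0_norm x0) invf_div expr2 invfM.
  by rewrite -expr2 hardy_weight_ge // andbT mulr_ge0 // sqr_ge0.
Qed.

End Weights.

(** * The limit field and its gradient *)

Section LimitField.
Variable R : realType.
Local Notation D := (halfplane R : set (plane R)).
Local Notation mu := (lebesgue2 R).
Local Notation dot := (l2dot mu D).
Local Notation E := (solfield R).
Local Notation nrm := (ip_norm (@dirichlet R)).
Implicit Types (f g : R * R -> R) (x : R * R).

Let mD : measurable D := @measurable_halfplane R.

Lemma solfield_partialB (u v : E) i j :
  partial j (solval (u - v) i) = (fun x => partial j (u i) x - partial j (v i) x).
Proof.
have -> : u - v = -1 *: v + u by rewrite scaleN1r addrC.
by rewrite solfield_partial_lin; apply/funext => x; rewrite mulN1r addrC.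
Qed.

Lemma limit_field (psi : nat -> E) :
  (forall k l, nrm (psi k - psi l) <= (1/2) ^+ k + (1/2) ^+ l) ->
  exists (U : 'I_2 -> R * R -> R) (Du : 'I_2 * 'I_2 -> R * R -> R),
    (forall i, l2_cvg mu D (fun k x => psi k i x * root_weight x) (U i)) /\
    (forall ij, l2_cvg mu D (fun k => partial ij.2 (psi k ij.1)) (Du ij)).
Proof.
move=> psiC.
have /choice[U hU] : forall i, exists g, l2_cvg mu D (fun k x => psi k i x * root_weight x) g.
  move=> i.
  have sf k : sqint mu D (fun x => psi k i x * root_weight x).
    exact: cc_sqint (root_weight_cc (solfield_test (psi k) i)).
  (* 4 is the square root of the Hardy constant 16. *)
  have [|g [sg hg]] := @l2_complete _ _ _ mu D mD (fun k x => psi k i x * root_weight x) 4 sf.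
    move=> k l.
    have -> : (fun x => psi k i x * root_weight x - psi l i x * root_weight x) =
        (fun x => (psi k - psi l) i x * root_weight x).
      by apply/funext => x; rewrite -mulrBl.
    apply: le_trans (hardy_root (solfield_test (psi k - psi l) i)) _.
    apply: le_trans (ler_wpM2l _ (dirichlet_field (psi k - psi l) i)) _ => //.
    rewrite -(sqr_sqrtr (dirichlet_ge0 (psi k - psi l))) -/(nrm _).
    have -> : 16 * nrm (psi k - psi l) ^+ 2 = (4 * nrm (psi k - psi l)) ^+ 2 by ring.
    rewrite lerXn2r ?nnegrE ?mulr_ge0 ?ip_norm_ge0 ?addr_ge0 ?exprn_ge0 //.
    by rewrite ler_wpM2l.
  by exists g; apply: (l2_cvg_half (C := 2 * 4)).
have /choice[Du hDu] : forall ij : 'I_2 * 'I_2, exists g,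
    l2_cvg mu D (fun k => partial ij.2 (psi k ij.1)) g.
  move=> [i j] /=.
  have sf k : sqint mu D (partial j (psi k i)) := solfield_partial_sqint (psi k) i j.
  have [|g [sg hg]] := @l2_complete _ _ _ mu D mD (fun k => partial j (psi k i)) 1 sf.
    move=> k l.
    have -> : (fun x => partial j (psi k i) x - partial j (psi l i) x) =
      partial j (solval (psi k - psi l) i) by rewrite solfield_partialB.
    have p0 : 0 <= (1/2 : R) ^+ k + (1/2) ^+ l by rewrite addr_ge0 // exprn_ge0.
    rewrite mul1r -(sqr_sqrtr (l2dot_ge0 mu D _)); apply: lerXn2r; rewrite ?nnegrE ?sqrtr_ge0 //.
    exact: le_trans (dirichlet_norm_component _ i j) (psiC k l).
  by exists g; apply: (l2_cvg_half (C := 2 * 1)).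
by exists U, Du.
Qed.

End LimitField.

Section WeakLimit.
Variable R : realType.
Local Notation D := (halfplane R : set (plane R)).
Local Notation mu := (lebesgue2 R).
Local Notation dot := (l2dot mu D).
Local Notation E := (solfield R).
Implicit Types (f g c : R * R -> R) (x : R * R).

Let mD : measurable D := @measurable_halfplane R.

Lemma indic_sqint (A : set (plane R)) : measurable A -> (mu A < +oo)%E -> sqint mu D \1_A.
Proof.
move=> mA fA; split; first exact: measurable_indic.
rewrite (eq_integral (EFin \o \1_A)); last first.
  by move=> x _; rewrite /= indicE; case: (_ \in _); rewrite ?expr1n ?expr0n.
rewrite integral_indic //; apply: le_lt_trans fA.
by apply: le_measure; rewrite ?inE //; exact: measurableI.
Qed.

Lemma compact_subset_square (K : set (R * R)) : compact K ->
  exists2 M : R, 0 < M & K `<=` square M.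
Proof.
move=> /compact_bounded[B [_ hB]]; exists (Num.max 1 (B + 1)); first by rewrite lt_max ltr01.
move=> x Kx; have := hB (B + 1) _ x Kx; rewrite ltrDl ltr01 => /(_ isT).
rewrite [X in X -> _]/= prod_normE ge_max !ler_norml => /andP[/andP[h1 h2] /andP[h3 h4]].
set M := Num.max _ _; have BM : B + 1 <= M by rewrite le_max lexx orbT.
by split; rewrite /= in_itv /=; apply/andP; split; lra.
Qed.

Variables (psi : nat -> E) (U : 'I_2 -> R * R -> R) (Du : 'I_2 * 'I_2 -> R * R -> R).
Hypothesis hU : forall i, l2_cvg mu D (fun k x => psi k i x * root_weight x) (U i).
Hypothesis hDu : forall ij, l2_cvg mu D (fun k => partial ij.2 (psi k ij.1)) (Du ij).

Definition unweight (V : 'I_2 -> R * R -> R) i x := V i x / root_weight x.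
Local Notation u := (unweight U).

Lemma unweight_measurable i : measurable_fun D (u i).
Proof.
apply: measurable_funM; last exact: measurable_root_weight_inv.
by have [_ [] ] := hU i.
Qed.

(** A bounded multiplier supported at height at most [M] stays bounded after division by
    [root_weight], so the convergence of the weighted fields passes to the fields themselves. *)
Lemma unweight_local_cvg c (B M : R) i : measurable_fun D c ->
  (forall x, `|c x| <= B) -> (forall x, c x != 0 -> x.2 <= M) ->
  l2_cvg mu D (fun k x => psi k i x * c x) (fun x => u i x * c x).
Proof.
move=> mc cB cM.
have B0 : 0 <= B := le_trans (normr_ge0 _) (cB (0, 0)).
have h : l2_cvg mu D (fun k x => psi k i x * root_weight x * (c x / root_weight x))
    (fun x => U i x * (c x / root_weight x)).
  apply: (@l2_cvgM _ _ _ _ _ mD _ _ _ (B * (`|M| / 2))) (hU i).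
    by apply: measurable_funM => //; exact: measurable_root_weight_inv.
  move=> x Dx; rewrite normrM; have [->|cx] := eqVneq (c x) 0.
    by rewrite normr0 mul0r mulr_ge0 // divr_ge0.
  apply: ler_pM => //; rewrite ger0_norm ?invr_ge0 ?sqrtr_ge0 //.
  apply: le_trans (root_weight_inv_le Dx) _.
  by rewrite ler_pM2r // (le_trans (cM x cx)) // ler_norm.
apply: eq_l2_cvg h.
- by move=> k x Dx; field; rewrite gt_eqF // root_weight_gt0.
- by move=> x Dx; rewrite /unweight; ring.
Qed.

Lemma unweight_cc_cvg c i : cc_fun c ->
  l2_cvg mu D (fun k x => psi k i x * c x) (fun x => u i x * c x).
Proof.
move=> cc; have [B B0 cB] := cc_bounded cc; have [_ [M hM]] := cc.
apply: (@unweight_local_cvg c B M) => //; first by case: (cc_sqint cc).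
by move=> x /hM[_ _ /ltW].
Qed.

Lemma unweight_indic_cvg (A : set (R * R)) (M : R) i : measurable (A : set (plane R)) ->
  (forall x, A x -> x.2 <= M) ->
  l2_cvg mu D (fun k x => psi k i x * \1_A x) (fun x => u i x * \1_A x).
Proof.
move=> mA AM; apply: (@unweight_local_cvg \1_A 1 M).
- exact: measurable_indic.
- by move=> x; rewrite indicE normr_nat lern1 leq_b1.
- by move=> x; rewrite indicE; case: (boolP (x \in A)) => [/set_mem/AM//|]; rewrite eqxx.
Qed.

Lemma unweight_dot_cvg g i : cc_fun g -> (fun k => dot (psi k i) g) @ \oo --> dot (u i) g.
Proof.
move=> cg; have [M [B [M0 B0 _ hM]]] := cc_family (fun _ : unit => cg).
have sM x : strip M x -> x.2 <= M by move=> [_]; rewrite /= in_itv /= => /andP[_ /ltW].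
have := l2_cvg_dot mD (unweight_indic_cvg i (measurable_strip M) sM) (l2_cvg_cst (cc_sqint cg)).
have e v : dot (fun x => v x * \1_(strip M) x) g = dot v g.
  by apply: eq_Rintegral => x _; rewrite -[in RHS](hM tt) -mulrA (mulrC (g x)).
by rewrite e; under eq_fun do rewrite e.
Qed.

Lemma unweight_L1loc i : L1loc (u i).
Proof.
split; first exact: unweight_measurable.
move=> K cK KD; have mK := compact_measurable_plane cK.
have [M M0 KM] := compact_subset_square cK.
have KM2 x : K x -> x.2 <= M by move=> /KM[_]; rewrite /= in_itv /= => /andP[].
have [_ sK _] := unweight_indic_cvg i mK KM2.
have fK : (mu K < +oo)%E.
  apply: le_lt_trans (square_lty M); apply: le_measure; rewrite ?inE //.
  exact: measurable_square.
have := sqint_mul mD sK (indic_sqint mK fK).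
move=> /(integrableS mD mK KD); apply: eq_integrable => // x xK /=.
by rewrite indicE xK !mulr1.
Qed.

Lemma solfield_by_parts (v : E) g i j : test_function g ->
  dot (v i) (partial j g) = - dot (partial j (v i)) g.
Proof.
move=> tg; apply/eqP; rewrite -addr_eq0; apply/eqP.
have cv := solfield_cc v i; have cg := test_cc tg.
have cv' := solfield_partial_cc v i j; have cg' := test_partial_cc j tg.
have ca := cc_mul cv cg'.1; have cb := cc_mul cv' cg.1.
rewrite /l2dot -RintegralD //; [|exact: cc_integrableD|exact: cc_integrableD].
apply: (@cc_int_partial R j (fun x => v i x * g x)).
- have -> : (fun x => v i x * partial j g x + partial j (v i) x * g x) =
    (fun x => 1 * (v i x * partial j g x) + partial j (v i) x * g x).
    by apply/funext => x; rewrite mul1r.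
  exact: cc_lin.
- by case: (cc_mul cv cg.1).
move=> x; rewrite [X in is_derive _ _ _ (_ + X)]mulrC; apply: is_derive_mul.
  exact: test_is_derive (solfield_test v i).
exact: test_is_derive.
Qed.

(** Each [psi k] satisfies the formula by integration by parts, and both sides converge: the fields
    against the compactly supported derivative of the test function, the gradients in L^2. *)
Lemma unweight_weak_gradient : weak_gradient u Du.
Proof.
move=> i j g tg; rewrite -/(dot (u i) (partial j g)) -/(dot (Du (i, j)) g).
have h1 := unweight_dot_cvg (i := i) (test_partial_cc j tg).
have h2 := l2_cvg_dot mD (hDu (i, j)) (l2_cvg_cst (cc_sqint (test_cc tg))).
have e : (fun k => dot (psi k i) (partial j g)) = (fun k => - dot (partial j (psi k i)) g).
  by apply/funext => k; exact: solfield_by_parts.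
rewrite e in h1; exact: (cvg_unique _ h1 (cvgN h2)).
Qed.

Lemma unweight_L2norm_cvg (K : set (R * R)) : compact K -> K `<=` halfplane R ->
  (fun k => L2norm K (fun i x => psi k i x - u i x)) @ \oo --> 0%E.
Proof.
move=> cK KD; have mK := compact_measurable_plane cK.
have [M M0 KM] := compact_subset_square cK.
have KM2 x : K x -> x.2 <= M by move=> /KM[_]; rewrite /= in_itv /= => /andP[].
pose w k i x := psi k i x * \1_K x - u i x * \1_K x.
have sw k i : sqint mu D (w k i).
  by have [s1 s2 _] := unweight_indic_cvg i mK KM2; exact: sqintB (s1 k) s2.
have le k : (L2norm K (fun i x => (psi k i x - u i x)%R) <= L2norm (halfplane R) (w k))%E.
  rewrite /L2norm lee_sqrt; last first.
    by apply: integral_ge0 => x _; rewrite lee_fin sumr_ge0.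
  have -> : (\int[mu]_(x in K) (\sum_i `|psi k i x - u i x| ^+ 2)%:E =
      \int[mu]_(x in K) (\sum_i `|w k i x| ^+ 2)%:E)%E.
    apply: eq_integral => x xK; congr _%:E; apply: eq_bigr => i _.
    by rewrite /w indicE xK !mulr1.
  apply: ge0_subset_integral => //.
  - apply/measurable_EFinP; apply: measurable_sum => i; apply: measurable_funX.
    by apply: measurableT_comp => //; case: (sw k i).
  - by move=> x _; rewrite lee_fin sumr_ge0.
have w0 : (fun k => L2norm (halfplane R) (w k)) @ \oo --> 0%E.
  exact: (@L2norm_cvg0 R _ (fun k i x => psi k i x * \1_K x) (fun i x => u i x * \1_K x)
    (fun i => unweight_indic_cvg i mK KM2)).
apply: squeeze_cvge (cvg_cst 0%E) w0; near=> k; rewrite le andbT; exact: sqrte_ge0.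
Unshelve. all: by end_near.
Qed.

End WeakLimit.

Lemma Rintegral_sum_fin d (T : measurableType d) (R : realType)
    (mu : {measure set T -> \bar R}) (D : set T) (I : Type) (r : seq I) (f : I -> T -> R) :
  measurable D -> (forall i, mu.-integrable D (EFin \o f i)) ->
  \int[mu]_(x in D) (\sum_(i <- r) f i x) = \sum_(i <- r) \int[mu]_(x in D) f i x.
Proof.
move=> mD fi; suff [] : mu.-integrable D (EFin \o (fun x => \sum_(i <- r) f i x)) /\
  \int[mu]_(x in D) (\sum_(i <- r) f i x) = \sum_(i <- r) \int[mu]_(x in D) f i x by [].
elim: r => [|i r [IHi IHe]].
  have -> : (fun x => \sum_(i <- [::]) f i x) = (fun=> 0) by apply/funext => x; rewrite big_nil.
  by split; [exact: integrable0|rewrite big_nil /Rintegral integral0].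
have -> : (fun x => \sum_(j <- i :: r) f j x) = (fun x => f i x + \sum_(j <- r) f j x).
  by apply/funext => x; rewrite big_cons.
by split; [exact: (integrableD mD (fi i) IHi)|rewrite RintegralD // big_cons IHe].
Qed.

Lemma sum_pair (R : nmodType) (I J : finType) (f : I * J -> R) :
  \sum_ij f ij = \sum_i \sum_j f (i, j).
Proof. by rewrite pair_bigA; apply: eq_bigr => -[]. Qed.

Lemma l2dot_mean d (T : measurableType d) (R : realType) (mu : {measure set T -> \bar R})
    (D : set T) (f g : T -> R) : measurable D -> sqint mu D f -> sqint mu D g ->
  2 * l2dot mu D f g <= l2dot mu D f f + l2dot mu D g g.
Proof.
move=> mD sf sg; have := l2dot_cs mD sf sg; move=> /(le_trans (ler_norm _)) h.
have sq v : Num.sqrt (l2dot mu D v v) ^+ 2 = l2dot mu D v v by rewrite sqr_sqrtr // l2dot_ge0.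
rewrite -(sq f) -(sq g); move: h; move: (Num.sqrt _) (Num.sqrt _) (l2dot _ _ _ _) => a b p h.
by have := sqr_ge0 (a - b); nra.
Qed.

Section Limit.
Variable R : realType.
Local Notation D := (halfplane R : set (plane R)).
Local Notation mu := (lebesgue2 R).
Local Notation dot := (l2dot mu D).
Local Notation E := (solfield R).
Implicit Types (x : R * R).

Let mD : measurable D := @measurable_halfplane R.

Variables (psi : nat -> E) (U : 'I_2 -> R * R -> R) (Du : 'I_2 * 'I_2 -> R * R -> R).
Hypothesis hU : forall i, l2_cvg mu D (fun k x => psi k i x * root_weight x) (U i).
Hypothesis hDu : forall ij, l2_cvg mu D (fun k => partial ij.2 (psi k ij.1)) (Du ij).
Local Notation u := (unweight U).

(** The convection is regrouped as [psi k j * w i] times a derivative of [psi k i]: by the compact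
    support of [w] the first factor converges strongly in L^2, and so does the gradient. *)
Lemma weak_form_cvg (w : E) :
  (fun k => dirichlet (psi k) w + convection (psi k) (psi k) w) @ \oo -->
  \sum_(i < 2) \int[mu]_(x in D)
    (\sum_(j < 2) Du (i, j) x * partial j (w i) x + (\sum_(j < 2) u j x * Du (i, j) x) * w i x).
Proof.
have lin (i : 'I_2) : \int[mu]_(x in D)
    (\sum_(j < 2) Du (i, j) x * partial j (w i) x + (\sum_(j < 2) u j x * Du (i, j) x) * w i x) =
    \sum_(j < 2) dot (Du (i, j)) (partial j (w i)) +
    \sum_(j < 2) dot (fun x => u j x * w i x) (Du (i, j)).
  rewrite -big_split /=.
  transitivity (\int[mu]_(x in D) (\sum_(j < 2)
    (Du (i, j) x * partial j (w i) x + u j x * w i x * Du (i, j) x))).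
    apply: eq_Rintegral => x _; rewrite big_split /= mulr_suml; congr (_ + _).
    by apply: eq_bigr => j _; rewrite mulrAC.
  have sDu j : sqint mu D (Du (i, j)) by have [] := hDu (i, j).
  have sw j : sqint mu D (fun x => u j x * w i x).
    by have [] := unweight_cc_cvg hU j (solfield_cc w i).
  have i1 j := sqint_mul mD (sDu j) (solfield_partial_sqint w i j).
  have i2 j := sqint_mul mD (sw j) (sDu j).
  rewrite Rintegral_sum_fin //; last by move=> j; exact: (integrableD mD (i1 j) (i2 j)).
  by apply: eq_bigr => j _; rewrite RintegralD.
under eq_bigr => i _ do rewrite lin.
have h1 i j := l2_cvg_dot mD (hDu (i, j)) (l2_cvg_cst (solfield_partial_sqint w i j)).
have h2 i j : (fun k => dot (fun x => psi k j x * partial j (psi k i) x) (w i)) @ \oo -->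
    dot (fun x => u j x * w i x) (Du (i, j)).
  have := l2_cvg_dot mD (unweight_cc_cvg hU j (solfield_cc w i)) (hDu (i, j)).
  rewrite (_ : (fun k => _) = (fun k => dot (fun x => psi k j x * partial j (psi k i) x) (w i))) //.
  by apply/funext => k; apply: eq_Rintegral => x _ /=; ring.
rewrite big_split /=.
exact: (cvgD (cvg_sum_fin (fun i => cvg_sum_fin (h1 i))) (cvg_sum_fin (fun i => cvg_sum_fin (h2 i)))).
Qed.

Lemma dirichlet_cvg : (fun k => dirichlet (psi k) (psi k)) @ \oo -->
  \sum_ij dot (Du ij) (Du ij).
Proof.
rewrite sum_pair.
exact: (cvg_sum_fin (fun i => cvg_sum_fin (fun j => l2_cvg_dot mD (hDu (i, j)) (hDu (i, j))))).
Qed.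

Lemma force_cvg (F : 'I_2 * 'I_2 -> R * R -> R) : (forall ij, sqint mu D (F ij)) ->
  (fun k => force F (psi k)) @ \oo --> \sum_ij dot (F ij) (Du ij).
Proof.
move=> sF; rewrite sum_pair.
exact: (cvg_sum_fin (fun i => cvg_sum_fin (fun j =>
  l2_cvg_dot mD (l2_cvg_cst (sF (i, j))) (hDu (i, j))))).
Qed.

Lemma inner_L2_dot (F : 'I_2 * 'I_2 -> R * R -> R) : (forall ij, sqint mu D (F ij)) ->
  inner_L2 Du F = \sum_ij dot (F ij) (Du ij).
Proof.
move=> sF; rewrite sum_pair.
apply: eq_bigr => i _; rewrite Rintegral_sum_fin //.
  by apply: eq_bigr => j _; exact: l2dotC.
by move=> j; apply: sqint_mul => //; have [] := hDu (i, j).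
Qed.

Lemma hardy_limit : \sum_i dot (U i) (U i) <= 16 * \sum_ij dot (Du ij) (Du ij).
Proof.
have c1 : (fun k => \sum_i dot (fun x => psi k i x * root_weight x)
    (fun x => psi k i x * root_weight x)) @ \oo --> \sum_i dot (U i) (U i).
  exact: (cvg_sum_fin (fun i => l2_cvg_dot mD (hU i) (hU i))).
have c2 : (fun k => 16 * dirichlet (psi k) (psi k)) @ \oo --> 16 * \sum_ij dot (Du ij) (Du ij).
  exact: (cvgMr dirichlet_cvg).
apply: (ler_cvg_to c1 c2); apply: nearW => k; rewrite /dirichlet mulr_sumr.
by apply: ler_sum => i _; exact: hardy_root (solfield_test (psi k) i).
Qed.

(** Pointwise, u^2 / omega is at most u^2 times [hardy_weight], which is U^2. *)
Lemma weighted_L2norm_le (omega w : R * R -> R) :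
  (forall x, halfplane R x -> {for x, continuous w}) ->
  (forall x, halfplane R x -> (omega x)^-1 = w x /\ 0 <= w x <= hardy_weight x) ->
  (weighted_L2norm (fun x => (omega x)^-1%R) u <= L2norm (halfplane R) U)%E.
Proof.
move=> cw hw.
have sU i : sqint mu D (U i) by have [] := hU i.
rewrite /weighted_L2norm /L2norm lee_sqrt; last first.
  by apply: integral_ge0 => x _; rewrite lee_fin sumr_ge0.
have -> : (\int[mu]_(x in D) ((\sum_i `|u i x| ^+ 2) * (omega x)^-1)%:E =
    \int[mu]_(x in D) ((\sum_i `|u i x| ^+ 2) * w x)%:E)%E.
  by apply: eq_integral => x /set_mem /hw[-> _].
apply: ge0_le_integral => //.
- by move=> x /hw[_ /andP[w0 _]]; rewrite lee_fin mulr_ge0 // sumr_ge0.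
- apply/measurable_EFinP; apply: measurable_funM; last exact: measurable_on_halfplane.
  apply: measurable_sum => i; apply: measurable_funX; apply: measurableT_comp => //.
  exact: unweight_measurable hU i.
- apply/measurable_EFinP; apply: measurable_sum => i; apply: measurable_funX.
  by apply: measurableT_comp => //; case: (sU i).
move=> x Dx; have [_ /andP[w0 wh]] := hw x Dx; rewrite lee_fin mulr_suml; apply: ler_sum => i _.
apply: le_trans (ler_wpM2l _ wh) _; first by rewrite sqr_ge0.
rewrite -root_weight_sqr // -(ger0_norm (ltW (root_weight_gt0 Dx))) -exprMn -normrM.
by rewrite /unweight divfK // gt_eqF // root_weight_gt0.
Qed.

End Limit.

Theorem theorem1p2 (R : realType) (F : 'I_2 * 'I_2 -> R * R -> R) (hF : L2 F) :
  exists (u : 'I_2 -> R * R -> R) (Du : 'I_2 * 'I_2 -> R * R -> R),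
    [/\ weak_solution F u Du,
        (L2norm (halfplane R) Du ^+ 2 <= (inner_L2 Du F)%:E)%E,
        (L2norm (halfplane R) Du <= L2norm (halfplane R) F)%E
      & forall omega : R * R -> R,
          [set omega0 R; omega1 R; omega2 R] omega ->
          (weighted_L2norm (fun x => (omega x)^-1%R) u
             <= 4%:E * L2norm (halfplane R) F)%E].
Proof.
have mD := @measurable_halfplane R; have sF := L2_sqint hF.
have [psi [psiC psiE psiN]] := stationary_approx (@dirichletL R) (@dirichletC R)
  (@dirichlet_ge0 R) (forceB sF) (@convectionL1 R) (@convectionL2 R) (@convectionL3 R)
  (@convection_skew R) (@convection_compact R).
have [U [Du [hU hDu]]] := limit_field psiC.
have sDu ij : sqint (lebesgue2 R) (halfplane R) (Du ij) by have [] := hDu ij.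
have sU i : sqint (lebesgue2 R) (halfplane R) (U i) by have [] := hU i.
have cD := dirichlet_cvg hDu; have cF := force_cvg hDu sF; have IF := inner_L2_dot hDu sF.
have HU := hardy_limit hU hDu.
set S := \sum_ij _ in cD HU; set P := \sum_ij _ in cF IF.
pose T := \sum_ij l2dot (lebesgue2 R) (halfplane R) (F ij) (F ij).
have S0 : 0 <= S by apply: sumr_ge0 => ij _; exact: l2dot_ge0.
(* The energy inequality: the approximate ones hold up to any [e], and both of their sides
   converge. *)
have SP : S <= P.
  apply/ler_addgt0Pr => e e0.
  apply: (ler_cvg_to cD (cvgD cF (cvg_cst e))).
  exact: psiN.
(* Young's inequality; together with [S <= P] it gives [S <= T], the bound of the gradient by the
   force. *)
have PT : 2 * P <= T + S.
  rewrite mulr_sumr -big_split; apply: ler_sum => ij _ /=.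
  exact: l2dot_mean.
have ST : S <= T by clear -SP PT; lra.
have NF : L2norm (halfplane R) F = (Num.sqrt T)%:E by exact: L2norm_sqint.
have NDu : L2norm (halfplane R) Du = (Num.sqrt S)%:E by exact: L2norm_sqint.
exists (unweight U), Du; split.
- split.
    split; first split; first exact: unweight_L1loc hU.
    - exact: unweight_weak_gradient hU hDu.
    - exact: sqint_L2.
    exists (fun k => solval (psi k)); split.
    - by move=> k; have := solvalP (psi k) => /asboolP.
    - exact: (L2norm_cvg0 (f := fun k => grad (psi k))).
    - exact: unweight_L2norm_cvg hU.
  move=> phi tphi.
  have sphi : phi \in @solenoidal R by apply/asboolP.
  pose w := SolField sphi.
  have c1 := weak_form_cvg hU hDu (w := w).
  have -> : \sum_(i < 2) \int[lebesgue2 R]_(x in halfplane R)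
      (\sum_(j < 2) F (i, j) x * partial j (phi i) x) = force F w.
    apply: eq_bigr => i _; rewrite Rintegral_sum_fin // => j.
    by apply: sqint_mul => //; exact: solfield_partial_sqint w i j.
  (* The same sequence tends to the left side by [weak_form_cvg] and to the force by [psiE]. *)
  apply: (cvg_unique _ c1) => //.
  apply/cvgrPdist_le => e e0; have := psiE w e e0; apply: filterS => k.
  by rewrite distrC.
- by rewrite NDu IF -EFin_expe lee_fin sqr_sqrtr.
- by rewrite NF NDu lee_fin ler_wsqrtr.
move=> omega /omega_inverse[w [cw hw]].
apply: le_trans (weighted_L2norm_le hU cw hw) _.
rewrite L2norm_sqint // NF -EFinM lee_fin.
apply: (@le_trans _ _ (Num.sqrt (16 * T))).
  by apply: ler_wsqrtr; apply: le_trans HU _; rewrite ler_wpM2l.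
rewrite sqrtrM // (_ : 16 = 4 ^+ 2 :> R) ?sqrtr_sqr ?ger0_norm //; ring.
Qed.
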